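(* Let $k$ be an algebraically closed field with $\operatorname{char}(k)=p\geqslant 5$. Let $\mathcal{C}$ be a connected skeletal finite EI category with three objects such that the automorphism groups of all objects are $p$-groups. Then $k\mathcal{C}$ is of finite representation type if and only if $\mathcal{C}$ or $\mathcal{C}^{\mathrm{op}}$ satisfies one of the following conditions: (1) it lies in the first family; (2) it lies in the second family and $s=0$; (3) it lies in the second family and $r=t=0$.
   Context: A finite EI category is a small category with finitely many morphisms in which every endomorphism is an isomorphism. Its category algebra $k\mathcal{C}$ is the $k$-algebra with basis the set of all morphisms, the product of two morphisms being their composite if it exists and $0$ otherwise. It is of finite representation type if it has only finitely many isomorphism classes of finitely generated indecomposable left modules. The two families consist of skeletal finite EI categories with three distinct objects, which can be named $x,y,z$, whose automorphism groups $G=\operatorname{Aut}(x)$, $H=\operatorname{Aut}(y)$, $L=\operatorname{Aut}(z)$ are cyclic $p$-groups (possibly trivial) of orders $|G|=p^r$, $|H|=p^s$, $|L|=p^t$, with at most one morphism between any ordered pair of distinct objects. First family: the only morphisms between distinct objects are $\alpha:x\to y$, $\beta:y\to z$ and the composite $\beta\alpha:x\to z$. Second family: the only morphisms between distinct objects are $\alpha:x\to y$ and $\beta:z\to y$. (In all cases the automorphism groups necessarily act trivially on the one-element morphism sets.) *)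

(* Defs.v *)
From HB Require Import structures.
From mathcomp Require Import all_boot all_order all_algebra all_fingroup all_solvable.

Set Implicit Arguments.
Unset Strict Implicit.
Unset Printing Implicit Defensive.

Import GRing.Theory.
Local Open Scope ring_scope.

(* A category with finitely many morphisms has finitely many objects (its
   identities), so the objects are taken in a finType as well.
   [compc f g] is the composite "f after g". *)
Record fincat := FinCat {
  ob : finType;
  hom : ob -> ob -> finType;
  idc : forall x, hom x x;
  compc : forall x y z, hom y z -> hom x y -> hom x z;
  compA : forall x y z w (f : hom z w) (g : hom y z) (h : hom x y),
    compc f (compc g h) = compc (compc f g) h;
  compId : forall x y (f : hom x y), compc (idc y) f = f;
  compfId : forall x y (f : hom x y), compc f (idc x) = f
}.

Arguments hom : clear implicits.
Arguments idc : clear implicits.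
Arguments compc {f0 x y z} _ _ : rename.

Definition opcat (C : fincat) : fincat :=
  @FinCat (ob C) (fun x y => hom C y x) (idc C)
    (fun x y z f g => compc g f)
    (fun x y z w f g h => esym (compA h g f))
    (fun x y f => compfId f) (fun x y f => compId f).

Definition isoc C x y (f : hom C x y) : bool :=
  [exists g : hom C y x, (compc g f == idc C x) && (compc f g == idc C y)].

Definition EI (C : fincat) : Prop := forall x (f : hom C x x), isoc f.

Definition skeletal (C : fincat) : Prop :=
  forall x y (f : hom C x y), isoc f -> x = y.

Definition cat_connected (C : fincat) : Prop :=
  (exists x : ob C, True) /\
  forall x y : ob C,
    connect (fun a b => (0 < #|hom C a b|) || (0 < #|hom C b a|))%N x y.

Section Automorphisms.
Variables (C : fincat) (x : ob C).

Record autc := MkAut { aut_val :> hom C x x; aut_iso : isoc aut_val }.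

HB.instance Definition _ := [isSub for aut_val].
HB.instance Definition _ := [Finite of autc by <:].

Lemma isoc_id : isoc (idc C x).
Proof. by apply/existsP; exists (idc C x); rewrite !compId eqxx. Qed.

Lemma isoc_comp (f g : hom C x x) : isoc f -> isoc g -> isoc (compc f g).
Proof.
case/existsP=> f' /andP[/eqP f'f /eqP ff']; case/existsP=> g' /andP[/eqP g'g /eqP gg'].
apply/existsP; exists (compc g' f').
by rewrite -!compA (compA f' f) f'f compId g'g (compA g g') gg' compId ff' !eqxx.
Qed.

Definition inv_hom (f : autc) : hom C x x := xchoose (existsP (aut_iso f)).

Lemma inv_homP (f : autc) :
  compc (inv_hom f) f = idc C x /\ compc f (inv_hom f) = idc C x.
Proof. by have /andP[/eqP ? /eqP ?] := xchooseP (existsP (aut_iso f)). Qed.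

Lemma isoc_inv (f : autc) : isoc (inv_hom f).
Proof. by apply/existsP; exists (aut_val f); case: (inv_homP f) => -> ->; rewrite !eqxx. Qed.

Definition aut_one := MkAut isoc_id.
Definition aut_mul (f g : autc) := MkAut (isoc_comp (aut_iso f) (aut_iso g)).
Definition aut_inv (f : autc) := MkAut (isoc_inv f).

Lemma aut_mulA : associative aut_mul.
Proof. by move=> f g h; apply/val_inj; rewrite /= compA. Qed.
Lemma aut_mul1 : left_id aut_one aut_mul.
Proof. by move=> f; apply/val_inj; rewrite /= compId. Qed.
Lemma aut_mulV : left_inverse aut_one aut_inv aut_mul.
Proof. by move=> f; apply/val_inj; case: (inv_homP f). Qed.

HB.instance Definition _ := Finite_isGroup.Build autc aut_mulA aut_mul1 aut_mulV.
End Automorphisms.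

Arguments autc : clear implicits.

Definition mor (C : fincat) : finType :=
  {xy : ob C * ob C & hom C xy.1 xy.2}.

Definition Mor C (x y : ob C) (f : hom C x y) : mor C :=
  Tagged (fun xy : ob C * ob C => hom C xy.1 xy.2) (f : hom C (x, y).1 (x, y).2).

(* Elements are k-valued functions on the set of all morphisms. *)
Definition catalg (k : fieldType) (C : fincat) : Type := {ffun mor C -> k}.

Section CategoryAlgebra.
Variables (k : fieldType) (C : fincat).
Local Notation A := (catalg k C).

HB.instance Definition _ := GRing.Zmodule.copy A {ffun mor C -> k}.

Definition coef (a : A) (m : mor C) : k := (a : {ffun mor C -> k}) m.

Definition basis (x y : ob C) (f : hom C x y) : A :=
  [ffun m => (m == Mor f)%:R] : {ffun mor C -> k}.

(* The bilinear extension of the partial composition of morphisms; see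
   [basis_mul] and [basis_mul0] below for its values on basis elements. *)
Definition catalg_mul (a b : A) : A :=
  [ffun m : mor C => \sum_(y : ob C) \sum_(g : hom C (tag m).1 y)
     \sum_(f : hom C y (tag m).2 | compc f g == tagged m)
       coef a (Mor f) * coef b (Mor g)] : {ffun mor C -> k}.

Definition catalg_one : A := \sum_(x : ob C) basis (idc C x).

Lemma catalgP (a b : A) :
  (forall x y (f : hom C x y), coef a (Mor f) = coef b (Mor f)) -> a = b.
Proof. by move=> eq_ab; apply/ffunP => -[[x y] f]; apply: eq_ab. Qed.

Lemma coefD (a b : A) m : coef (a + b) m = coef a m + coef b m.
Proof. by rewrite /coef ffunE. Qed.

Lemma coef_sum I (r : seq I) (P : pred I) (F : I -> A) m :
  coef (\sum_(i <- r | P i) F i) m = \sum_(i <- r | P i) coef (F i) m.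
Proof. by apply: (big_morph (coef^~ m)) => [a b|]; rewrite ?coefD // /coef ffunE. Qed.

Lemma coef_mul (a b : A) x z (h : hom C x z) :
  coef (catalg_mul a b) (Mor h) =
  \sum_(y : ob C) \sum_(g : hom C x y) \sum_(f : hom C y z | compc f g == h)
    coef a (Mor f) * coef b (Mor g).
Proof. by rewrite [LHS]ffunE. Qed.

Lemma Mor_inj x y : injective (@Mor C x y).
Proof. by move=> f g /eqP; rewrite eq_Tagged => /eqP. Qed.

Lemma coef_basis x y (f g : hom C x y) : coef (basis f) (Mor g) = (g == f)%:R.
Proof. by rewrite [LHS]ffunE (inj_eq (@Mor_inj x y)). Qed.

Lemma coef_basis0 x y x' y' (f : hom C x y) (g : hom C x' y') :
  (x', y') != (x, y) -> coef (basis f) (Mor g) = 0.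
Proof.
move=> neq; rewrite [LHS]ffunE; case: eqP => // /(congr1 tag) /= eq_xy.
by rewrite eq_xy eqxx in neq.
Qed.

Lemma coef_one x (f : hom C x x) : coef catalg_one (Mor f) = (f == idc C x)%:R.
Proof.
rewrite coef_sum (bigD1 x) //= coef_basis big1 ?addr0 // => y neq_yx.
by rewrite coef_basis0 // xpair_eqE negb_and eq_sym neq_yx.
Qed.

Lemma coef_one0 x y (f : hom C x y) : x != y -> coef catalg_one (Mor f) = 0.
Proof.
move=> neq_xy; rewrite coef_sum big1 // => z _; rewrite coef_basis0 // xpair_eqE.
by apply: contra neq_xy => /andP[/eqP-> /eqP->].
Qed.

(* Collapses a sum over the factorizations of a composite. *)
Lemma sum_fiber (I J : finType) (F : I -> k) (G : I -> J) (P : pred J) :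
  \sum_(j | P j) \sum_(i | G i == j) F i = \sum_(i | P (G i)) F i.
Proof.
rewrite (exchange_big_dep (fun i => P (G i))) /= => [|j i Pj /eqP-> //].
by apply: eq_bigr => i PGi; rewrite (big_pred1 (G i)) // => j /=;
  rewrite andb_idl ?[_ == G i]eq_sym // => /eqP <-.
Qed.

Lemma catalg_mulA : associative catalg_mul.
Proof.
move=> a b c; apply: catalgP => x w h; rewrite !coef_mul.
transitivity (\sum_(u : ob C) \sum_(y : ob C) \sum_(g : hom C x y)
   \sum_(g' : hom C y u) \sum_(f : hom C u w | compc f (compc g' g) == h)
     coef a (Mor f) * (coef b (Mor g') * coef c (Mor g))).
  apply: eq_bigr => u _.
  transitivity (\sum_(f : hom C u w) \sum_(l : hom C x u | compc f l == h)
     \sum_(y : ob C) \sum_(g : hom C x y) \sum_(g' : hom C y u | compc g' g == l)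
     coef a (Mor f) * (coef b (Mor g') * coef c (Mor g))).
    rewrite (exchange_big_dep xpredT) //=; apply: eq_bigr => f _.
    apply: eq_bigr => l _; rewrite coef_mul mulr_sumr; apply: eq_bigr => y _.
    by rewrite mulr_sumr; apply: eq_bigr => g _; rewrite mulr_sumr.
  transitivity (\sum_(f : hom C u w) \sum_(y : ob C) \sum_(g : hom C x y)
     \sum_(g' : hom C y u | compc f (compc g' g) == h)
     coef a (Mor f) * (coef b (Mor g') * coef c (Mor g))).
    apply: eq_bigr => f _; rewrite exchange_big /=; apply: eq_bigr => y _.
    by rewrite exchange_big /=; apply: eq_bigr => g _; rewrite sum_fiber.
  rewrite exchange_big /=; apply: eq_bigr => y _.
  rewrite exchange_big /=; apply: eq_bigr => g _.
  by rewrite (exchange_big_dep xpredT).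
rewrite exchange_big /=; apply: eq_bigr => y _.
rewrite exchange_big /=; apply: eq_bigr => g _.
transitivity (\sum_(l : hom C y w | compc l g == h)
     \sum_(u : ob C) \sum_(g' : hom C y u) \sum_(f : hom C u w | compc f g' == l)
     coef a (Mor f) * (coef b (Mor g') * coef c (Mor g))); last first.
  apply: eq_bigr => l _; rewrite coef_mul mulr_suml; apply: eq_bigr => u _.
  rewrite mulr_suml; apply: eq_bigr => g' _; rewrite mulr_suml.
  by apply: eq_bigr => f _; rewrite mulrA.
rewrite exchange_big /=; apply: eq_bigr => u _.
rewrite exchange_big /=; apply: eq_bigr => g' _.
by rewrite sum_fiber; apply: eq_bigl => f; rewrite compA.
Qed.

Lemma basis_mul x y z (f : hom C y z) (g : hom C x y) :
  catalg_mul (basis f) (basis g) = basis (compc f g).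
Proof.
apply: catalgP => x' z' h; rewrite coef_mul.
case: (eqVneq (x', z') (x, z)) h => [[-> ->] h | neq h]; last first.
  rewrite coef_basis0 // big1 // => y' _; rewrite big1 // => g' _.
  rewrite big1 // => f' _; move: neq; rewrite xpair_eqE negb_and.
  by case/orP => neq; [rewrite (coef_basis0 _ g') | rewrite (coef_basis0 _ f')];
    rewrite ?mulr0 ?mul0r // xpair_eqE negb_and neq ?orbT.
rewrite coef_basis (bigD1 y) //= [X in _ + X]big1 ?addr0 => [|y' neq]; last first.
  rewrite big1 // => g' _; rewrite big1 // => f' _.
  by rewrite coef_basis0 ?mul0r // xpair_eqE negb_and neq.
rewrite (bigD1 g) //= [X in _ + X]big1 ?addr0 => [|g' neq]; last first.
  by rewrite big1 // => f' _; rewrite (coef_basis g) (negPf neq) mulr0.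
rewrite big_mkcond (bigD1 f) //= [X in _ + X]big1 ?addr0 => [|f' neq]; last first.
  by rewrite coef_basis (negPf neq) mul0r if_same.
by rewrite !coef_basis !eqxx mulr1 eq_sym; case: eqP.
Qed.

Lemma basis_mul0 x y y' z (f : hom C y' z) (g : hom C x y) :
  y != y' -> catalg_mul (basis f) (basis g) = 0.
Proof.
move=> neq; apply: catalgP => x' z' h; rewrite coef_mul [RHS]ffunE.
rewrite big1 // => u _; rewrite big1 // => g' _; rewrite big1 // => f' _.
case: (eqVneq u y) => [eq_uy | neq_uy].
  by rewrite coef_basis0 ?mul0r // xpair_eqE negb_and eq_uy neq.
by rewrite mulrC coef_basis0 ?mul0r // xpair_eqE negb_and neq_uy orbT.
Qed.

Lemma catalg_mul1 : left_id catalg_one catalg_mul.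
Proof.
move=> a; apply: catalgP => x z h; rewrite coef_mul.
rewrite (bigD1 z) //= [X in _ + X]big1 ?addr0 => [|y neq]; last first.
  by rewrite big1 // => g _; rewrite big1 // => f _; rewrite coef_one0 ?mul0r.
rewrite (bigD1 h) //= [X in _ + X]big1 ?addr0 => [|g neq].
  rewrite (bigD1 (idc C z)) /= ?compId // coef_one eqxx mul1r big1 ?addr0 //.
  by move=> f /andP[_ neq]; rewrite coef_one (negPf neq) mul0r.
rewrite big1 // => f /eqP eq_h; rewrite coef_one; case: eqP => [eq_f | _].
  by rewrite -eq_h eq_f compId eqxx in neq.
by rewrite mul0r.
Qed.

Lemma catalg_mulr1 : right_id catalg_one catalg_mul.
Proof.
move=> a; apply: catalgP => x z h; rewrite coef_mul.
rewrite (bigD1 x) //= [X in _ + X]big1 ?addr0 => [|y neq]; last first.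
  rewrite big1 // => g _; rewrite big1 // => f _.
  by rewrite (coef_one0 g) ?mulr0 // eq_sym.
rewrite (bigD1 (idc C x)) //= [X in _ + X]big1 ?addr0 => [|g neq]; last first.
  by rewrite big1 // => f _; rewrite coef_one (negPf neq) mulr0.
rewrite (eq_bigl (pred1 h)) ?big_pred1_eq => [|f]; last by rewrite compfId.
by rewrite coef_one eqxx mulr1.
Qed.

Lemma catalg_mulDl : left_distributive catalg_mul +%R.
Proof.
move=> a b c; apply: catalgP => x z h; rewrite coefD !coef_mul.
rewrite -big_split /=; apply: eq_bigr => y _.
rewrite -big_split /=; apply: eq_bigr => g _.
by rewrite -big_split /=; apply: eq_bigr => f _; rewrite coefD mulrDl.
Qed.

Lemma catalg_mulDr : right_distributive catalg_mul +%R.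
Proof.
move=> a b c; apply: catalgP => x z h; rewrite coefD !coef_mul.
rewrite -big_split /=; apply: eq_bigr => y _.
rewrite -big_split /=; apply: eq_bigr => g _.
by rewrite -big_split /=; apply: eq_bigr => f _; rewrite coefD mulrDr.
Qed.

(* Only a possibly zero ring, since C may have no object. *)
HB.instance Definition _ := GRing.Zmodule_isPzRing.Build A
  catalg_mulA catalg_mul1 catalg_mulr1 catalg_mulDl catalg_mulDr.

Definition catalg_scale (c : k) (a : A) : A :=
  [ffun m => c * coef a m] : {ffun mor C -> k}.

Lemma coefZ c a m : coef (catalg_scale c a) m = c * coef a m.
Proof. by rewrite [LHS]ffunE. Qed.

Lemma catalg_scaleA c d a :
  catalg_scale c (catalg_scale d a) = catalg_scale (c * d) a.
Proof. by apply: catalgP => x y f; rewrite !coefZ mulrA. Qed.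
Lemma catalg_scale1 : left_id 1 catalg_scale.
Proof. by move=> a; apply: catalgP => x y f; rewrite coefZ mul1r. Qed.
Lemma catalg_scaleDr : right_distributive catalg_scale +%R.
Proof. by move=> c a b; apply: catalgP => x y f; rewrite !(coefZ, coefD) mulrDr. Qed.
Lemma catalg_scaleDl a : {morph catalg_scale^~ a : c d / c + d}.
Proof. by move=> c d; apply: catalgP => x y f; rewrite !(coefZ, coefD) mulrDl. Qed.

HB.instance Definition _ := GRing.Zmodule_isLmodule.Build k A
  catalg_scaleA catalg_scale1 catalg_scaleDr catalg_scaleDl.

Lemma catalg_scaleAl (c : k) (a b : A) : c *: (a * b) = (c *: a) * b.
Proof.
apply: catalgP => x z h; rewrite coefZ !coef_mul mulr_sumr; apply: eq_bigr => y _.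
rewrite mulr_sumr; apply: eq_bigr => g _; rewrite mulr_sumr.
by apply: eq_bigr => f _; rewrite coefZ mulrA.
Qed.

Lemma catalg_scaleAr (c : k) (a b : A) : c *: (a * b) = a * (c *: b).
Proof.
apply: catalgP => x z h; rewrite coefZ !coef_mul mulr_sumr; apply: eq_bigr => y _.
rewrite mulr_sumr; apply: eq_bigr => g _; rewrite mulr_sumr.
by apply: eq_bigr => f _; rewrite coefZ mulrCA.
Qed.
End CategoryAlgebra.

Definition lmod_iso (R : pzRingType) (M N : lmodType R) : Prop :=
  exists f : {linear M -> N}, bijective f.

Definition fin_generated (R : pzRingType) (M : lmodType R) : Prop :=
  exists (n : nat) (e : 'I_n -> M),
    forall v : M, exists c : 'I_n -> R, v = \sum_i c i *: e i.

Definition indecomposable (R : pzRingType) (M : lmodType R) : Prop :=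
  (exists v : M, v <> 0) /\
  forall U V : lmodType R, lmod_iso M (U * V)%type ->
    (forall u : U, u = 0) \/ (forall v : V, v = 0).

Definition finite_rep_type (R : pzRingType) : Prop :=
  exists (n : nat) (M : 'I_n -> lmodType R),
    forall N : lmodType R, fin_generated N -> indecomposable N ->
      exists i, lmod_iso N (M i).

(* C is skeletal EI with exactly the three distinct objects x, y, z, whose
   automorphism groups are cyclic of orders p^r, p^s, p^t. *)
Definition cyclic_three (p r s t : nat) (C : fincat) (x y z : ob C) : Prop :=
  [/\ EI C /\ skeletal C,
      uniq [:: x; y; z] /\ (forall w, w \in [:: x; y; z]),
      cyclic [set: autc C x] /\ #|[set: autc C x]| = (p ^ r)%N,
      cyclic [set: autc C y] /\ #|[set: autc C y]| = (p ^ s)%N &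
      cyclic [set: autc C z] /\ #|[set: autc C z]| = (p ^ t)%N].

(* In both families the boolean is coerced to 0 or 1: there is exactly one
   morphism between the listed ordered pairs of objects, and none between the
   other pairs of distinct objects.  In the first one the morphism x -> z is
   therefore the composite of the other two. *)
Definition first_family (p r s t : nat) (C : fincat) : Prop :=
  exists x y z : ob C, cyclic_three p r s t x y z /\
    forall a b, a != b ->
      #|hom C a b| = ((a, b) \in [:: (x, y); (y, z); (x, z)]) :> nat.

Definition second_family (p r s t : nat) (C : fincat) : Prop :=
  exists x y z : ob C, cyclic_three p r s t x y z /\
    forall a b, a != b ->
      #|hom C a b| = ((a, b) \in [:: (x, y); (z, y)]) :> nat.

Definition listed (p : nat) (C : fincat) : Prop :=
  [\/ exists r s t, first_family p r s t C,
      exists r s t, second_family p r s t C /\ s = 0%N |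
      exists r s t, second_family p r s t C /\ r = 0%N /\ t = 0%N].

(* Main.v *)
Require Import Defs.
From HB Require Import structures.
From mathcomp Require Import all_boot all_order all_algebra all_fingroup all_solvable.
From mathcomp Require Import zify.
From Stdlib Require Import Classical.
Import Defs.

(** A module over the category algebra is a functor to vector spaces, that is, a
    system of matrices [ract f] on a single space on which the identities are
    orthogonal idempotents.  Both directions rest on this translation.

    Finite type.  Let the category be listed.  Each automorphism group is cyclic of
    order a power of p, so it acts on a representation through one nilpotent
    operator T = g - 1, and an arrow that is alone in its hom set satisfies
    [T x *m arr d = 0] and [arr d *m T y = 0].  Arrows thus send tops of Jordan
    blocks to socles of Jordan blocks.  By choosing vectors that are extremal for
    the filtrations by images and kernels of the powers of T one finds Jordan blocks
    linked by arrows, together with linked dual functionals; such a system is a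
    direct summand ([block_splitting]).  Hence an indecomposable representation is a
    chain of at most three blocks, or a plane with three lines (two blocks at the
    centre of the second family, [four_blocks]).  All these have bounded dimension
    and matrices over the prime field, and there are only finitely many such
    matrices ([finite_rep_type_of_prime]).  Transposing the matrices gives the
    opposite categories.

    Infinite type.  If the type is finite, then there are finitely many isomorphism
    classes in each dimension, so every family of functors of constant dimension
    indexed by k has two isomorphic members ([finite_type_collide]).  Explicit
    families with pairwise non-isomorphic members then exclude, one after the other:
    - noncyclic automorphism groups, by modules of dimension two
      ([collide_cyclic]);
    - hom sets with several orbits, by the Kronecker quiver ([hom_transitive],
      [chain_hom_eq]);
    - transitive hom sets with more than one element.  Such a set maps
      equivariantly onto Z/p, and since p is at least 5 (nilpotency of order four is
      used) there are families where the parameter is the cross ratio of four lines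
      in a plane ([one_sided_rigid], [two_sided_rigid]);
    - the second family with nontrivial groups at the sink and at a source: two full
      flags and a plane in a space of dimension four ([star_rigid]).
    What is left are posets on three points with cyclic groups attached, and these
    are the listed categories and their opposites. *)

Set Implicit Arguments.
Unset Strict Implicit.
Unset Printing Implicit Defensive.

Import GRing.Theory.
Local Open Scope ring_scope.

(** * Representations by matrices and the modules they define *)

Section Representations.
Variables (k : fieldType) (C : fincat).

(** Vectors are rows, so [ract f] acts on the right and composites are read from left
    to right.  All objects share one space, in which [ract (idc x)] projects onto the
    part at x; this keeps dimensions independent of the objects. *)
Record rep := Rep {
  rdim : nat;
  ract : forall x y, hom C x y -> 'M[k]_rdim;
  ractM : forall x y z (f : hom C y z) (g : hom C x y),
    ract (compc f g) = ract g *m ract f;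
  ract0 : forall x y y' z (f : hom C y' z) (g : hom C x y),
    y != y' -> ract g *m ract f = 0;
  ract1 : \sum_x ract (idc C x) = 1%:M
}.

Definition rlin (r : rep) (a : catalg k C) : 'M[k]_(rdim r) :=
  \sum_(m : mor C) coef a m *: ract r (tagged m).

Lemma rlinD r a b : rlin r (a + b) = rlin r a + rlin r b.
Proof.
by rewrite /rlin -big_split; apply: eq_bigr => m _; rewrite coefD scalerDl.
Qed.

Lemma rlinZ r c a : rlin r (c *: a) = c *: rlin r a.
Proof.
by rewrite /rlin scaler_sumr; apply: eq_bigr => m _; rewrite coefZ scalerA.
Qed.

Lemma rlin0 r : rlin r 0 = 0.
Proof. by rewrite -(scale0r 0) rlinZ scale0r. Qed.

Lemma rlin_sum r I (s : seq I) (P : pred I) F :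
  rlin r (\sum_(i <- s | P i) F i) = \sum_(i <- s | P i) rlin r (F i).
Proof. exact: (big_morph _ (rlinD r) (rlin0 r)). Qed.

Lemma rlin_basis r x y (f : hom C x y) : rlin r (basis k f) = ract r f.
Proof.
rewrite /rlin (bigD1 (Mor f)) //= coef_basis eqxx scale1r big1 ?addr0 // => m.
by move=> neq; rewrite /coef ffunE (negPf neq) scale0r.
Qed.

Lemma catalg_expand (a : catalg k C) :
  a = \sum_(m : mor C) coef a m *: basis k (tagged m).
Proof.
apply/ffunP => m; change (coef a m = coef (\sum_m coef a m *: basis k (tagged m)) m).
rewrite coef_sum (bigD1 m) //= coefZ big1 ?addr0 => [|m' neq].
  by case: m => [[x y] f]; rewrite coef_basis eqxx mulr1.
rewrite coefZ /coef ffunE; case: eqP => [eqm|_]; last by rewrite mulr0.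
by case/negP: neq; rewrite eqm; case: (m') => [[x y] f].
Qed.

Lemma rlinM r a b : rlin r (a * b) = rlin r b *m rlin r a.
Proof.
rewrite {1}(catalg_expand a) {1}(catalg_expand b) mulr_suml rlin_sum.
rewrite [in RHS]/rlin mulmx_sumr; apply: eq_bigr => -[[x y] f] _ /=.
rewrite -catalg_scaleAl rlinZ -scalemxAr; congr (_ *: _).
rewrite mulr_sumr rlin_sum mulmx_suml; apply: eq_bigr => -[[x' y'] g] _ /=.
rewrite -catalg_scaleAr rlinZ -scalemxAl; congr (_ *: _).
case: (eqVneq y' x) f => [<- f | neq f].
  by rewrite [_ * _]basis_mul rlin_basis ractM.
by rewrite [_ * _]basis_mul0 // rlin0 ract0.
Qed.

Lemma rlin1 r : rlin r 1 = 1%:M.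
Proof.
rewrite -(ract1 r) [1]/(catalg_one k C) rlin_sum.
by apply: eq_bigr => x _; rewrite rlin_basis.
Qed.

Definition rmod (r : rep) : Type := 'rV[k]_(rdim r).
HB.instance Definition _ r := GRing.Zmodule.copy (rmod r) 'rV[k]_(rdim r).

Section Rmod.
Variable r : rep.
Definition rmod_scale (a : catalg k C) (v : rmod r) : rmod r :=
  (v : 'rV_(rdim r)) *m rlin r a.
Lemma rmod_scaleA a b v : rmod_scale a (rmod_scale b v) = rmod_scale (a * b) v.
Proof. by rewrite /rmod_scale rlinM mulmxA. Qed.
Lemma rmod_scale1 : left_id 1 rmod_scale.
Proof. by move=> v; rewrite /rmod_scale rlin1 mulmx1. Qed.
Lemma rmod_scaleDr : right_distributive rmod_scale +%R.
Proof. by move=> a u v; rewrite /rmod_scale [LHS]mulmxDl. Qed.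
Lemma rmod_scaleDl v : {morph rmod_scale^~ v : a b / a + b}.
Proof. by move=> a b; rewrite /rmod_scale rlinD [LHS]mulmxDr. Qed.
HB.instance Definition _ := GRing.Zmodule_isLmodule.Build (catalg k C) (rmod r)
  rmod_scaleA rmod_scale1 rmod_scaleDr rmod_scaleDl.
End Rmod.

Lemma rmod_basisE r x y (f : hom C x y) (v : rmod r) :
  basis k f *: v = (v : 'rV_(rdim r)) *m ract r f.
Proof. by rewrite -rlin_basis. Qed.

Lemma rmod_scalarE r (c : k) (v : rmod r) :
  (c *: (1 : catalg k C)) *: v = c *: (v : 'rV_(rdim r)).
Proof.
by change ((v : 'rV_(rdim r)) *m rlin r (c *: (1 : catalg k C)) = c *: (v : 'rV_(rdim r)));
  rewrite rlinZ rlin1 -scalemxAr mulmx1.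
Qed.

End Representations.

(** * Isomorphisms and direct sums *)

Section LinearIso.
Variable R : pzRingType.

Lemma linear_mk (M N : lmodType R) (g : M -> N) : linear g ->
  exists f : {linear M -> N}, f =1 g.
Proof.
move=> lin_g; pose f : {linear M -> N} := HB.pack g (GRing.isLinear.Build R M N _ g lin_g).
by exists f.
Qed.

Lemma lmod_iso_mk (M N : lmodType R) (g : M -> N) :
  linear g -> bijective g -> lmod_iso M N.
Proof.
move=> /linear_mk[f fg] bij_g; exists f.
exact: eq_bij bij_g _ (fsym fg).
Qed.

Lemma lmod_iso_sym (M N : lmodType R) : lmod_iso M N -> lmod_iso N M.
Proof.
move=> [f [g fK gK]]; apply: (@lmod_iso_mk _ _ g); last by exists f.
by move=> a u v; apply: (can_inj fK); rewrite linearP !gK.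
Qed.

Lemma lmod_iso_trans (M N P : lmodType R) :
  lmod_iso M N -> lmod_iso N P -> lmod_iso M P.
Proof.
move=> [f bij_f] [g bij_g]; apply: (@lmod_iso_mk _ _ (g \o f)).
  by move=> a u v /=; rewrite !linearP.
exact: bij_comp.
Qed.

End LinearIso.

Section RepIso.
Variables (k : fieldType) (C : fincat).
Implicit Types r : rep k C.

(** Mutually inverse rectangular matrices: the two dimensions are equal only as a
    consequence. *)
Definition rep_iso r r' :=
  exists (P : 'M[k]_(rdim r, rdim r')) (Q : 'M[k]_(rdim r', rdim r)),
    [/\ P *m Q = 1%:M, Q *m P = 1%:M &
        forall x y (f : hom C x y), ract r f *m P = P *m ract r' f].

Lemma rep_iso_intertwine_inv r r' (P : 'M[k]_(rdim r, rdim r')) Q :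
    P *m Q = 1%:M -> Q *m P = 1%:M ->
    (forall x y (f : hom C x y), ract r f *m P = P *m ract r' f) ->
  forall x y (f : hom C x y), ract r' f *m Q = Q *m ract r f.
Proof.
move=> PQ QP fP x y f; rewrite -[LHS]mul1mx -QP -mulmxA (mulmxA P) -fP.
by rewrite -mulmxA PQ mulmx1.
Qed.

Lemma rlin_intertwine r r' (P : 'M[k]_(rdim r, rdim r')) :
    (forall x y (f : hom C x y), ract r f *m P = P *m ract r' f) ->
  forall a, rlin r a *m P = P *m rlin r' a.
Proof.
move=> fP a; rewrite mulmx_suml mulmx_sumr; apply: eq_bigr => m _.
by rewrite -scalemxAl fP scalemxAr.
Qed.

Lemma rep_iso_lmod r r' : rep_iso r r' -> lmod_iso (rmod r) (rmod r').
Proof.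
move=> [P [Q [PQ QP fP]]].
apply: (@lmod_iso_mk _ _ _ (fun v : rmod r => (v : 'rV_(rdim r)) *m P : rmod r')).
  move=> a u v; rewrite [LHS]mulmxDl; congr (_ + _).
  change ((u : 'rV_(rdim r)) *m rlin r a *m P = (u : 'rV_(rdim r)) *m P *m rlin r' a).
  by rewrite -mulmxA (rlin_intertwine fP) mulmxA.
exists (fun v : rmod r' => (v : 'rV_(rdim r')) *m Q : rmod r) => v;
  by rewrite -[LHS]mulmxA ?PQ ?QP [LHS]mulmx1.
Qed.

Lemma linear_mx n m (g : 'rV[k]_n -> 'rV[k]_m) :
  linear g -> exists P, forall v, g v = v *m P.
Proof. by move=> /linear_mk[f fg]; exists (lin1_mx f) => v; rewrite mul_rV_lin1 fg. Qed.

(** The scalars act through the multiples of 1, so a module morphism is k-linear, that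
    is, a matrix. *)
Lemma rmod_linear_mx r r' (g : rmod r -> rmod r') : linear g ->
  exists P : 'M[k]_(rdim r, rdim r'),
    (forall v : rmod r, g v = (v : 'rV_(rdim r)) *m P) /\
    (forall x y (f : hom C x y), ract r f *m P = P *m ract r' f).
Proof.
move=> lin_g.
have [|P gP] := @linear_mx _ _ (g : 'rV[k]_(rdim r) -> 'rV[k]_(rdim r')).
  by move=> c u v; have := lin_g (c *: (1 : catalg k C)) u v; rewrite !rmod_scalarE.
exists P; split=> // x y f; apply/row_matrixP => i; rewrite !row_mul !rowE.
have [g0 g0E] := linear_mk lin_g.
have := linearZ_LR g0 (basis k f) (delta_mx 0 i : 'rV_(rdim r)).
rewrite !g0E !rmod_basisE.
by rewrite !gP.
Qed.

Lemma lmod_rep_iso r r' : lmod_iso (rmod r) (rmod r') -> rep_iso r r'.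
Proof.
move=> iso; have [g [g' gK g'K]] := iso.
have [P [gP fP]] := rmod_linear_mx (linearP g).
have [|Q [g'Q _]] := @rmod_linear_mx r' r g'.
  by move=> a u v; apply: (can_inj gK); rewrite linearP !g'K.
exists P, Q; split=> //; apply/row_matrixP => i; rewrite row_mul [in RHS]rowE mulmx1 rowE.
  by rewrite -[RHS]gK g'Q gP.
by rewrite -[RHS]g'K gP g'Q.
Qed.

(** If [B *m F = 1] and the projection [F *m B] commutes with the action, compressing
    the action by B and F is again multiplicative, since [F *m B *m F = F]. *)
Section Summand.
Variables (r : rep k C) (d : nat) (B : 'M[k]_(d, rdim r)) (F : 'M[k]_(rdim r, d)).
Hypothesis BF : B *m F = 1%:M.
Hypothesis comm : forall x y (f : hom C x y), ract r f *m (F *m B) = F *m B *m ract r f.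

Definition summand_act x y (f : hom C x y) : 'M[k]_d := B *m ract r f *m F.

Lemma summand_actM x y z (f : hom C y z) (g : hom C x y) :
  summand_act g *m summand_act f = B *m (ract r g *m ract r f) *m F.
Proof.
rewrite /summand_act !mulmxA -(mulmxA _ F B) -(mulmxA B) comm !mulmxA BF mul1mx.
by rewrite -!mulmxA.
Qed.

Lemma summandM x y z (f : hom C y z) (g : hom C x y) :
  summand_act (compc f g) = summand_act g *m summand_act f.
Proof. by rewrite summand_actM -ractM. Qed.

Lemma summand0 x y y' z (f : hom C y' z) (g : hom C x y) :
  y != y' -> summand_act g *m summand_act f = 0.
Proof.
move=> neq; rewrite /summand_act !mulmxA -(mulmxA _ F B) -(mulmxA B) comm !mulmxA BF mul1mx.
by rewrite -(mulmxA B) ract0 // mulmx0 mul0mx.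
Qed.

Lemma summand1 : \sum_x summand_act (idc C x) = 1%:M.
Proof.
by rewrite -mulmx_suml -mulmx_sumr ract1 mulmx1 BF.
Qed.

Definition summand : rep k C := Rep summandM summand0 summand1.

Lemma summand_inj x y (f : hom C x y) : B *m ract r f = ract summand f *m B.
Proof. by rewrite /= /summand_act -[RHS]mulmxA -mulmxA comm !mulmxA BF mul1mx. Qed.

Lemma summand_proj x y (f : hom C x y) : ract r f *m F = F *m ract summand f.
Proof. by rewrite /= /summand_act !mulmxA -comm -!mulmxA BF mulmx1. Qed.
End Summand.

(** Indecomposability in terms of idempotents, a form that is stable under
    transposition. *)
Definition rep_indec r :=
  (0 < rdim r)%N /\
  forall E : 'M[k]_(rdim r), E *m E = E ->
    (forall x y (f : hom C x y), ract r f *m E = E *m ract r f) -> E = 0 \/ E = 1%:M.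

(** The inclusions B and projections F of a direct sum, which dispense with a cast
    along [rdim r = rdim r1 + rdim r2]. *)
Definition rep_sum r r1 r2 :=
  exists (B1 : 'M[k]_(rdim r1, rdim r)) (F1 : 'M[k]_(rdim r, rdim r1))
         (B2 : 'M[k]_(rdim r2, rdim r)) (F2 : 'M[k]_(rdim r, rdim r2)),
  [/\ B1 *m F1 = 1%:M /\ B2 *m F2 = 1%:M, B1 *m F2 = 0 /\ B2 *m F1 = 0,
      F1 *m B1 + F2 *m B2 = 1%:M,
      forall x y (f : hom C x y), B1 *m ract r f = ract r1 f *m B1 /\
         ract r f *m F1 = F1 *m ract r1 f &
      forall x y (f : hom C x y), B2 *m ract r f = ract r2 f *m B2 /\
         ract r f *m F2 = F2 *m ract r2 f].

Lemma idem_factor n (E : 'M[k]_n) : E *m E = E ->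
  exists (B : 'M[k]_(\rank E, n)) (F : 'M[k]_(n, \rank E)), B *m F = 1%:M /\ F *m B = E.
Proof.
move=> EE; exists (row_base E), (col_base E); split; last exact: mulmx_base.
apply: (row_free_inj (row_base_free E)); apply: (row_full_inj (col_base_full E)).
by rewrite mul1mx -mulmxA mulmx_base mulmxA mulmx_base EE.
Qed.

Lemma rep_split r (E : 'M[k]_(rdim r)) : E *m E = E ->
    (forall x y (f : hom C x y), ract r f *m E = E *m ract r f) ->
  exists r1 r2, rep_sum r r1 r2 /\ rdim r1 = \rank E /\ rdim r2 = \rank (1%:M - E).
Proof.
move=> EE fE.
have E'E' : (1%:M - E) *m (1%:M - E) = 1%:M - E.
  by rewrite mulmxBl !mulmxBr !mul1mx mulmx1 EE subrr subr0.
have fE' x y (f : hom C x y) : ract r f *m (1%:M - E) = (1%:M - E) *m ract r f.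
  by rewrite mulmxBl mulmxBr fE mulmx1 mul1mx.
have [B1 [F1 [BF1 FB1]]] := idem_factor EE.
have [B2 [F2 [BF2 FB2]]] := idem_factor E'E'.
have c1 x y (f : hom C x y) : ract r f *m (F1 *m B1) = F1 *m B1 *m ract r f.
  by rewrite FB1 fE.
have c2 x y (f : hom C x y) : ract r f *m (F2 *m B2) = F2 *m B2 *m ract r f.
  by rewrite FB2 fE'.
exists (summand BF1 c1), (summand BF2 c2); split=> //.
exists B1, F1, B2, F2; split=> //.
- split.
    rewrite -[LHS]mul1mx -BF1 -[LHS]mulmx1 -BF2 !mulmxA -(mulmxA B1) FB1.
    rewrite -(mulmxA _ F2 B2) FB2 -(mulmxA B1 E) mulmxBr mulmx1 EE subrr.
    by rewrite mulmx0 mul0mx.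
  rewrite -[LHS]mul1mx -BF2 -[LHS]mulmx1 -BF1 !mulmxA -(mulmxA B2) FB2.
  rewrite -(mulmxA _ F1 B1) FB1 -(mulmxA B2 _ E) mulmxBl mul1mx EE subrr.
  by rewrite mulmx0 mul0mx.
- by rewrite FB1 FB2 addrC subrK.
- by move=> x y f; split; [apply: summand_inj | apply: summand_proj].
by move=> x y f; split; [apply: summand_inj | apply: summand_proj].
Qed.

Lemma rep_sum_iso r r1 r2 r' r1' r2' :
  rep_sum r r1 r2 -> rep_sum r' r1' r2' -> rep_iso r1 r1' -> rep_iso r2 r2' ->
  rep_iso r r'.
Proof.
move=> [B1 [F1 [B2 [F2 [[a1 a2] [a3 a4] a5 a6 a7]]]]].
move=> [B1' [F1' [B2' [F2' [[a1' a2'] [a3' a4'] a5' a6' a7']]]]].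
move=> [P1 [Q1 [PQ1 QP1 fP1]]] [P2 [Q2 [PQ2 QP2 fP2]]].
exists (F1 *m P1 *m B1' + F2 *m P2 *m B2'), (F1' *m Q1 *m B1 + F2' *m Q2 *m B2).
split.
- rewrite mulmxDl !mulmxDr !mulmxA -!(mulmxA _ B1') -!(mulmxA _ B2').
  rewrite a1' a2' a3' a4' !(mulmx0, mul0mx, mulmx1) addr0 add0r.
  by rewrite -(mulmxA F1) PQ1 -(mulmxA F2) PQ2 !mulmx1.
- rewrite mulmxDl !mulmxDr !mulmxA -!(mulmxA _ B1) -!(mulmxA _ B2).
  rewrite a1 a2 a3 a4 !(mulmx0, mul0mx, mulmx1) addr0 add0r.
  by rewrite -(mulmxA F1') QP1 -(mulmxA F2') QP2 !mulmx1.
move=> x y f; have [b1 b2] := a6 _ _ f; have [b3 b4] := a7 _ _ f.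
have [c1 c2] := a6' _ _ f; have [c3 c4] := a7' _ _ f.
rewrite mulmxDl mulmxDr !mulmxA b2 b4 -!mulmxA c1 c3 !mulmxA.
by rewrite -!(mulmxA _ (ract _ f)) fP1 fP2 !mulmxA.
Qed.

Lemma rep_sum_lmod r r1 r2 : rep_sum r r1 r2 ->
  lmod_iso (rmod r) (rmod r1 * rmod r2)%type.
Proof.
move=> [B1 [F1 [B2 [F2 [[a1 a2] [a3 a4] a5 a6 a7]]]]].
apply: (@lmod_iso_mk _ _ _ (fun v : rmod r => 
  ((v : 'rV_(rdim r)) *m F1 : rmod r1, (v : 'rV_(rdim r)) *m F2 : rmod r2))).
  move=> a u v; congr (_, _); rewrite [LHS]mulmxDl; congr (_ + _).
    change ((u : 'rV_(rdim r)) *m rlin r a *m F1 = (u : 'rV_(rdim r)) *m F1 *m rlin r1 a).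
    by rewrite -!mulmxA; congr (_ *m _); apply: rlin_intertwine => x y f; case: (a6 x y f).
  change ((u : 'rV_(rdim r)) *m rlin r a *m F2 = (u : 'rV_(rdim r)) *m F2 *m rlin r2 a).
  by rewrite -!mulmxA; congr (_ *m _); apply: rlin_intertwine => x y f; case: (a7 x y f).
exists (fun w => (w.1 : 'rV_(rdim r1)) *m B1 + (w.2 : 'rV_(rdim r2)) *m B2 : rmod r).
  by move=> v /=; rewrite -!mulmxA -mulmxDr a5 mulmx1.
by move=> [v w]; congr (_, _); rewrite mulmxDl -!mulmxA ?a1 ?a2 ?a3 ?a4
   !(mulmx0, mulmx1) ?addr0 ?add0r.
Qed.

(** A commuting idempotent splits the module into its image and its kernel. *)
Lemma indecomposable_rep r : indecomposable (rmod r) -> rep_indec r.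
Proof.
move=> [[v nz_v] ind]; split.
  rewrite lt0n; apply/eqP => d0; case: nz_v.
  by apply/matrixP => i j; have := ltn_ord j; rewrite {2}d0.
move=> E EE fE; have [r1 [r2 [sm [d1 d2]]]] := rep_split EE fE.
have z (s : rep k C) : (forall u : rmod s, u = 0) -> rdim s = 0%N.
  move=> u0; apply/eqP; rewrite -leqn0 leqNgt; apply/negP => d_gt0.
  have /matrixP/(_ 0 (Ordinal d_gt0)) := u0 (const_mx 1 : 'rV[k]_(rdim s)).
  by rewrite !mxE => /eqP; rewrite oner_eq0.
case: (ind _ _ (rep_sum_lmod sm)) => /z; rewrite ?d1 ?d2 => /eqP.
  by rewrite mxrank_eq0 => /eqP; left.
by rewrite mxrank_eq0 subr_eq0 => /eqP; right.
Qed.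

(** Conversely the projection to a direct factor is a commuting idempotent. *)
Lemma rep_indecomposable r : rep_indec r -> indecomposable (rmod r).
Proof.
move=> [r_gt0 ind]; split.
  exists (const_mx 1 : 'rV[k]_(rdim r)) => /matrixP/(_ 0 (Ordinal r_gt0))/eqP.
  by rewrite !mxE oner_eq0.
move=> U V [g bij_g]; have [g' gK g'K] := bij_g.
have lin_g' : linear g' by move=> a u v; apply: (can_inj gK); rewrite linearP !g'K.
have [|E [hE fE]] := @rmod_linear_mx r r (fun v => g' ((g v).1, 0)).
  move=> a u v; rewrite -lin_g'; congr g'; rewrite linearP.
  by congr (_, _) => /=; rewrite scaler0 addr0.
have EE : E *m E = E.
  apply/row_matrixP => i; rewrite row_mul !rowE.
  by rewrite -(hE ('e_i *m E)) -(hE 'e_i) g'K.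
have z0 w : g' w = 0 -> w = 0 by move=> e; rewrite -(g'K w) e raddf0.
case: (ind E EE fE) => e; [left => u | right => v].
  have := hE (g' (u, 0)); rewrite g'K e mulmx0 => /z0.
  by move=> /(congr1 fst).
have := hE (g' (0, v)); rewrite g'K e mulmx1.
by move=> /(can_inj g'K) [].
Qed.
End RepIso.

(** * From finitely generated modules to representations *)

Lemma classical_min (P : nat -> Prop) :
  (exists n, P n) -> exists n, P n /\ forall m, P m -> (n <= m)%N.
Proof.
move=> [n Pn]; elim/ltn_ind: n Pn => n IH Pn.
case: (classic (exists2 m, (m < n)%N & P m)) => [[m lt_mn Pm] | no].
  exact: IH Pm.
exists n; split=> // m Pm; rewrite leqNgt; apply/negP => lt_mn.
by case: no; exists m.
Qed.

Section ModuleToRep.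
Variables (k : fieldType) (C : fincat) (N : lmodType (catalg k C)).

(** The module as a vector space over k, through the multiples of 1. *)
Definition scalars : Type := N.
HB.instance Definition _ := GRing.Zmodule.on scalars.

Definition scalars_scale (c : k) (v : scalars) : scalars :=
  (c *: (1 : catalg k C)) *: (v : N).
Lemma scalars_scaleA c d v :
  scalars_scale c (scalars_scale d v) = scalars_scale (c * d) v.
Proof. by rewrite /scalars_scale scalerA -catalg_scaleAl mul1r scalerA. Qed.
Lemma scalars_scale1 : left_id 1 scalars_scale.
Proof. by move=> v; rewrite /scalars_scale !scale1r. Qed.
Lemma scalars_scaleDr : right_distributive scalars_scale +%R.
Proof. by move=> c u v; rewrite /scalars_scale [LHS]scalerDr. Qed.
Lemma scalars_scaleDl v : {morph scalars_scale^~ v : c d / c + d}.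
Proof. by move=> c d; rewrite /scalars_scale [X in X *: _]scalerDl [LHS]scalerDl. Qed.
HB.instance Definition _ := GRing.Zmodule_isLmodule.Build k scalars
  scalars_scaleA scalars_scale1 scalars_scaleDr scalars_scaleDl.

Lemma scalars_scaleM (c : k) (a : catalg k C) (v : N) :
  c *: (a *: v : scalars) = (c *: a) *: v.
Proof.
by change ((c *: (1 : catalg k C)) *: (a *: v) = (c *: a) *: v);
  rewrite scalerA -catalg_scaleAl mul1r.
Qed.

Lemma scalars_scaleC (c : k) (a : catalg k C) (v : scalars) :
  a *: (c *: v : N) = c *: (a *: (v : N) : scalars).
Proof.
rewrite scalars_scaleM; change (a *: ((c *: (1 : catalg k C)) *: (v : N)) = (c *: a) *: (v : N)).
by rewrite scalerA -catalg_scaleAr mulr1.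
Qed.

Definition lincomb n (b : 'I_n -> scalars) (c : 'rV[k]_n) : scalars :=
  \sum_i c 0 i *: b i.

Lemma lincombP n b : linear (@lincomb n b).
Proof.
move=> a u v; rewrite /lincomb scaler_sumr -big_split; apply: eq_bigr => i _ /=.
by rewrite !mxE scalerDl scalerA.
Qed.

Definition spanning n (b : 'I_n -> scalars) := forall v, exists c, v = lincomb b c.

Lemma fin_generated_spanning : fin_generated N ->
  exists n (b : 'I_n -> scalars), spanning b.
Proof.
move=> [m [e eP]]; pose T := (mor C * 'I_m)%type.
pose b (i : 'I_#|{: T}|) : scalars :=
  basis k (tagged (enum_val i).1) *: e (enum_val i).2.
exists #|{: T}|, b => v; have [a ->] := eP v.
exists (\row_i coef (a (enum_val i).2) (enum_val i).1).
rewrite /lincomb; under [RHS]eq_bigr do rewrite mxE.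
transitivity (\sum_(t : T) (coef (a t.2) t.1 *: (basis k (tagged t.1) *: e t.2 : scalars))).
  rewrite -(pair_bigA _ (fun m j => coef (a j) m *: (basis k (tagged m) *: e j : scalars))).
  rewrite exchange_big; apply: eq_bigr => j _ /=.
  rewrite {1}(catalg_expand (a j)) scaler_suml; apply: eq_bigr => l _.
  by rewrite scalars_scaleM.
rewrite (reindex (@enum_val T predT)) //=.
by exists enum_rank => t _; rewrite ?enum_rankK ?enum_valK.
Qed.

(** In a spanning family of least size, a relation would let one vector be dropped. *)
Lemma minimal_spanning_free n (b : 'I_n -> scalars) : spanning b ->
    (forall m (b' : 'I_m -> scalars), spanning b' -> (n <= m)%N) ->
  injective (lincomb b).
Proof.
case: n b => [|n] b span_b min_n u v eq_uv; first by apply/matrixP => i [].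
pose c := u - v; have c0 : lincomb b c = 0.
  have := lincombP b (-1) v u; rewrite !scaleN1r eq_uv addNr => <-.
  by rewrite /c addrC.
apply/eqP; rewrite -subr_eq0 -/c; apply/eqP; move: (c) c0 => {}c c0; apply/rowP => i0; rewrite [RHS]mxE.
apply/eqP; apply: contraT => nz; suff: (n.+1 <= n)%N by rewrite ltnn.
apply: (min_n _ (fun j => b (lift i0 j))) => w; have [d ->] := span_b w.
exists (\row_j (d 0 (lift i0 j) - d 0 i0 / c 0 i0 * c 0 (lift i0 j))).
have -> : lincomb b d = lincomb b (- (d 0 i0 / c 0 i0) *: c + d).
  by rewrite lincombP c0 scaler0 add0r.
rewrite /lincomb (bigD1_ord i0) //= !mxE mulNr divfK // addNr scale0r add0r.
by apply: eq_bigr => j _; rewrite !mxE mulNr addrC.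
Qed.

(** Coordinates in a minimal spanning family of the underlying vector space. *)
Lemma fin_generated_rep : fin_generated N -> exists r : rep k C, lmod_iso N (rmod r).
Proof.
move=> /fin_generated_spanning/classical_min[n [[b span_b] min_n]].
have inj_b : injective (lincomb b).
  by apply: minimal_spanning_free => // m b' span_b'; apply: min_n; exists b'.
have ex v : exists c, v == lincomb b c by have [c ->] := span_b v; exists c.
pose x v := xchoose (ex v); have xK v : lincomb b (x v) = v.
  by rewrite -(eqP (xchooseP (ex v))).
have Kx c : x (lincomb b c) = c by apply: inj_b; rewrite xK.
have xP : linear x by move=> c u v; apply: inj_b; rewrite lincombP !xK.
have [x' x'E] := linear_mk xP.
pose A y z (f : hom C y z) := \matrix_j x (basis k f *: (b j : N)).
have scale_lin a : linear (fun v : scalars => a *: (v : N) : scalars).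
  move=> c u v; rewrite [LHS]scalerDr; congr (_ + _).
  exact: scalars_scaleC.
have xA y z (f : hom C y z) v : x (basis k f *: (v : N)) = x v *m A _ _ f.
  have [s sE] := linear_mk (scale_lin (basis k f)).
  have {1}-> : v = lincomb b (x v) by rewrite xK.
  rewrite -(sE _) linear_sum -x'E linear_sum mulmx_sum_row; apply: eq_bigr => i _.
  by rewrite !linearZ_LR rowK x'E sE.
have rowx i : 'e_i = x (b i).
  rewrite -[LHS]Kx; congr x; rewrite /lincomb (bigD1 i) //= mxE !eqxx scale1r.
  by rewrite big1 ?addr0 // => j neq; rewrite mxE (negPf neq) andbF scale0r.
have x0 : x 0 = 0 by rewrite -x'E raddf0.
have AM y z w (f : hom C z w) (g : hom C y z) : A _ _ (compc f g) = A _ _ g *m A _ _ f.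
  apply/row_matrixP => i; rewrite row_mul !rowK -xA.
  by rewrite scalerA [_ * _]basis_mul.
have A0 y z z' w (f : hom C z' w) (g : hom C y z) : z != z' -> A _ _ g *m A _ _ f = 0.
  move=> neq; apply/row_matrixP => i; rewrite row_mul rowK -xA.
  by rewrite scalerA [_ * _]basis_mul0 // scale0r x0 row0.
have A1 : \sum_y A _ _ (idc C y) = 1%:M.
  apply/row_matrixP => i; rewrite !rowE mulmx_sumr mulmx1.
  under eq_bigr do rewrite rowx -xA -x'E.
  rewrite -linear_sum /= x'E rowx; congr x.
  have e : \sum_y basis k (idc C y) *: (b i : N) = b i.
    by rewrite -scaler_suml; exact: scale1r.
  exact: e.
exists (Rep AM A0 A1).
apply: (@lmod_iso_mk _ _ _ (x : N -> rmod (Rep AM A0 A1))); last first.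
  by exists (lincomb b : rmod (Rep AM A0 A1) -> N).
move=> a u v; rewrite -!x'E [LHS](raddfD x'); congr (_ + _); rewrite !x'E.
have e : (a *: u : scalars) =
    \sum_(m : mor C) coef a m *: (basis k (tagged m) *: u : scalars).
  rewrite [in LHS](catalg_expand a) [LHS]scaler_suml; apply: eq_bigr => m _.
  by rewrite scalars_scaleM.
transitivity (x' (\sum_(m : mor C) coef a m *: (basis k (tagged m) *: u : scalars))).
  exact: congr1 e.
rewrite linear_sum.
change (\sum_(m : mor C) x' (coef a m *: (basis k (tagged m) *: u : scalars)) =
   x u *m rlin (Rep AM A0 A1) a).
rewrite mulmx_sumr; apply: eq_bigr => m _.
by rewrite linearZ_LR -scalemxAr -[ract _ _]/(A _ _ (tagged m)) -xA x'E.
Qed.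
End ModuleToRep.

(** * Two criteria for the representation type *)

Section FiniteType.
Variables (k : fieldType) (C : fincat).

Lemma rmod_fin_generated (r : rep k C) : fin_generated (rmod r).
Proof.
exists (rdim r), (fun i => 'e_i : rmod r) => v.
exists (fun i => (v : 'rV_(rdim r)) 0 i *: (1 : catalg k C)).
rewrite [LHS]row_sum_delta; apply: eq_bigr => i _.
by rewrite rmod_scalarE.
Qed.

Lemma rep_iso_dim0 (r r' : rep k C) : rdim r = 0%N -> rdim r' = 0%N -> rep_iso r r'.
Proof.
move=> d d'; exists 0, 0; split=> [||x y f].
- by apply/matrixP => i; have := ltn_ord i; rewrite {2}d.
- by apply/matrixP => i; have := ltn_ord i; rewrite {2}d'.
by rewrite mulmx0 mul0mx.
Qed.

Lemma rank_idem_lt n (E : 'M[k]_n) : E *m E = E -> E <> 1%:M -> (\rank E < n)%N.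
Proof.
move=> EE nE; rewrite ltn_neqAle rank_leq_row andbT; apply/negP => full.
by apply: nE; apply: (row_free_inj full); rewrite mul1mx.
Qed.

Lemma not_indec_split (r : rep k C) : (0 < rdim r)%N -> ~ rep_indec r ->
  exists r1 r2, [/\ rep_sum r r1 r2, (rdim r1 < rdim r)%N & (rdim r2 < rdim r)%N].
Proof.
move=> r_gt0 not_ind.
have [E [EE fE [nE0 nE1]]] : exists E : 'M[k]_(rdim r), [/\ E *m E = E,
    forall x y (f : hom C x y), ract r f *m E = E *m ract r f & E <> 0 /\ E <> 1%:M].
  apply: NNPP => no; apply: not_ind; split=> // E EE fE; apply: NNPP => nE.
  by apply: no; exists E; split=> //; split=> e; apply: nE; [left | right].
have [r1 [r2 [sm [d1 d2]]]] := rep_split EE fE; exists r1, r2; rewrite d1 d2.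
split=> //; apply: rank_idem_lt => //.
  by rewrite mulmxBl !mulmxBr !mul1mx mulmx1 EE subrr subr0.
by move=> e; apply: nE0; rewrite -[E](subKr 1%:M) e subrr.
Qed.

(** Finitely many indecomposables leave only finitely many classes in each
    dimension: a decomposable representation is recorded by the classes of two
    proper summands. *)
Lemma finite_type_bounded n : finite_rep_type (catalg k C) ->
  exists (T : finType) (R : rep k C -> T -> Prop),
    (forall r, (rdim r <= n)%N -> exists t, R r t) /\
    (forall r r' t, R r t -> R r' t -> rep_iso r r').
Proof.
move=> [q [M Mall]]; elim: n => [|n [T [R [Rtot Rinj]]]].
  exists unit, (fun r _ => rdim r = 0%N); split=> [r|r r' _]; last exact: rep_iso_dim0.
  by rewrite leqn0 => /eqP; exists tt.
pose R' (r : rep k C) (t : option ('I_q + T * T)) := match t with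
  | None => rdim r = 0%N
  | Some (inl i) => lmod_iso (rmod r) (M i)
  | Some (inr (t1, t2)) => exists r1 r2, [/\ rep_sum r r1 r2, R r1 t1 & R r2 t2]
  end.
exists (option ('I_q + T * T)%type), R'; split=> [r le_rn | r r' [[i|[t1 t2]]|]] /=.
- case: (posnP (rdim r)) => [d0 | r_gt0]; first by exists None.
  case: (classic (rep_indec r)) => [ind | not_ind].
    have [i iso_i] := Mall _ (rmod_fin_generated r) (rep_indecomposable ind).
    by exists (Some (inl i)).
  have [r1 [r2 [sm lt1 lt2]]] := not_indec_split r_gt0 not_ind.
  have [t1 Rt1] := Rtot r1 (leq_trans lt1 le_rn).
  have [t2 Rt2] := Rtot r2 (leq_trans lt2 le_rn).
  by exists (Some (inr (t1, t2))); exists r1, r2.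
- move=> iso iso'; apply: lmod_rep_iso; apply: lmod_iso_trans iso _.
  exact: lmod_iso_sym.
- move=> [r1 [r2 [sm Rt1 Rt2]]] [r1' [r2' [sm' Rt1' Rt2']]].
  by apply: rep_sum_iso sm sm' _ _; [apply: Rinj Rt1 Rt1' | apply: Rinj Rt2 Rt2'].
exact: rep_iso_dim0.
Qed.

(** Pigeonhole on the classes in dimension n. *)
Lemma finite_type_family n (I : nat -> rep k C) : finite_rep_type (catalg k C) ->
    (forall l, rdim (I l) = n) ->
  exists l m, l <> m /\ rep_iso (I l) (I m).
Proof.
move=> /(finite_type_bounded n)[T [R [Rtot Rinj]]] dimI.
have [t Rt] : exists t : 'I_#|T|.+1 -> T, forall i : 'I_#|T|.+1, R (I i) (t i).
  have [t tP] := @fin_all_exists 'I_#|T|.+1 (fun=> T) (fun i t => R (I i) t)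
    (fun i => Rtot (I i) (eq_leq (dimI i))).
  by exists t.
have /injectivePn[i [j neq eq_t]] : ~~ injectiveb t.
  apply/negP => /injectiveP/leq_card; rewrite card_ord.
  by rewrite ltnn.
exists i, j; split; first by move=> /val_inj e; rewrite e eqxx in neq.
by apply: Rinj (Rt i) _; rewrite eq_t.
Qed.

(** If a code from a finite set determines a module up to isomorphism, one
    representative for each code that occurs is enough. *)
Lemma finite_rep_type_of_codes (T : finType) (R : lmodType (catalg k C) -> T -> Prop) :
    (forall N N' t, R N t -> R N' t -> lmod_iso N N') ->
    (forall N, fin_generated N -> indecomposable N -> exists t, R N t) ->
  finite_rep_type (catalg k C).
Proof.
move=> Rinj Rtot.
have [n [M MP]] : exists n (M : 'I_n -> lmodType (catalg k C)),
    forall N t, t \in enum T -> R N t -> exists i, lmod_iso N (M i).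
  elim: (enum T) => [|t s [n [M MP]]].
    by exists 0%N, (fun i : 'I_0 => False_rect _ (notF (ltn_ord i))).
  case: (classic (exists N, R N t)) => [[N0 RN0] | none]; last first.
    exists n, M => N t'; rewrite inE => /orP[/eqP-> RN|]; last exact: MP.
    by case: none; exists N.
  exists n.+1, (fun i => if unlift ord0 i is Some j then M j else N0) => N t'.
  rewrite inE => /orP[/eqP-> RN | s_t' RN].
    by exists ord0; rewrite unlift_none; apply: Rinj RN RN0.
  by have [i iso_i] := MP N t' s_t' RN; exists (lift ord0 i); rewrite liftK.
exists n, M => N fgN indN; have [t RNt] := Rtot N fgN indN.
by apply: MP RNt; rewrite mem_enum.
Qed.

Lemma rep_iso_eq (r r' : rep k C) (e : rdim r = rdim r') :
    (forall x y (f : hom C x y) i j,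
      ract r f i j = ract r' f (cast_ord e i) (cast_ord e j)) ->
  rep_iso r r'.
Proof.
case: r r' e => d A AM A0 A1 [d' A' AM' A0' A1'] /= e; subst d' => eqA.
exists 1%:M, 1%:M; split; rewrite ?mulmx1 //= => x y f.
rewrite mulmx1 mul1mx; apply/matrixP => i j.
by rewrite eqA !cast_ord_id.
Qed.

(** In characteristic p the images of the natural numbers are the prime field. *)
Definition prime_entries n m (A : 'M[k]_(n, m)) := forall i j, exists a, A i j = a%:R.

(** Matrices of bounded size over the prime field are coded by residues modulo p. *)
Lemma finite_rep_type_of_prime p D : p \in [pchar k] ->
    (forall r : rep k C, rep_indec r -> exists r' : rep k C,
       [/\ (rdim r' <= D)%N, rep_iso r r' &
           forall x y (f : hom C x y), prime_entries (ract r' f)]) ->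
  finite_rep_type (catalg k C).
Proof.
move=> char_p small; have p_gt0 := prime_gt0 (pcharf_prime char_p).
pose T := ('I_D.+1 * {ffun mor C * 'I_D * 'I_D -> 'I_p})%type.
pose coded (r' : rep k C) (t : T) := rdim r' = t.1 :> nat /\
  forall (m : mor C) (i j : 'I_D) (i' j' : 'I_(rdim r')),
    i = i' :> nat -> j = j' :> nat ->
    ract r' (tagged m) i' j' = (t.2 (m, i, j) : nat)%:R.
apply: (@finite_rep_type_of_codes T
  (fun N t => exists r' : rep k C, lmod_iso N (rmod r') /\ coded r' t)).
- move=> N N' t [r [iso [d c]]] [r' [iso' [d' c']]].
  apply: lmod_iso_trans iso _; apply: lmod_iso_trans (lmod_iso_sym iso').
  have e : rdim r = rdim r' by rewrite d d'.
  apply: rep_iso_lmod; apply: (rep_iso_eq (e := e)) => x y f i j.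
  have lti (l : 'I_(rdim r)) : (l < D)%N.
    by apply: leq_trans (ltn_ord l) _; rewrite d -ltnS.
  rewrite (c (Mor f) (Ordinal (lti i)) (Ordinal (lti j))) //.
  by rewrite (c' (Mor f) (Ordinal (lti i)) (Ordinal (lti j))).
move=> N fgN indN; have [r iso] := fin_generated_rep fgN.
have ind_r : rep_indec r.
  apply: indecomposable_rep; case: indN => [[v nz_v] indN].
  have [g [g' gK g'K]] := iso; split.
    by exists (g v) => g0; apply: nz_v; rewrite -(gK v) g0 -(raddf0 g) gK.
  by move=> U V iso'; apply: indN; apply: lmod_iso_trans iso'.
have [r' [le_D iso' ent]] := small r ind_r.
pose good (x : mor C * 'I_D * 'I_D) (a : 'I_p) := forall i j : 'I_(rdim r'),
  x.1.2 = i :> nat -> x.2 = j :> nat -> ract r' (tagged x.1.1) i j = (a : nat)%:R.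
have [c cP] : exists c : mor C * 'I_D * 'I_D -> 'I_p, forall x, good x (c x).
  apply: (@fin_all_exists _ (fun=> 'I_p) good) => -[[m i] j]; rewrite /good /=.
  case: (ltnP i (rdim r')) => [lti|gei]; last first.
    exists (Ordinal p_gt0) => i' j' ei _.
    by have := ltn_ord i'; rewrite -ei ltnNge gei.
  case: (ltnP j (rdim r')) => [ltj|gej]; last first.
    exists (Ordinal p_gt0) => i' j' _ ej.
    by have := ltn_ord j'; rewrite -ej ltnNge gej.
  have [a ea] := ent _ _ (tagged m) (Ordinal lti) (Ordinal ltj).
  exists (Ordinal (ltn_pmod a p_gt0)) => i' j' ei ej /=.
  rewrite (GRing.natr_mod_pchar char_p) -ea.
  by congr (ract _ _ _ _); apply: val_inj.
have lt_d : (rdim r' < D.+1)%N by rewrite ltnS.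
exists (Ordinal lt_d, [ffun x => c x]), r'; split.
  exact: lmod_iso_trans iso (rep_iso_lmod iso').
by split=> //= m i j i' j' ei ej; rewrite ffunE; apply: (cP (m, i, j)).
Qed.

End FiniteType.

(** * Splitting off blocks *)

Section Span.
Variables (k : fieldType) (I : finType) (V : lmodType k) (e : I -> V).

(** Natural coefficients, so that matrices in the basis e have entries in the prime field. *)
Definition nspan (v : V) := exists c : I -> nat, v = \sum_s (c s)%:R *: e s.

Lemma nspan0 : nspan 0.
Proof. by exists (fun=> 0%N); rewrite big1 // => s _; rewrite scale0r. Qed.

Lemma nspanD v w : nspan v -> nspan w -> nspan (v + w).
Proof.
move=> [c ->] [d ->]; exists (fun s => c s + d s)%N.
by rewrite -big_split; apply: eq_bigr => s _; rewrite natrD scalerDl.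
Qed.

Lemma nspanZ a v : nspan v -> nspan (a%:R *: v).
Proof.
move=> [c ->]; exists (fun s => a * c s)%N.
by rewrite scaler_sumr; apply: eq_bigr => s _; rewrite natrM scalerA.
Qed.

Lemma nspan_mem s : nspan (e s).
Proof.
exists (fun t => (t == s) : nat); rewrite (bigD1 s) //= eqxx scale1r.
by rewrite big1 ?addr0 // => t /negPf->; rewrite scale0r.
Qed.

Lemma nspan_sum J (r : seq J) (P : pred J) F :
  (forall j, P j -> nspan (F j)) -> nspan (\sum_(j <- r | P j) F j).
Proof. by move=> PF; apply: big_ind => //; [apply: nspan0 | apply: nspanD]. Qed.
End Span.

(** A block q is the Jordan block at [o q] generated by [u q], and [f q] generates a dual
    block; the arrows send tops to combinations of socles, on vectors and on
    functionals.  The vectors [e] and the functionals [phi] list all blocks. *)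
Section BlockSplitting.
Variables (k : fieldType) (O D : finType) (n : nat).
Variables (idm T : O -> 'M[k]_n) (arr : D -> 'M[k]_n).
Hypothesis idmT : forall x y, idm x *m T y = if x == y then T y else 0.
Hypothesis Tidm : forall x y, T x *m idm y = if x == y then T x else 0.
Hypothesis idmM : forall x y, idm x *m idm y = if x == y then idm x else 0.
Hypothesis arrT : forall d x, arr d *m T x = 0.
Hypothesis Tarr : forall d x, T x *m arr d = 0.

(** The operators [idm], [T] and [arr] generate the action of the category algebra
    ([generated]), so idempotents need only commute with these. *)
Definition gens_indec := (0 < n)%N /\
  forall E : 'M[k]_n, E *m E = E -> (forall x, idm x *m E = E *m idm x) ->
    (forall x, T x *m E = E *m T x) -> (forall d, arr d *m E = E *m arr d) ->
  E = 0 \/ E = 1%:M.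

Definition prime_form (N : nat) :=
  exists d (B : 'M[k]_(d, n)) (F : 'M[k]_(n, d)), [/\ (d <= N)%N,
    B *m F = 1%:M, F *m B = 1%:M &
    [/\ forall x, prime_entries (B *m idm x *m F),
        forall x, prime_entries (B *m T x *m F) &
        forall a, prime_entries (B *m arr a *m F)]].

Variables (K : finType) (o : K -> O) (len : K -> nat).
Variables (u : K -> 'rV[k]_n) (f : K -> 'cV[k]_n).
Hypothesis len_gt0 : forall q, (0 < len q)%N.
Hypothesis u_idm : forall q, u q *m idm (o q) = u q.
Hypothesis idm_f : forall q, idm (o q) *m f q = f q.
Hypothesis u_len : forall q, u q *m T (o q) ^+ len q = 0.
Hypothesis f_len : forall q, T (o q) ^+ len q *m f q = 0.
Hypothesis pairing : forall q q', o q = o q' ->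
  u q *m T (o q) ^+ (len q).-1 *m f q' = (q == q')%:R%:M.
Hypothesis u_arr : forall d q,
  nspan (fun q => u q *m T (o q) ^+ (len q).-1) (u q *m arr d).
Hypothesis arr_f : forall d q,
  nspan (fun q => T (o q) ^+ (len q).-1 *m f q) (arr d *m f q).

Let I := {q : K & 'I_(len q)}.
Let e (s : I) := u (tag s) *m T (o (tag s)) ^+ (tagged s : nat).
Let phi (s : I) := T (o (tag s)) ^+ (tagged s : nat) *m f (tag s).

Let mkI q i (lt : (i < len q)%N) : I := Tagged (fun q => 'I_(len q)) (Ordinal lt).

Lemma u_pow0 q i : (len q <= i)%N -> u q *m T (o q) ^+ i = 0.
Proof. by move=> /subnKC<-; rewrite exprD mulmxA u_len mul0mx. Qed.

Lemma f_pow0 q i : (len q <= i)%N -> T (o q) ^+ i *m f q = 0.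
Proof. by move=> /subnK<-; rewrite exprD -mulmxE -mulmxA f_len mulmx0. Qed.

Lemma u_idm' q x i : u q *m T (o q) ^+ i *m idm x = if o q == x then u q *m T (o q) ^+ i else 0.
Proof.
case: i => [|i]; last first.
  by rewrite exprSr -mulmxE -!mulmxA Tidm; case: ifP; rewrite ?mulmx0.
rewrite expr0 mulmx1; rewrite -{1}u_idm -mulmxA idmM.
by case: ifP; rewrite ?mulmx0 ?u_idm.
Qed.

Lemma idm_f' q x i : idm x *m (T (o q) ^+ i *m f q) = if x == o q then T (o q) ^+ i *m f q else 0.
Proof.
case: i => [|i]; last first.
  by rewrite exprS -mulmxE !mulmxA idmT; case: ifP; rewrite ?mul0mx.
rewrite expr0 mul1mx; rewrite -{1}idm_f mulmxA idmM.
by case: eqP => [->|]; rewrite ?mul0mx ?idm_f.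
Qed.

Lemma cross q q' i j : o q != o q' -> u q *m T (o q) ^+ i *m (T (o q') ^+ j *m f q') = 0.
Proof.
move=> neq; have <- : idm (o q') *m (T (o q') ^+ j *m f q') = T (o q') ^+ j *m f q'.
  by rewrite idm_f' eqxx.
by rewrite mulmxA u_idm' (negPf neq) mul0mx.
Qed.

Lemma nspan_e_idm s x : nspan e (e s *m idm x).
Proof. by rewrite u_idm'; case: ifP => _; [apply: nspan_mem | apply: nspan0]. Qed.

Lemma nspan_phi_idm s x : nspan phi (idm x *m phi s).
Proof. by rewrite idm_f'; case: ifP => _; [apply: nspan_mem | apply: nspan0]. Qed.

Lemma e_T s x : nspan e (e s *m T x).
Proof.
case: s => q i; rewrite /e /=; case: (eqVneq (o q) x) => [<-|neq]; last first.
  have <- : idm x *m T x = T x by rewrite idmT eqxx.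
  rewrite mulmxA u_idm' (negPf neq) mul0mx.
  exact: nspan0.
rewrite -mulmxA mulmxE -exprSr; case: (ltnP i.+1 (len q)) => [lt|ge].
  exact: (nspan_mem e (mkI lt)).
by rewrite u_pow0 //; apply: nspan0.
Qed.

Lemma T_phi s x : nspan phi (T x *m phi s).
Proof.
case: s => q i; rewrite /phi /=; case: (eqVneq x (o q)) => [->|neq]; last first.
  have <- : T x *m idm x = T x by rewrite Tidm eqxx.
  rewrite -mulmxA idm_f' (negPf neq) mulmx0.
  exact: nspan0.
rewrite mulmxA mulmxE -exprS; case: (ltnP i.+1 (len q)) => [lt|ge].
  exact: (nspan_mem phi (mkI lt)).
by rewrite f_pow0 //; apply: nspan0.
Qed.

Lemma last_lt q : ((len q).-1 < len q)%N.
Proof. by rewrite ltn_predL. Qed.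

Lemma e_arr s d : nspan e (e s *m arr d).
Proof.
case: s => q [[|i] lt]; rewrite /e /=; last first.
  by rewrite exprSr -mulmxE -!mulmxA Tarr !mulmx0; apply: nspan0.
rewrite expr0 mulmx1; have [c ->] := u_arr d q.
apply: nspan_sum => q' _; apply: nspanZ.
exact: (nspan_mem e (mkI (last_lt q'))).
Qed.

Lemma arr_phi s d : nspan phi (arr d *m phi s).
Proof.
case: s => q [[|i] lt]; rewrite /phi /=; last first.
  by rewrite exprS -mulmxE !mulmxA arrT !mul0mx; apply: nspan0.
rewrite expr0 mul1mx; have [c ->] := arr_f d q.
apply: nspan_sum => q' _; apply: nspanZ.
exact: (nspan_mem phi (mkI (last_lt q'))).
Qed.

Let B : 'M[k]_(#|{: I}|, n) := \matrix_t e (enum_val t).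
Let Phi : 'M[k]_(n, #|{: I}|) := \matrix_(i, t) phi (enum_val t) i 0.

Lemma colPhi t : col t Phi = phi (enum_val t).
Proof. by apply/matrixP => i j; rewrite !mxE ord1. Qed.

(** The pairing of the blocks with the dual blocks is triangular with respect to the
    height (the distance to the end of the block): [T ^+ h.-1 *m f] kills the vectors
    of height less than h and reads off the socle from those of height h.  Hence a
    descending induction on the height. *)
Lemma gram_free (c : I -> k) :
  (forall t, (\sum_s c s *: e s) *m phi t = 0) -> forall s, c s = 0.
Proof.
move=> c0; pose L := (\max_q len q)%N.
suff main j (s : I) : (L - (len (tag s) - tagged s) = j)%N -> c s = 0.
  by move=> s; apply: main erefl.
elim/ltn_ind: j s => j IH -[q0 i0] /= hj.
have lt0 : ((len q0 - i0).-1 < len q0)%N.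
  have h : (0 < len q0 - i0)%N by rewrite subn_gt0.
  by rewrite prednK // leq_subr.
have := c0 (mkI lt0); rewrite mulmx_suml (bigD1 (Tagged (fun q => 'I_(len q)) i0)) //=.
rewrite big1 ?addr0 => [|[q i] neq].
  rewrite /e /phi /= -scalemxAl mulmxA -(mulmxA (u q0)) mulmxE -exprD.
  rewrite (_ : (i0 + _)%N = (len q0).-1); last first.
    by case: (len q0) i0 {hj lt0 c0} => [[]//|l] i0 /=; rewrite subSn ?subnKC // -ltnS.
  rewrite pairing // eqxx => /matrixP/(_ 0 0); rewrite !mxE.
  by rewrite mulr1n mulr1.
case: (eqVneq (o q) (o q0)) => [eo|neqo]; last first.
  by rewrite -scalemxAl /e /phi /= cross // scaler0.
have [lt_h|le_h] := ltnP (len q0 - i0) (len q - i).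
  rewrite (IH (L - (len q - i))%N) ?scale0r ?mul0mx // -hj.
  have : (len q - i <= L)%N.
    by apply: leq_trans (leq_subr _ _) _; apply: leq_bigmax.
  by move=> le_L; apply: ltn_sub2l => //; apply: leq_trans le_L.
rewrite -scalemxAl /e /phi /= mulmxA -eo -(mulmxA (u q)) mulmxE -exprD.
move: le_h; rewrite leq_eqVlt => /orP[/eqP eh|lt_h].
  rewrite (_ : (i + _)%N = (len q).-1); last first.
    rewrite -eh; case: (len q) i {neq eh} => [[]//|l] i /=.
    by rewrite subSn ?subnKC // -ltnS.
  rewrite pairing //; case: (eqVneq q q0) neq => [eq_q|]; last by rewrite raddf0 scaler0.
  subst q0 => /eqP[]; congr (Tagged _ _); apply: val_inj => /=.
  have := congr1 (subn (len q)) eh; rewrite !subKn // ltnW //.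
rewrite u_pow0 ?mul0mx ?scaler0 //.
have h : (0 < len q0 - i0)%N by rewrite subn_gt0.
by rewrite -leq_subLR -ltnS prednK.
Qed.

Lemma rowmul_B (c : 'rV[k]_#|{: I}|) : c *m B = \sum_s c 0 (enum_rank s) *: e s.
Proof.
rewrite mulmx_sum_row (reindex (@enum_rank I)) /=; last first.
  by exists enum_val => t _; rewrite ?enum_rankK ?enum_valK.
by apply: eq_bigr => s _; rewrite rowK enum_rankK.
Qed.

Lemma gram_unit : B *m Phi \in unitmx.
Proof.
rewrite -row_free_unit; apply: inj_row_free => c; rewrite mulmxA => c0.
apply/rowP => t; rewrite [RHS]mxE -[t]enum_valK.
apply: (gram_free (c := fun s => c 0 (enum_rank s))) => s.
by rewrite -rowmul_B -[s]enum_rankK -colPhi colE !mulmxA -(mulmxA c) mulmxA c0 mul0mx.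
Qed.

Lemma nspan_B G : (forall s, nspan e (e s *m G)) -> 
  exists2 S, prime_entries S & B *m G = S *m B.
Proof.
move=> eG; have [c cP] := fin_all_exists eG.
exists (\matrix_(t, t') (c (enum_val t) (enum_val t'))%:R).
  by move=> t t'; exists (c (enum_val t) (enum_val t')); rewrite mxE.
apply/row_matrixP => t; rewrite !row_mul rowK cP rowmul_B.
by apply: eq_bigr => s _; rewrite !mxE enum_rankK.
Qed.

Lemma nspan_Phi G : (forall s, nspan phi (G *m phi s)) ->
  exists S, G *m Phi = Phi *m S.
Proof.
move=> phiG; have [c cP] := fin_all_exists phiG.
exists (\matrix_(t', t) (c (enum_val t) (enum_val t'))%:R).
apply/matrixP => i t.
have := congr1 (fun M : 'cV_n => M i 0) (cP (enum_val t)).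
rewrite -colPhi colE mulmxA -colE mxE => ->; rewrite summxE mxE.
rewrite (reindex (@enum_val I predT)) /=; last first.
  by exists enum_rank => s _; rewrite ?enum_rankK ?enum_valK.
by apply: eq_bigr => s _; rewrite !mxE mulrC.
Qed.

(** By [gram_unit] the matrix [Phi *m invmx (B *m Phi) *m B] is a projection onto the span
    of the blocks.  It commutes with the generators because these preserve the span of
    the blocks and the span of the dual blocks. *)
Theorem block_splitting (q0 : K) N : (\sum_q len q <= N)%N -> gens_indec -> prime_form N.
Proof.
move=> le_N [n_gt0 ind]; pose F := Phi *m invmx (B *m Phi).
have BF : B *m F = 1%:M by rewrite mulmxA mulmxV // gram_unit.
have cardI : #|{: I}| = (\sum_q len q)%N.
  rewrite card_tagged sumnE big_map big_enum /=.
  by apply: eq_bigr => q _; rewrite card_ord.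
have comm G : (forall s, nspan e (e s *m G)) -> (forall s, nspan phi (G *m phi s)) ->
   G *m F = F *m (B *m G *m F) /\ B *m G = B *m G *m F *m B.
  move=> /nspan_B[S _ BG] /nspan_Phi[S' GPhi].
  have SB : B *m G *m F = S by rewrite BG -mulmxA BF mulmx1.
  have SG : S *m (B *m Phi) = B *m Phi *m S' by rewrite mulmxA -BG -!mulmxA GPhi.
  rewrite SB; split=> //; rewrite mulmxA GPhi -!mulmxA; congr (_ *m _).
  rewrite -[S in RHS]mulmx1 -(mulmxV gram_unit) (mulmxA S) SG.
  by rewrite -mulmxA mulKmx ?gram_unit.
have commE G : (forall s, nspan e (e s *m G)) -> (forall s, nspan phi (G *m phi s)) ->
   G *m (F *m B) = F *m B *m G.
  by move=> h1 h2; have [GF BG] := comm G h1 h2; rewrite mulmxA GF -[RHS]mulmxA [in RHS]BG !mulmxA.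
have EE : F *m B *m (F *m B) = F *m B by rewrite mulmxA -(mulmxA F) BF mulmx1.
have FB : F *m B = 1%:M.
  have := ind (F *m B) EE; case.
  - by move=> x; apply: commE => s; [apply: nspan_e_idm | apply: nspan_phi_idm].
  - by move=> x; apply: commE => s; [apply: e_T | apply: T_phi].
  - by move=> d; apply: commE => s; [apply: e_arr | apply: arr_phi].
  - move=> E0; have : B *m F *m B = 0 by rewrite -mulmxA E0 mulmx0.
    rewrite BF mul1mx => B0; have /eqP : (1%:M : 'M[k]_#|{: I}|) = 0 by rewrite -BF B0 mul0mx.
    rewrite -mxrank_eq0 mxrank1 => card0; exfalso; move: card0.
    by rewrite cardI (bigD1 q0) //= addn_eq0 eqn0Ngt len_gt0.
  by [].
have ent G : (forall s, nspan e (e s *m G)) -> prime_entries (B *m G *m F).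
  by move=> /nspan_B[S pS BG]; rewrite BG -mulmxA BF mulmx1.
exists #|{: I}|, B, F; split=> //; first by rewrite cardI.
split=> x; apply: ent => s; [exact: nspan_e_idm | exact: e_T | exact: e_arr].
Qed.
End BlockSplitting.

(** * Functionals and chains of blocks *)

Section Functionals.
Variables (k : fieldType) (n : nat).
Implicit Types (v : 'rV[k]_n).

(** Some column of the cokernel detects v. *)
Lemma separate m v (A : 'M[k]_(m, n)) : ~~ (v <= A)%MS ->
  exists phi : 'cV[k]_n, A *m phi = 0 /\ v *m phi = 1%:M.
Proof.
rewrite submxE => /rV0Pn[j nz]; pose c := (v *m cokermx A) 0 j.
exists (c^-1 *: col j (cokermx A)).
rewrite -!scalemxAr !colE (mulmxA A) (mulmxA v) mulmx_coker mul0mx scaler0; split=> //.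
by apply/matrixP => s t; rewrite -colE !ord1 mxE [X in _ * X]mxE [RHS]mxE mulVf.
Qed.

(** For subspaces stable under the idempotent e the functional can be replaced by its
    part at e. *)
Lemma separate_hom m v (A : 'M[k]_(m, n)) (e : 'M[k]_n) : e *m e = e ->
    v *m e = v -> (A *m e <= A)%MS -> ~~ (v <= A)%MS ->
  exists phi : 'cV[k]_n, [/\ e *m phi = phi, A *m phi = 0 & v *m phi = 1%:M].
Proof.
move=> ee ve /submxP[S Ae] /separate[phi [A0 v1]]; exists (e *m phi).
by rewrite !mulmxA ee Ae ve -mulmxA A0 mulmx0.
Qed.

Lemma extend_functional q (A : 'M[k]_(q, n)) (h : 'cV[k]_q) :
  (forall w : 'rV_q, w *m A = 0 -> w *m h = 0) -> exists g, A *m g = h.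
Proof.
move=> kerA; exists (pinvmx A *m h); apply/row_matrixP => i.
rewrite mulmxA row_mul; apply/eqP; rewrite -subr_eq0; apply/eqP.
have -> : row i h = row i 1%:M *m h by rewrite -row_mul mul1mx.
rewrite -mulmxBl; apply: kerA; rewrite mulmxBl -!row_mul mul1mx.
by rewrite mulmxKpV // subrr.
Qed.

Lemma extend_functional2 q q' (A : 'M[k]_(q, n)) (h : 'cV[k]_q) (B : 'M[k]_(q', n)) :
    (forall (w : 'rV_q) (w' : 'rV_q'), w *m A + w' *m B = 0 -> w *m h = 0) ->
  exists g, A *m g = h /\ B *m g = 0.
Proof.
move=> kerAB; have [|g] := @extend_functional _ (col_mx A B) (col_mx h 0).
  move=> w; rewrite -(hsubmxK w) !mul_row_col => /kerAB->.
  by rewrite mulmx0 addr0.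
by rewrite mul_col_mx => /eq_col_mx[Ag Bg]; exists g.
Qed.
End Functionals.

Lemma sum_option_bool (F : option bool -> nat) :
  (\sum_q F q = F None + F (Some true) + F (Some false))%N.
Proof.
rewrite (bigD1 None) //= (bigD1 (Some true)) //= (bigD1 (Some false)) //=.
by rewrite big_pred0 ?addn0 ?addnA //; case=> [[]|].
Qed.

Section Blocks.
Variables (k : fieldType) (O : finType) (n : nat).
Variables (idm T : O -> 'M[k]_n) (arr : bool -> 'M[k]_n) (src tgt : bool -> O).
Hypothesis idmT : forall x y, idm x *m T y = if x == y then T y else 0.
Hypothesis Tidm : forall x y, T x *m idm y = if x == y then T x else 0.
Hypothesis idmM : forall x y, idm x *m idm y = if x == y then idm x else 0.
Hypothesis arrT : forall d x, arr d *m T x = 0.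
Hypothesis Tarr : forall d x, T x *m arr d = 0.
Hypothesis src_arr : forall d, idm (src d) *m arr d = arr d.
Hypothesis arr_tgt : forall d, arr d *m idm (tgt d) = arr d.
Hypothesis ind : gens_indec idm T arr.

Let splits := block_splitting idmT Tidm idmM arrT Tarr.

Lemma idmK x : idm x *m idm x = idm x.
Proof. by rewrite idmM eqxx. Qed.

Lemma idm_powC x i : idm x *m T x ^+ i = T x ^+ i *m idm x.
Proof.
case: i => [|i]; first by rewrite expr0 mulmx1 mul1mx.
by rewrite {1}exprS exprSr -!mulmxE !mulmxA idmT eqxx -mulmxA Tidm eqxx mulmxE -exprS exprSr.
Qed.

Lemma idm_powS x i : idm x *m T x ^+ i.+1 = T x ^+ i.+1.
Proof. by rewrite exprS -mulmxE mulmxA idmT eqxx. Qed.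

Lemma not_src d x m (v : 'M_(m, n)) : v *m idm x = v -> x != src d -> v *m arr d = 0.
Proof. by move=> <- neq; rewrite -(src_arr d) mulmxA -(mulmxA v) idmM (negPf neq) mulmx0 mul0mx. Qed.

Lemma not_tgt d x m (g : 'M_(n, m)) : idm x *m g = g -> x != tgt d -> arr d *m g = 0.
Proof.
move=> <- neq; rewrite -(arr_tgt d) mulmxA -(mulmxA _ _ (idm x)) idmM eq_sym (negPf neq).
by rewrite mulmx0 mul0mx.
Qed.

Lemma one_block x a (u : 'rV_n) (f : 'cV_n) N : (0 < a <= N)%N ->
    u *m idm x = u -> idm x *m f = f -> u *m T x ^+ a = 0 -> T x ^+ a *m f = 0 ->
    u *m T x ^+ a.-1 *m f = 1%:M ->
    (forall d, u *m arr d = 0) -> (forall d, arr d *m f = 0) ->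
  prime_form idm T arr N.
Proof.
move=> /andP[a0 le_N] ux xf ua af uf ud df.
apply: (@splits unit (fun=> x) (fun=> a) (fun=> u) (fun=> f)) => //.
- by move=> d q; rewrite ud; apply: nspan0.
- by move=> d q; rewrite df; apply: nspan0.
by rewrite big_const card_unit /= addn0.
Qed.

(** The arrow d0 sends the top of the first block to the socle of the second, and the
    functionals are linked the opposite way; the pairing on the first block is
    transported from the second. *)
Lemma two_blocks x y d0 a b (u w : 'rV_n) (f g : 'cV_n) N : x != y ->
    (0 < a)%N -> (0 < b)%N -> (a + b <= N)%N ->
    u *m idm x = u -> idm x *m f = f -> w *m idm y = w -> idm y *m g = g ->
    u *m T x ^+ a = 0 -> T x ^+ a *m f = 0 ->
    w *m T y ^+ b = 0 -> T y ^+ b *m g = 0 ->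
    w *m T y ^+ b.-1 *m g = 1%:M ->
    u *m arr d0 = w *m T y ^+ b.-1 -> arr d0 *m g = T x ^+ a.-1 *m f ->
    (forall d, d != d0 -> u *m arr d = 0) -> (forall d, d != d0 -> arr d *m g = 0) ->
    (forall d, w *m arr d = 0) -> (forall d, arr d *m f = 0) ->
  prime_form idm T arr N.
Proof.
move=> neq a0 b0 le_N ux xf wy yg ua af wb bg wg uw gf ud dg wd df.
apply: (@splits bool (fun q => if q then y else x) (fun q => if q then b else a)
   (fun q => if q then w else u) (fun q => if q then g else f)) => //.
- by case.
- by case.
- by case.
- by case.
- by case.
- case=> [] [] //= e; last 1 first.
    by rewrite -mulmxA -gf mulmxA uw wg.
  by rewrite e eqxx in neq.
  by rewrite e eqxx in neq.
- move=> d []; rewrite ?wd; first exact: nspan0.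
  case: (eqVneq d d0) => [->|/ud->]; last exact: nspan0.
  by rewrite uw; apply: (nspan_mem _ true).
- move=> d []; rewrite ?df; last exact: nspan0.
  case: (eqVneq d d0) => [->|/dg->]; last exact: nspan0.
  by rewrite gf; apply: (nspan_mem _ false).
by rewrite big_bool /= addnC.
Qed.

Lemma three_blocks_path x y z d1 d2 a b c (u w v : 'rV_n) (f g h : 'cV_n) N :
    uniq [:: x; y; z] -> d1 != d2 ->
    (0 < a)%N -> (0 < b)%N -> (0 < c)%N -> (a + b + c <= N)%N ->
    u *m idm x = u -> idm x *m f = f -> w *m idm y = w -> idm y *m g = g ->
    v *m idm z = v -> idm z *m h = h ->
    u *m T x ^+ a = 0 -> T x ^+ a *m f = 0 ->
    w *m T y ^+ b = 0 -> T y ^+ b *m g = 0 ->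
    v *m T z ^+ c = 0 -> T z ^+ c *m h = 0 ->
    w *m T y ^+ b.-1 *m g = 1%:M ->
    u *m arr d1 = w *m T y ^+ b.-1 -> arr d1 *m g = T x ^+ a.-1 *m f ->
    w *m arr d2 = v *m T z ^+ c.-1 -> arr d2 *m h = T y ^+ b.-1 *m g ->
    src d1 = x -> tgt d1 = y -> src d2 = y -> tgt d2 = z ->
  prime_form idm T arr N.
Proof.
move=> + neqd a0 b0 c0 le_N ux xf wy yg vz zh ua af wb bg vc ch wg uw gf wv hg s1 t1 s2 t2.
rewrite /= !inE negb_or andbT => /andP[/andP[nxy nxz] nyz].
have [nyx nzx nzy] : [/\ y != x, z != x & z != y] by rewrite ![_ == x]eq_sym [z == y]eq_sym.
have eqd d : d != d1 -> d = d2 by move: neqd; case: (d); case: (d1); case: (d2).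
apply: (@splits (option bool) 
   (fun q => match q with None => y | Some true => z | Some false => x end)
   (fun q => match q with None => b | Some true => c | Some false => a end)
   (fun q => match q with None => w | Some true => v | Some false => u end)
   (fun q => match q with None => g | Some true => h | Some false => f end)) => //.
- by case=> [[]|].
- by case=> [[]|].
- by case=> [[]|].
- by case=> [[]|].
- by case=> [[]|].
- case=> [[]|] [[]|] //= /eqP; rewrite ?eqxx ?(negPf nxy) ?(negPf nyx) ?(negPf nxz)
    ?(negPf nzx) ?(negPf nyz) ?(negPf nzy) //= => _.
    by rewrite -wv -mulmxA hg mulmxA wg.
  by rewrite -mulmxA -gf mulmxA uw wg.
- move=> d [[]|].
  + rewrite (not_src vz) ?[X in _ != X](_ : _ = if d == d1 then x else y).
      exact: nspan0.
      by case: ifP; rewrite eq_sym.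
    by case: eqVneq => [->//|/eqd->].
  + case: (eqVneq d d1) => [->|/eqd->]; first by rewrite uw; apply: (nspan_mem _ None).
    by rewrite (not_src ux) ?s2 //; apply: nspan0.
  case: (eqVneq d d1) => [->|/eqd->].
    by rewrite (not_src wy) ?s1 1?eq_sym //; apply: nspan0.
  by rewrite wv; apply: (nspan_mem _ (Some true)).
- move=> d [[]|].
  + case: (eqVneq d d1) => [->|/eqd->].
      by rewrite (not_tgt zh) ?t1 1?eq_sym //; apply: nspan0.
    by rewrite hg; apply: (nspan_mem _ None).
  + rewrite (not_tgt xf) ?[X in _ != X](_ : _ = if d == d1 then y else z).
      exact: nspan0.
      by case: ifP.
    by case: eqVneq => [->//|/eqd->].
  case: (eqVneq d d1) => [->|/eqd->].
    by rewrite gf; apply: (nspan_mem _ (Some false)).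
  by rewrite (not_tgt yg) ?t2 //; apply: nspan0.
- exact: None.
by rewrite sum_option_bool addnC addnA.
Qed.

Lemma three_blocks_sink x y z d1 d2 a b c (u w v : 'rV_n) (f g h : 'cV_n) N :
    uniq [:: x; y; z] -> d1 != d2 ->
    (0 < a)%N -> (0 < b)%N -> (0 < c)%N -> (a + b + c <= N)%N ->
    u *m idm x = u -> idm x *m f = f -> w *m idm y = w -> idm y *m g = g ->
    v *m idm z = v -> idm z *m h = h ->
    u *m T x ^+ a = 0 -> T x ^+ a *m f = 0 ->
    w *m T y ^+ b = 0 -> T y ^+ b *m g = 0 ->
    v *m T z ^+ c = 0 -> T z ^+ c *m h = 0 ->
    w *m T y ^+ b.-1 *m g = 1%:M ->
    u *m arr d1 = w *m T y ^+ b.-1 -> arr d1 *m g = T x ^+ a.-1 *m f ->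
    v *m arr d2 = w *m T y ^+ b.-1 -> arr d2 *m g = T z ^+ c.-1 *m h ->
    src d1 = x -> tgt d1 = y -> src d2 = z -> tgt d2 = y ->
  prime_form idm T arr N.
Proof.
move=> + neqd a0 b0 c0 le_N ux xf wy yg vz zh ua af wb bg vc ch wg uw gf vw gh s1 t1 s2 t2.
rewrite /= !inE negb_or andbT => /andP[/andP[nxy nxz] nyz].
have [nyx nzx nzy] : [/\ y != x, z != x & z != y] by rewrite ![_ == x]eq_sym [z == y]eq_sym.
have eqd d : d != d1 -> d = d2 by move: neqd; case: (d); case: (d1); case: (d2).
apply: (@splits (option bool) 
   (fun q => match q with None => y | Some true => z | Some false => x end)
   (fun q => match q with None => b | Some true => c | Some false => a end)
   (fun q => match q with None => w | Some true => v | Some false => u end)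
   (fun q => match q with None => g | Some true => h | Some false => f end)) => //.
- by case=> [[]|].
- by case=> [[]|].
- by case=> [[]|].
- by case=> [[]|].
- by case=> [[]|].
- case=> [[]|] [[]|] //= /eqP; rewrite ?eqxx ?(negPf nxy) ?(negPf nyx) ?(negPf nxz)
    ?(negPf nzx) ?(negPf nyz) ?(negPf nzy) //= => _.
    by rewrite -mulmxA -gh mulmxA vw wg.
  by rewrite -mulmxA -gf mulmxA uw wg.
- move=> d [[]|].
  + case: (eqVneq d d1) => [->|/eqd->]; last by rewrite vw; apply: (nspan_mem _ None).
    by rewrite (not_src vz) ?s1 //; apply: nspan0.
  + case: (eqVneq d d1) => [->|/eqd->]; first by rewrite uw; apply: (nspan_mem _ None).
    by rewrite (not_src ux) ?s2 //; apply: nspan0.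
  by case: (eqVneq d d1) => [->|/eqd->]; rewrite (not_src wy) ?s1 ?s2 //; apply: nspan0.
- move=> d [[]|].
  + by case: (eqVneq d d1) => [->|/eqd->]; rewrite (not_tgt zh) ?t1 ?t2 //; apply: nspan0.
  + by case: (eqVneq d d1) => [->|/eqd->]; rewrite (not_tgt xf) ?t1 ?t2 //; apply: nspan0.
  case: (eqVneq d d1) => [->|/eqd->].
    by rewrite gf; apply: (nspan_mem _ (Some false)).
  by rewrite gh; apply: (nspan_mem _ (Some true)).
- exact: None.
by rewrite sum_option_bool addnC addnA.
Qed.

(** The socles of the two blocks at y span a plane, in which the images of u and v and
    the socle of the first block are three distinct lines.  This is the one
    indecomposable shape that is not a chain of blocks. *)
Lemma four_blocks x y z d1 d2 a b (u w1 w2 v : 'rV_n) (f g1 g2 h : 'cV_n) m1 N :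
    uniq [:: x; y; z] -> d1 != d2 -> m1%:R = -1 :> k ->
    (0 < a)%N -> (0 < b)%N -> (a + b + 2 <= N)%N ->
    T x = 0 -> T z = 0 ->
    u *m idm x = u -> idm x *m f = f -> v *m idm z = v -> idm z *m h = h ->
    w1 *m idm y = w1 -> idm y *m g1 = g1 -> w2 *m idm y = w2 -> idm y *m g2 = g2 ->
    w1 *m T y ^+ a = 0 -> T y ^+ a *m g1 = 0 ->
    w2 *m T y ^+ b = 0 -> T y ^+ b *m g2 = 0 ->
    w1 *m T y ^+ a.-1 *m g1 = 1%:M -> w1 *m T y ^+ a.-1 *m g2 = 0 ->
    w2 *m T y ^+ b.-1 *m g1 = 0 -> w2 *m T y ^+ b.-1 *m g2 = 1%:M ->
    u *m arr d1 = w2 *m T y ^+ b.-1 -> 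
    v *m arr d2 = w1 *m T y ^+ a.-1 - w2 *m T y ^+ b.-1 ->
    arr d1 *m g1 = 0 -> arr d1 *m g2 = f ->
    arr d2 *m g1 = h -> arr d2 *m g2 = - h ->
    src d1 = x -> tgt d1 = y -> src d2 = z -> tgt d2 = y ->
  prime_form idm T arr N.
Proof.
move=> + neqd m1E a0 b0 le_N Tx Tz ux xf vz zh w1y yg1 w2y yg2 w1a ag1 w2b bg2
  w1g1 w1g2 w2g1 w2g2 uw vw g10 g2f g1h g2h s1 t1 s2 t2.
rewrite /= !inE negb_or andbT => /andP[/andP[nxy nxz] nyz].
have [nyx nzx nzy] : [/\ y != x, z != x & z != y] by rewrite ![_ == x]eq_sym [z == y]eq_sym.
have eqd d : d != d1 -> d = d2 by move: neqd; case: (d); case: (d1); case: (d2).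
have m0 : 0%:M = 0 :> 'M[k]_1 by rewrite raddf0.
have [fx hz] : f = T x ^+ 0 *m f /\ h = T z ^+ 0 *m h by rewrite !expr0 !mul1mx.
apply: (@splits (bool * bool)%type
   (fun q => match q with (true, _) => y | (false, true) => x | (false, false) => z end)
   (fun q => match q with (true, true) => a | (true, false) => b | _ => 1%N end)
   (fun q => match q with (true, true) => w1 | (true, false) => w2
      | (false, true) => u | (false, false) => v end)
   (fun q => match q with (true, true) => g1 | (true, false) => g2
      | (false, true) => f | (false, false) => h end)) => //.
- by case=> [[] []].
- by case=> [[] []].
- by case=> [[] []].
- by case=> [[] []]; rewrite ?expr1 ?Tx ?Tz ?mulmx0.
- by case=> [[] []]; rewrite ?expr1 ?Tx ?Tz ?mul0mx.
- case=> [[] []] [[] []] //= /eqP; rewrite ?eqxx ?(negPf nxy) ?(negPf nyx) ?(negPf nxz)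
    ?(negPf nzx) ?(negPf nyz) ?(negPf nzy) //= => _; rewrite ?m0 // expr0 mulmx1.
    by rewrite -g2f mulmxA uw w2g2.
  by rewrite -g1h mulmxA vw mulmxBl w1g1 w2g1 subr0.
- move=> d [[] []].
  + by case: (eqVneq d d1) => [->|/eqd->]; rewrite (not_src w1y) ?s1 ?s2 //; apply: nspan0.
  + by case: (eqVneq d d1) => [->|/eqd->]; rewrite (not_src w2y) ?s1 ?s2 //; apply: nspan0.
  + case: (eqVneq d d1) => [->|/eqd->]; first by rewrite uw; apply: (nspan_mem _ (true, false)).
    by rewrite (not_src ux) ?s2 //; apply: nspan0.
  case: (eqVneq d d1) => [->|/eqd->].
    by rewrite (not_src vz) ?s1 //; apply: nspan0.
  rewrite vw -scaleN1r -m1E; apply: nspanD; first exact: (nspan_mem _ (true, true)).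
  by apply: nspanZ; apply: (nspan_mem _ (true, false)).
- move=> d [[] []].
  + case: (eqVneq d d1) => [->|/eqd->]; first by rewrite g10; apply: nspan0.
    rewrite g1h [X in nspan _ X]hz; exact: (nspan_mem _ (false, false)).
  + case: (eqVneq d d1) => [->|/eqd->].
      rewrite g2f [X in nspan _ X]fx; exact: (nspan_mem _ (false, true)).
    rewrite g2h -scaleN1r -m1E [X in nspan _ (_ *: X)]hz; apply: nspanZ.
    exact: (nspan_mem _ (false, false)).
  + by case: (eqVneq d d1) => [->|/eqd->]; rewrite (not_tgt xf) ?t1 ?t2 //; apply: nspan0.
  by case: (eqVneq d d1) => [->|/eqd->]; rewrite (not_tgt zh) ?t1 ?t2 //; apply: nspan0.
rewrite (bigD1 (true, true)) //= (bigD1 (true, false)) //= (bigD1 (false, true)) //=.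
rewrite (bigD1 (false, false)) //= big_pred0 ?addn0 ?addnA //; last by case=> [[] []].
by rewrite -addnA.
Qed.
End Blocks.

(** * Indecomposables of the three finite families *)

Lemma le_block1 i m : (i < m -> 0 < i.+1 <= 4 * m.+1)%N. Proof. by lia. Qed.
Lemma le_blocks2 a b m : (a <= m.+1 -> b <= m.+1 -> a + b <= 3 * m.+1)%N. Proof. by lia. Qed.
Lemma le_blocks3 a b c m : (a <= m.+1 -> b <= m.+1 -> c <= m.+1 -> a + b + c <= 3 * m.+1)%N.
Proof. by lia. Qed.
Lemma le_top_blocks3 i m : (i < m -> 1 + i.+1 + 1 <= 4 * m.+1)%N. Proof. by lia. Qed.
Lemma le_top_blocks2 i m : (i < m -> 1 + i.+1 <= 4 * m.+1)%N. Proof. by lia. Qed.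
Lemma le_blocks4 i l m : (i < m -> i.+1 + (i - l).+1 + 2 <= 4 * m.+1)%N. Proof. by lia. Qed.
Lemma pred_between b m : (m < b -> b <= m.+1 -> b.-1 = m)%N. Proof. by lia. Qed.
Lemma subn_pred_shift i l : (0 < l <= i -> (i - l).+1 = i - l.-1)%N. Proof. by lia. Qed.
Lemma subn_pred_le i l : (0 < l <= i -> (i - l).+1 <= i)%N. Proof. by lia. Qed.

Section Families.
Variables (k : fieldType) (O : finType) (n : nat).
Variables (idm T : O -> 'M[k]_n) (arr : bool -> 'M[k]_n) (src tgt : bool -> O).
Hypothesis idmT : forall x y, idm x *m T y = if x == y then T y else 0.
Hypothesis Tidm : forall x y, T x *m idm y = if x == y then T x else 0.
Hypothesis idmM : forall x y, idm x *m idm y = if x == y then idm x else 0.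
Hypothesis arrT : forall d x, arr d *m T x = 0.
Hypothesis Tarr : forall d x, T x *m arr d = 0.
Hypothesis src_arr : forall d, idm (src d) *m arr d = arr d.
Hypothesis arr_tgt : forall d, arr d *m idm (tgt d) = arr d.
Hypothesis ind : gens_indec idm T arr.
Hypothesis sum_idm : \sum_x idm x = 1%:M.
Variable m : nat.
Hypothesis T_nil : forall x, T x ^+ m = 0.

Let idm_powC := idm_powC idmT Tidm.
Let idm_powS := idm_powS idmT.
Let idmK := idmK idmM.
Let one := one_block idmT Tidm idmM arrT Tarr ind.
Let two := two_blocks idmT Tidm idmM arrT Tarr ind.
Let path3 := three_blocks_path idmT Tidm idmM arrT Tarr src_arr arr_tgt ind.
Let sink3 := three_blocks_sink idmT Tidm idmM arrT Tarr src_arr arr_tgt ind.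
Let four := four_blocks idmT Tidm idmM arrT Tarr src_arr arr_tgt ind.
Let not_src := not_src idmM src_arr.
Let not_tgt := not_tgt idmM arr_tgt.

Lemma exists_object : exists x, idm x != 0.
Proof.
apply: NNPP => no; have [n_gt0 _] := ind.
have /matrixP/(_ (Ordinal n_gt0) (Ordinal n_gt0))/eqP : 1%:M = 0 :> 'M[k]_n.
  rewrite -sum_idm big1 // => x _; apply/eqP; apply: contraT => nz.
  by case: no; exists x.
by rewrite !mxE eqxx oner_eq0.
Qed.

Lemma loop_length x : idm x != 0 ->
  exists2 l, (l < m)%N & idm x *m T x ^+ l != 0 /\ idm x *m T x ^+ l.+1 = 0.
Proof.
move=> nz; have exl : exists l, idm x *m T x ^+ l != 0 by exists 0%N; rewrite expr0 mulmx1.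
have ub l : idm x *m T x ^+ l != 0 -> (l <= m)%N.
  apply: contraNT; rewrite -ltnNge => /ltnW/subnKC<-.
  by rewrite exprD -mulmxE T_nil mul0mx mulmx0.
have [l nzl max_l] := ex_maxnP exl ub; exists l.
  rewrite ltn_neqAle ub // andbT; apply: contraNneq nzl => ->.
  by rewrite T_nil mulmx0.
split=> //; apply/eqP; apply: contraT => /max_l.
by rewrite ltnn.
Qed.

(** A Jordan block of maximal length splits off. *)
Lemma arrow_free N : (m <= N)%N -> (forall d, arr d = 0) -> prime_form idm T arr N.
Proof.
move=> le_N arr0; have [x /loop_length[l lt_l [nzl l0]]] := exists_object.
have /rowV0Pn[v /submxP[s vE] nz_v] := nzl.
have [||||f [xf _ vf]] := @separate_hom k n n v 0 (idm x).
- exact: idmK.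
- by rewrite vE -!mulmxA -idm_powC (mulmxA (idm x)) idmK.
- by rewrite mul0mx.
- by rewrite submx0.
apply: (one (x := x) (a := l.+1) (u := s *m idm x) (f := f)) => //.
- by rewrite (leq_trans lt_l).
- by rewrite -mulmxA idmK.
- by rewrite -mulmxA l0 mulmx0.
- by rewrite -[f]xf mulmxA -idm_powC l0 mul0mx.
- by rewrite /= -(mulmxA s) -vE vf.
- by move=> d; rewrite arr0 mulmx0.
by move=> d; rewrite arr0 mul0mx.
Qed.

Lemma kermx_pow0 x : kermx (T x ^+ 0) = 0.
Proof. by rewrite expr0; apply/eqP; rewrite kermx_eq0 row_free_unit unitmx1. Qed.

Lemma kermx_powm x q (M : 'M[k]_(n, q)) : (M <= kermx (T x ^+ m) *m M)%MS.
Proof.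
rewrite -[X in (X <= _)%MS]mul1mx; apply: submxMr.
by rewrite T_nil; apply/sub_kermxP; rewrite mulmx0.
Qed.

Lemma max_image_cap x (M : 'M[k]_n) : M != 0 -> exists2 c, (c <= m)%N &
  (M :&: T x ^+ c)%MS != 0 /\ (M :&: T x ^+ c.+1)%MS = 0.
Proof.
move=> nzM; have exc : exists c, (M :&: T x ^+ c)%MS != 0.
  by exists 0%N; rewrite expr0 [(M :&: _)%MS]capmx1.
have ub c : (M :&: T x ^+ c)%MS != 0 -> (c <= m)%N.
  apply: contraNT; rewrite -ltnNge => /ltnW/subnKC<-.
  by rewrite exprD -mulmxE T_nil mul0mx capmx0.
have [c nzc max_c] := ex_maxnP exc ub; exists c; rewrite ?ub //.
by split=> //; apply/eqP; apply: contraT => /max_c; rewrite ltnn.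
Qed.

Lemma min_kernel_cap x (M Z : 'M[k]_n) : (M :&: Z)%MS != 0 ->
  exists2 b, (0 < b <= m)%N & ((kermx (T x ^+ b) *m M) :&: Z)%MS != 0 /\
    forall l, (l < b)%N -> ((kermx (T x ^+ l) *m M) :&: Z)%MS = 0.
Proof.
move=> nz; have pm : ((kermx (T x ^+ m) *m M) :&: Z)%MS != 0.
  apply: contraNneq nz; rewrite -!submx0 => e.
  by apply: submx_trans (capmxS (kermx_powm x M) (submx_refl Z)) _; rewrite e.
have [b nzb min_b] :=
  @ex_minnP (fun b => ((kermx (T x ^+ b) *m M) :&: Z)%MS != 0) (ex_intro _ m pm).
exists b; first rewrite min_b // andbT lt0n.
  by apply: contraNneq nzb => ->; rewrite kermx_pow0 mul0mx cap0mx.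
split=> // l lt_l; apply/eqP; apply: contraT => /min_b.
by rewrite leqNgt lt_l.
Qed.

(** As [arr d *m g] vanishes on the kernel of [T x ^+ a], it is [T x ^+ a *m f] for some f:
    the dual block of f at the source has socle [arr d *m g]. *)
Lemma pull_back d x a (g : 'cV_n) : src d = x ->
    kermx (T x ^+ a) *m arr d *m g = 0 ->
  exists f, [/\ idm x *m f = f, T x ^+ a *m f = arr d *m g & T x ^+ a.+1 *m f = 0].
Proof.
move=> sx Pg; have [|f Xf] := @extend_functional k n n (T x ^+ a) (arr d *m g).
  move=> w /eqP; rewrite -sub_kermx => /submxP[s ->].
  by rewrite -!mulmxA in Pg *; rewrite Pg mulmx0.
have Xf' : T x ^+ a *m (idm x *m f) = arr d *m g.
  by rewrite mulmxA -idm_powC -mulmxA Xf mulmxA -sx src_arr.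
exists (idm x *m f); rewrite Xf'; split=> //; first by rewrite mulmxA idmK.
by rewrite exprS -mulmxE -mulmxA Xf' mulmxA Tarr mul0mx.
Qed.

Section Path.
Variables x y z : O.
Hypothesis xyz : uniq [:: x; y; z].
Hypothesis srcA : src false = x.
Hypothesis tgtA : tgt false = y.
Hypothesis srcB : src true = y.
Hypothesis tgtB : tgt true = z.
Let A := arr false.
Let B := arr true.

Let xA : idm x *m A = A. Proof. by rewrite -srcA src_arr. Qed.
Let Ay : A *m idm y = A. Proof. by rewrite -tgtA arr_tgt. Qed.
Let yB : idm y *m B = B. Proof. by rewrite -srcB src_arr. Qed.
Let Bz : B *m idm z = B. Proof. by rewrite -tgtB arr_tgt. Qed.

Let neqs : [/\ x != y, x != z & y != z].
Proof. by move: xyz; rewrite /= !inE negb_or andbT => /andP[/andP[-> ->] ->]. Qed.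

(** The vector w is chosen with [w *m B] nonzero and, in this order: [w *m B] as deep as
    possible in the images of the powers of [T z] (c maximal), w killed by the least
    power of [T y] (b minimal), and the socle [w *m T y ^+ b.-1] in the image of the least
    kernel of a power of [T x] (a minimal, where a = m + 1 stands for a socle outside
    the image of A).  The obstruction to dual functionals is a vector of the same
    kind with a smaller a or a larger c, so extremality provides them. *)
Lemma path_prime_form_B : B != 0 -> prime_form idm T arr (3 * m.+1).
Proof.
move=> nzB; have [nxy nxz nyz] := neqs.
have [c le_c [nzc Bc1]] := max_image_cap z nzB.
have [b /andP[b_gt0 le_b] [nzb min_b]] := min_kernel_cap y nzc.
pose P a := if (a <= m)%N then kermx (T x ^+ a) *m A else 1%:M.
have PT a : (a <= m)%N -> P a *m T y = 0.
  by move=> le_a; rewrite /P le_a -mulmxA arrT mulmx0.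
have P_y a : (a <= m)%N -> P a *m idm y = P a.
  by move=> le_a; rewrite /P le_a -mulmxA Ay.
have P0 : P 0 = 0.
  by rewrite /P /= kermx_pow0 mul0mx.
have Pm (g : 'cV_n) : P m *m g = 0 -> A *m g = 0.
  rewrite /P leqnn => e; have /submxP[t ->] := kermx_powm x A.
  by rewrite -mulmxA e mulmx0.
pose Q a := exists w : 'rV_n, [/\ w *m idm y = w, w *m T y ^+ b = 0,
  (w *m B <= T z ^+ c)%MS, w *m B != 0 & (w *m T y ^+ b.-1 <= P a)%MS].
have [a [Qa min_a]] : exists a, Q a /\ forall a', Q a' -> (a <= a')%N.
  apply: classical_min; exists m.+1.
  have /rowV0Pn[v] := nzb; rewrite sub_capmx => /andP[/submxP[s vE] vZ] nz_v.
  exists (s *m kermx (T y ^+ b) *m idm y); rewrite /P ltnn submx1; split=> //.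
  - by rewrite -mulmxA idmK.
  - by rewrite -mulmxA idm_powC mulmxA -(mulmxA s) mulmx_ker mulmx0 mul0mx.
  - by rewrite -mulmxA yB -mulmxA -vE.
  by rewrite -mulmxA yB -mulmxA -vE.
have [w [wy wb wZ nzw wP]] := Qa.
have nzw' : w *m T y ^+ b.-1 != 0.
  apply/eqP => e; have := min_b b.-1; rewrite ltn_predL b_gt0 => /(_ isT) e'.
  case/negP: nzw; rewrite -submx0 -e' sub_capmx wZ andbT.
  by apply: submxMr; apply/sub_kermxP.
have a_gt0 : (0 < a)%N.
  rewrite lt0n; apply/eqP => a0; case/negP: nzw'.
  by move: wP; rewrite a0 P0 submx0.
have le_a : (a <= m.+1)%N.
  by apply: min_a; exists w; split=> //; rewrite /P ltnn submx1.
have le_a1 : (a.-1 <= m)%N by rewrite -ltnS prednK.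
have yb1 : T y ^+ b.-1 *m T y = T y ^+ b by rewrite mulmxE -exprSr prednK.
have TB : T y *m B = 0 by apply: Tarr.
(* g has to vanish on S for the functionals f and h to exist.  If w *m T y ^+ b.-1 were
   in S, then w could be corrected to a w3 with a smaller a. *)
pose S := (P a.-1 + T y ^+ b + kermx B *m T y ^+ b.-1)%MS.
have [||||g [yg Sg wg]] := @separate_hom k n n (w *m T y ^+ b.-1) S (idm y).
- exact: idmK.
- by rewrite -mulmxA -idm_powC mulmxA wy.
- rewrite /S addsmxMr; apply: addsmxS; last first.
    rewrite -mulmxA -idm_powC mulmxA; apply: submxMr; apply/sub_kermxP.
    by rewrite -mulmxA yB mulmx_ker.
  rewrite addsmxMr; apply: addsmxS; first by rewrite P_y.
  by rewrite -idm_powC -(prednK b_gt0) idm_powS.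
- apply/negP; rewrite /S => /sub_addsmxP[[s3 s4]] /= wE.
  have /sub_addsmxP[[s1 s2] /= s3E] := submxMl s3 (P a.-1 + T y ^+ b)%MS.
  pose w3 := (w - s2 *m T y - s4 *m kermx B) *m idm y.
  have w3B : w3 *m B = w *m B.
    by rewrite /w3 -mulmxA yB !mulmxBl -(mulmxA s2) -(mulmxA s4) TB mulmx_ker !mulmx0 !subr0.
  have w3b1 : w3 *m T y ^+ b.-1 = s1 *m P a.-1.
    have e : (w - s2 *m T y - s4 *m kermx B) *m T y ^+ b.-1 = s1 *m P a.-1.
      have yb1' : T y *m T y ^+ b.-1 = T y ^+ b by rewrite mulmxE -exprS prednK.
      by rewrite !mulmxBl -(mulmxA s2) yb1' wE s3E -(mulmxA s4) addrAC !addrK.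
    by rewrite /w3 -mulmxA idm_powC mulmxA e -mulmxA P_y.
  suff /min_a : Q a.-1 by rewrite leqNgt ltn_predL a_gt0.
  exists w3; rewrite w3B w3b1 submxMl -mulmxA idmK; split=> //.
  by rewrite -yb1 mulmxA w3b1 -mulmxA PT // mulmx0.
have [Pg [yb kBg]] : P a.-1 *m g = 0 /\ T y ^+ b *m g = 0 /\ kermx B *m T y ^+ b.-1 *m g = 0.
  have sub0 q (M : 'M_(q, n)) : (M <= S)%MS -> M *m g = 0.
    by move=> /submxP[N ->]; rewrite -mulmxA Sg mulmx0.
  split; last split; apply: sub0; rewrite /S; last exact: addsmxSr.
    by apply: submx_trans (addsmxSl _ _); apply: addsmxSl.
  by apply: submx_trans (addsmxSl _ _); apply: addsmxSr.
have [h [zh Bh Zh]] : exists h, [/\ idm z *m h = h, B *m h = T y ^+ b.-1 *m g &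
    T z ^+ c.+1 *m h = 0].
  have [|h [Bh Zh]] := @extend_functional2 k n n n B (T y ^+ b.-1 *m g) (T z ^+ c.+1).
    move=> s s' /eqP; rewrite addr_eq0 => /eqP sB.
    have /sub_kermxP : s *m B = 0.
      apply/eqP; rewrite -submx0 -Bc1 sub_capmx submxMl sB.
      by rewrite -mulNmx submxMl.
    by move=> /submxP[t ->]; rewrite -!mulmxA in kBg *; rewrite kBg mulmx0.
  exists (idm z *m h); rewrite mulmxA idmK mulmxA Bz; split=> //.
  by rewrite mulmxA -idm_powC -mulmxA Zh mulmx0.
have [v [vz vE]] : exists v, v *m idm z = v /\ w *m B = v *m T z ^+ c.
  have /submxP[v vE] := wZ; exists (v *m idm z); rewrite -mulmxA idmK; split=> //.
  by rewrite -mulmxA idm_powC mulmxA -vE -mulmxA Bz.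
have vc : v *m T z ^+ c.+1 = 0.
  by rewrite exprSr -mulmxE mulmxA -vE -mulmxA arrT mulmx0.
(* For a = m + 1 the functional g kills the image of A, and the chain starts at y. *)
have [le_am | lt_ma] := leqP a m; last first.
  have ea : a = m.+1 by apply/eqP; rewrite eqn_leq le_a.
  rewrite ea /= in Pg.
  apply: (two (x := y) (y := z) (d0 := true)
    (a := b) (b := c.+1) (u := w) (w := v) (f := g) (g := h)) => //.
  - exact: (@le_blocks2 b c.+1 m (leqW le_b) le_c).
  - by rewrite -vE -mulmxA Bh mulmxA wg.
  - by case=> // _; apply: not_src wy _; rewrite srcA eq_sym.
  - by case=> // _; apply: not_tgt zh _; rewrite tgtA eq_sym.
  - by case; apply: not_src vz _; rewrite ?srcA ?srcB eq_sym.
  case; last exact: Pm.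
  by apply: not_tgt yg _; rewrite tgtB.
have [|f [xf Xf Xf']] := @pull_back false x a.-1 g srcA; first by move: Pg; rewrite /P le_a1.
have [u [ux uX uA]] : exists u, [/\ u *m idm x = u, u *m T x ^+ a = 0 &
    u *m A = w *m T y ^+ b.-1].
  move: wP; rewrite /P le_am => /submxP[s sE].
  exists (s *m kermx (T x ^+ a) *m idm x); rewrite -mulmxA idmK; split=> //.
    by rewrite -mulmxA idm_powC mulmxA -(mulmxA s) mulmx_ker mulmx0 mul0mx.
  by rewrite -mulmxA xA -mulmxA sE.
apply: (path3 (x := x) (y := y) (z := z) (d1 := false) (d2 := true)
    (a := a) (b := b) (c := c.+1) (u := u) (w := w) (v := v) (f := f) (g := g) (h := h)) => //.
- exact: (@le_blocks3 a b c.+1 m (leqW le_am) (leqW le_b) le_c).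
- by rewrite -(prednK a_gt0).
Qed.

(** The same choice one step earlier: the image of A meets the deepest power of [T y]
    (b maximal), from the least kernel of a power of [T x] (a minimal). *)
Lemma path_prime_form_A : B = 0 -> A != 0 -> prime_form idm T arr (3 * m.+1).
Proof.
move=> B0 nzA; have [nxy nxz nyz] := neqs.
have [b le_b [nzb Ab1]] := max_image_cap y nzA.
have [a /andP[a_gt0 le_a] [nza min_a]] := min_kernel_cap x nzb.
pose P a := kermx (T x ^+ a) *m A.
have /rowV0Pn[t] := nza; rewrite sub_capmx => /andP[/submxP[s tE] /submxP[s' tE']] nz_t.
have ty : t *m idm y = t by rewrite tE /P -!mulmxA Ay.
pose S := (P a.-1 + T y ^+ b.+1)%MS.
have [||||g [yg Sg tg]] := @separate_hom k n n t S (idm y).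
- exact: idmK.
- exact: ty.
- rewrite /S addsmxMr; apply: addsmxS; first by rewrite /P -mulmxA Ay.
  by rewrite -idm_powC idm_powS.
- apply/negP => /sub_addsmxP[[s1 s2]] /= e.
  have e1 : s2 *m T y ^+ b.+1 = 0.
    apply/eqP; rewrite -submx0 -Ab1 sub_capmx submxMl andbT.
    have -> : s2 *m T y ^+ b.+1 = t - s1 *m P a.-1 by rewrite e addrC addKr.
    by rewrite tE /P !mulmxA -mulmxBl submxMl.
  case/negP: nz_t; rewrite -submx0 -(min_a a.-1) ?ltn_predL // sub_capmx.
  by rewrite {1}e e1 addr0 submxMl tE' submxMl.
have sub0 q (M : 'M_(q, n)) : (M <= S)%MS -> M *m g = 0.
  by move=> /submxP[N ->]; rewrite -mulmxA Sg mulmx0.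
have [|f [xf Xf Xf']] := @pull_back false x a.-1 g srcA; first by apply: sub0; apply: addsmxSl.
apply: (two (x := x) (y := y) (d0 := false) (a := a) (b := b.+1)
    (u := s *m kermx (T x ^+ a) *m idm x) (w := s' *m idm y) (f := f) (g := g)) => //.
- exact: (@le_blocks2 a b.+1 m (leqW le_a) le_b).
- by rewrite -mulmxA idmK.
- by rewrite -mulmxA idmK.
- by rewrite -mulmxA idm_powC mulmxA -(mulmxA s) mulmx_ker mulmx0 mul0mx.
- by rewrite -(prednK a_gt0).
- by rewrite -mulmxA idm_powS exprSr -mulmxE mulmxA -tE' tE /P -!mulmxA arrT !mulmx0.
- by apply: sub0; apply: addsmxSr.
- by rewrite /= -(mulmxA s') idm_powC mulmxA -tE' ty tg.
- by rewrite /= -mulmxA xA -(mulmxA s') idm_powC mulmxA -tE' ty tE /P mulmxA.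
- by case=> // _; rewrite -/B B0 mulmx0.
- by case=> // _; rewrite -/B B0 mul0mx.
- case; first by rewrite -/B B0 mulmx0.
  by apply: (@not_src _ y); rewrite ?srcA 1?eq_sym // -mulmxA idmK.
case; first by rewrite -/B B0 mul0mx.
by apply: not_tgt xf _; rewrite tgtA.
Qed.

Theorem path_prime_form : prime_form idm T arr (3 * m.+1).
Proof.
case: (eqVneq B 0) => [B0|]; last exact: path_prime_form_B.
case: (eqVneq A 0) => [A0|]; last exact: path_prime_form_A.
by apply: arrow_free => [|[]//]; rewrite mulSn (leq_trans (leqnSn m)) // leq_addr.
Qed.
End Path.

Section Sink.
Variable y : O.
Hypothesis tgty : forall d, tgt d = y.
Hypothesis srcy : forall d, src d != y.
Hypothesis src_neq : src false != src true.

Let arry d : arr d *m idm y = arr d. Proof. by rewrite -{1}(tgty d) arr_tgt. Qed.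

Let xyz : uniq [:: src false; y; src true].
Proof. by rewrite /= !inE negb_or srcy src_neq eq_sym srcy. Qed.

Let src_inj d d' : d != d' -> src d != src d'.
Proof. by case: d d' => [] [] // _; rewrite eq_sym. Qed.

Lemma sink_block N a (w : 'rV_n) (g : 'cV_n) : (0 < a <= N)%N ->
    w *m idm y = w -> idm y *m g = g -> w *m T y ^+ a = 0 -> T y ^+ a *m g = 0 ->
    w *m T y ^+ a.-1 *m g = 1%:M -> (forall d, arr d *m g = 0) ->
  prime_form idm T arr N.
Proof.
move=> le_a wy yg wa ag wg ag0.
apply: (one (x := y) (a := a) (u := w) (f := g)) => // d.
by apply: not_src wy _; rewrite eq_sym srcy.
Qed.

Lemma sink_two_blocks d N a b (u w : 'rV_n) (f g : 'cV_n) :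
    (0 < a)%N -> (0 < b)%N -> (a + b <= N)%N ->
    u *m idm (src d) = u -> idm (src d) *m f = f -> w *m idm y = w -> idm y *m g = g ->
    u *m T (src d) ^+ a = 0 -> T (src d) ^+ a *m f = 0 ->
    w *m T y ^+ b = 0 -> T y ^+ b *m g = 0 ->
    w *m T y ^+ b.-1 *m g = 1%:M ->
    u *m arr d = w *m T y ^+ b.-1 -> arr d *m g = T (src d) ^+ a.-1 *m f ->
    (forall d', d' != d -> arr d' *m g = 0) -> prime_form idm T arr N.
Proof.
move=> a0 b0 le_N ux xf wy yg ua af wb bg wg uw gf dg.
apply: (two (x := src d) (y := y) (d0 := d) (a := a) (b := b) (u := u) (w := w)
  (f := f) (g := g)) => // d'; first by move=> neq; apply: not_src ux _; rewrite eq_sym src_inj.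
- by apply: not_src wy _; rewrite eq_sym srcy.
by apply: not_tgt xf _; rewrite tgty.
Qed.

(** The images at y of the kernels of the powers of [T (src d)] form two flags, one for
    each arrow; [P d m.+1] stands for the whole space at y.  A vector in the first
    nonzero term of one flag and in the first term of the other that meets it spans,
    with preimages under the arrows, a summand. *)
Lemma sink_prime_form_trivial_center : T y = 0 -> prime_form idm T arr (3 * m.+1).
Proof.
move=> Ty0; case: (eqVneq (idm y) 0) => [y0|nzy].
  by apply: arrow_free => [|d]; [rewrite mulSn (leq_trans (leqnSn m)) // leq_addr | rewrite -arry y0 mulmx0].
pose P d a := if (a <= m)%N then kermx (T (src d) ^+ a) *m arr d else idm y.
have Py d a : P d a *m idm y = P d a by rewrite /P; case: ifP; rewrite ?idmK // -mulmxA arry.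
have Ple d a : (P d a <= idm y)%MS by rewrite -Py submxMl.
have P0 d : P d 0 = 0 by rewrite /P kermx_pow0 mul0mx.
have exa : exists a, P false a != 0 by exists m.+1; rewrite /P ltnn.
have [a nza min_a] := ex_minnP exa.
have nzm : (P false a :&: P true m.+1)%MS != 0.
  rewrite {2}/P ltnn; apply: contra nza; rewrite -!submx0; apply: submx_trans.
  by rewrite sub_capmx submx_refl Ple.
have exc : exists c, (P false a :&: P true c)%MS != 0 by exists m.+1.
have [c nzc min_c] := ex_minnP exc.
have a_gt0 : (0 < a)%N by rewrite lt0n; apply: contraNneq nza => ->; rewrite P0.
have c_gt0 : (0 < c)%N by rewrite lt0n; apply: contraNneq nzc => ->; rewrite P0 capmx0.
have le_a : (a <= m.+1)%N by apply: min_a; rewrite /P ltnn.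
have le_c : (c <= m.+1)%N by apply: min_c.
have Pa0 : P false a.-1 = 0.
  by apply/eqP; apply: contraT => /min_a; rewrite leqNgt ltn_predL a_gt0.
have /rowV0Pn[w] := nzc; rewrite sub_capmx => /andP[wa wc] nzw.
have wy : w *m idm y = w by have /submxP[s ->] := wa; rewrite -mulmxA Py.
have [||||g [yg Pg wg]] := @separate_hom k n n w (P true c.-1) (idm y) => //.
- by rewrite Py.
- apply/negP => wc1; have : ~~ (c <= c.-1)%N by rewrite -ltnNge ltn_predL.
  case/negP; apply: min_c; apply: contraNneq nzw => e.
  by rewrite -submx0 -e sub_capmx wa.
have side d b : (0 < b)%N -> (b <= m.+1)%N -> (w <= P d b)%MS -> P d b.-1 *m g = 0 ->
    ((b <= m)%N /\ exists u f, [/\ u *m idm (src d) = u /\ idm (src d) *m f = f,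
      u *m T (src d) ^+ b = 0, T (src d) ^+ b *m f = 0, u *m arr d = w &
      arr d *m g = T (src d) ^+ b.-1 *m f]) \/ arr d *m g = 0.
  move=> b_gt0 le_b wP; rewrite {1}/P -ltnS prednK // le_b => Pg'.
  have [le_bm|lt_mb] := leqP b m; last first.
    right; have eb := pred_between lt_mb le_b.
    have /submxP[t ->] := kermx_powm (src d) (arr d).
    by rewrite -mulmxA; move: Pg'; rewrite eb => ->; rewrite mulmx0.
  left; split=> //; have [f [xf Xf Xf']] := pull_back (erefl (src d)) Pg'.
  move: wP; rewrite /P le_bm => /submxP[s sE].
  exists (s *m kermx (T (src d) ^+ b) *m idm (src d)), f; split=> //.
  - by split=> //; rewrite -mulmxA idmK.
  - by rewrite -mulmxA idm_powC mulmxA -(mulmxA s) mulmx_ker mulmx0 mul0mx.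
  - by rewrite -(prednK b_gt0).
  by rewrite -mulmxA src_arr -mulmxA -sE.
have y1 : w *m T y ^+ 1 = 0 /\ T y ^+ 1 *m g = 0 by rewrite expr1 Ty0 mulmx0 mul0mx.
have [wy1 yg1] := y1; have w1 : w *m T y ^+ 0 = w by rewrite expr0 mulmx1.
have Pfg : P false a.-1 *m g = 0 by rewrite Pa0 mul0mx.
have [[le_am [u [f [[ux xf] ua af uw gf]]]]|Ag] := side false a a_gt0 le_a wa Pfg;
  have [[le_cm [v [h [[vz zh] vc ch vw gh]]]]|Bg] := side true c c_gt0 le_c wc Pg.
- apply: (sink3 (x := src false) (y := y) (z := src true) (d1 := false) (d2 := true)
    (a := a) (b := 1) (c := c) (u := u) (w := w) (v := v) (f := f) (g := g) (h := h));
  by rewrite /= ?w1 //; apply: (@le_blocks3 a 1 c m (leqW le_am) (ltn0Sn _) (leqW le_cm)).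
- apply: (@sink_two_blocks false _ a 1 u w f g); rewrite /= ?w1 //.
    exact: (@le_blocks2 a 1 m (leqW le_am) (ltn0Sn _)).
  by case.
- apply: (@sink_two_blocks true _ c 1 v w h g); rewrite /= ?w1 //.
    exact: (@le_blocks2 c 1 m (leqW le_cm) (ltn0Sn _)).
  by case.
apply: (@sink_block _ 1 w g); rewrite /= ?w1 //.
by case.
Qed.

(** Arrows with a kernel split off a simple summand, so they are injective.  Let F be the
    last nonzero image of a power of [N = T y].  A nonzero vector of F lying in both
    images of arrows, in exactly one, or outside their sum gives a chain of blocks.
    Otherwise some w in F is p + q with p and q in the two images, and two blocks at y
    are needed. *)
Lemma sink_prime_form_trivial_sources m1 : m1%:R = -1 :> k ->
  (forall d, T (src d) = 0) -> prime_form idm T arr (4 * m.+1).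
Proof.
move=> m1E Tsrc0.
case: (classic (exists d, exists2 u : 'rV_n, u *m idm (src d) = u & u != 0 /\ u *m arr d = 0)).
  move=> [d [u ux [nzu u0]]].
  have [||||f [xf _ uf]] := @separate_hom k n n u 0 (idm (src d)).
  - exact: idmK.
  - exact: ux.
  - by rewrite mul0mx.
  - by rewrite submx0.
  apply: (one (x := src d) (a := 1) (u := u) (f := f)) => //.
  - by rewrite expr1 Tsrc0 mulmx0.
  - by rewrite expr1 Tsrc0 mul0mx.
  - by rewrite expr0 mulmx1.
  - move=> d'; case: (eqVneq d' d) => [->//|neq].
    by apply: not_src ux _; rewrite eq_sym src_inj.
  by move=> d'; apply: not_tgt xf _; rewrite tgty.
move=> no_ker.
have inj d (u : 'rV_n) : u *m idm (src d) = u -> u *m arr d = 0 -> u = 0.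
  move=> ux u0; apply: NNPP => nzu; apply: no_ker; exists d, u => //; split=> //.
  exact/eqP.
case: (eqVneq (idm y) 0) => [y0|nzy].
  by apply: arrow_free => [|d]; [rewrite mulSn (leq_trans (leqnSn m)) // leq_addr | rewrite -arry y0 mulmx0].
have [i lt_i [nzi i1]] := loop_length nzy.
set N := T y in nzi i1; set F := idm y *m N ^+ i.
have Ni1 : N ^+ i.+1 = 0 by rewrite -i1 idm_powS.
have FN (w : 'rV_n) : (w <= F)%MS -> exists2 w', w' *m idm y = w' & w = w' *m N ^+ i.
  by move=> /submxP[s ->]; exists (s *m idm y); rewrite ?mulmxA // -mulmxA idmK.
have imarr d (w : 'rV_n) : (w <= arr d)%MS ->
    exists2 u, u *m idm (src d) = u & w = u *m arr d.
  move=> /submxP[s ->]; exists (s *m idm (src d)); first by rewrite -mulmxA idmK.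
  by rewrite -mulmxA src_arr.
have arr_f d (g : 'cV_n) : idm (src d) *m (arr d *m g) = arr d *m g.
  by rewrite mulmxA src_arr.
have t1 d (u : 'rV_n) : u *m T (src d) ^+ 1 = 0 by rewrite expr1 Tsrc0 mulmx0.
have t2 d (f : 'cV_n) : T (src d) ^+ 1 *m f = 0 by rewrite expr1 Tsrc0 mul0mx.
have t3 d (f : 'cV_n) : f = T (src d) ^+ 0 *m f by rewrite expr0 mul1mx.
have w_top (w : 'rV_n) : w *m N ^+ i.+1 = 0 by rewrite Ni1 mulmx0.
have g_top (g : 'cV_n) : N ^+ i.+1 *m g = 0 by rewrite Ni1 mul0mx.
have Fy (w : 'rV_n) : (w <= F)%MS -> w *m idm y = w.
  by move=> /submxP[s ->]; rewrite /F -!mulmxA -idm_powC (mulmxA (idm y)) idmK.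
have arr_y d (w : 'rV_n) : (w <= arr d)%MS -> w *m idm y = w.
  by move=> /submxP[s ->]; rewrite -mulmxA arry.
case: (classic (exists w : 'rV_n, [/\ w != 0, (w <= F)%MS, (w <= arr false)%MS &
  (w <= arr true)%MS])) => [[w [nzw wF wA wB]]|noFAB].
  have [w' wy' wE'] := FN w wF; have [u ux uE] := imarr _ w wA.
  have [v vz vE] := imarr _ w wB.
  have [||||g [yg _ wg]] := @separate_hom k n n w 0 (idm y).
  - exact: idmK.
  - exact: Fy.
  - by rewrite mul0mx.
  - by rewrite submx0.
  apply: (sink3 (x := src false) (y := y) (z := src true) (d1 := false) (d2 := true)
    (a := 1) (b := i.+1) (c := 1) (u := u) (w := w') (v := v)
    (f := arr false *m g) (g := g) (h := arr true *m g)) => //=; rewrite -?t3 -?wE' //.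
  exact: le_top_blocks3.
have two_case d : (exists w : 'rV_n, [/\ w != 0, (w <= F)%MS & (w <= arr d)%MS]) ->
    prime_form idm T arr (4 * m.+1).
  move=> [w [nzw wF wA]]; have [w' wy' wE'] := FN w wF; have [u ux uE] := imarr _ w wA.
  have [||||g [yg Bg wg]] := @separate_hom k n n w (arr (~~ d)) (idm y).
  - exact: idmK.
  - exact: Fy.
  - by rewrite arry.
  - apply/negP => wB; apply: noFAB; exists w; move: wA wB.
    by case: (d) => /= wA wB; split.
  apply: (@sink_two_blocks d _ 1 i.+1 u w' (arr d *m g) g) => //=; rewrite -?t3 -?wE' //.
    exact: le_top_blocks2.
  by move=> d' neq; suff -> : d' = ~~ d by []; move: neq; case: (d); case: (d').
case: (classic (exists w : 'rV_n, [/\ w != 0, (w <= F)%MS & (w <= arr false)%MS])).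
  exact: two_case.
case: (classic (exists w : 'rV_n, [/\ w != 0, (w <= F)%MS & (w <= arr true)%MS])).
  by move=> h _; apply: two_case h.
move=> noFB noFA.
have FA0 d (w : 'rV_n) : (w <= F)%MS -> (w <= arr d)%MS -> w = 0.
  move=> wF wd; apply/eqP; apply: contraT => nzw.
  by case: d wd => wd; [case: noFB | case: noFA]; exists w.
case: (classic (exists w : 'rV_n, [/\ w != 0, (w <= F)%MS &
    (w <= arr false + arr true)%MS])); last first.
  move=> noFAB'; have /rowV0Pn[w wF nzw] := nzi.
  have [w' wy' wE'] := FN w wF.
  have [||||g [yg Sg wg]] := @separate_hom k n n w (arr false + arr true)%MS (idm y).
  - exact: idmK.
  - exact: Fy.
  - by rewrite addsmxMr !arry.
  - by apply/negP => wAB; apply: noFAB'; exists w.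
  apply: (@sink_block _ i.+1 w' g) => //; rewrite /= -?wE' //; first exact: le_block1.
  move=> d; have /submxP[t ->] : (arr d <= arr false + arr true)%MS.
    by case: (d); [apply: addsmxSr | apply: addsmxSl].
  by rewrite -mulmxA Sg mulmx0.
move=> [w0 [nzw0 w0F w0AB]].
(* Among all splittings w = p + q over the two images, take p as deep as possible in
   the images of the powers of N. *)
pose R j := exists (w' p' u v : 'rV[k]_n), [/\ w' *m N ^+ i != 0,
  w' *m idm y = w' /\ p' *m idm y = p',
  u *m idm (src false) = u /\ v *m idm (src true) = v,
  w' *m N ^+ i = u *m arr false + v *m arr true & u *m arr false = p' *m N ^+ j].
have R0 : R (i - i)%N.
  have [w' wy' wE'] := FN w0 w0F; move: w0AB => /sub_addsmxP[[s t] /= w0E].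
  exists w', (s *m idm (src false) *m arr false), (s *m idm (src false)),
    (t *m idm (src true)); rewrite -wE'; split=> //.
  - by rewrite -!mulmxA arry.
  - by rewrite -!mulmxA !idmK.
  - by rewrite -!mulmxA !src_arr.
  by rewrite subnn expr0 mulmx1.
have [l [Rl min_l]] := classical_min (ex_intro (fun l => R (i - l)%N) i R0).
have le_li := min_l i R0.
have [w' [p' [u [v [nzw [wy' py'] [ux vz] wE pE]]]]] := Rl.
have wF : (w' *m N ^+ i <= F)%MS by rewrite -wy' -mulmxA submxMl.
have l_gt0 : (0 < l)%N.
  rewrite lt0n; apply/eqP => l0; rewrite l0 subn0 in pE.
  have p0 : u *m arr false = 0.
    apply: (FA0 false); last exact: submxMl.
    by rewrite pE -py' -mulmxA submxMl.
  case/negP: nzw; apply/eqP; apply: (FA0 true) => //.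
  by rewrite wE p0 add0r submxMl.
have l_range : (0 < l <= i)%N by rewrite l_gt0.
have := subn_pred_le l_range; have := subn_pred_shift l_range; have := le_blocks4 l lt_i.
move: Rl pE; set j := (i - l)%N => Rl pE size_ij j1 lt_ji.
have NiE : N ^+ i = N ^+ (i - j.+1) *m N ^+ j.+1 by rewrite mulmxE -exprD subnK.
(* g + h has to agree with h on the image of the first arrow and to vanish on that of the
   second, so h must vanish on their intersection. *)
pose S := (N ^+ j.+1 + (arr false :&: arr true))%MS.
have Ny : N ^+ j.+1 *m idm y = N ^+ j.+1 by rewrite -idm_powC idm_powS.
have capy : (arr false :&: arr true)%MS *m idm y = (arr false :&: arr true)%MS.
  by have /submxP[t ->] := capmxSl (arr false) (arr true); rewrite -mulmxA arry.
have [||||h [yh Sh ph]] := @separate_hom k n n (u *m arr false) S (idm y).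
- exact: idmK.
- by rewrite -mulmxA arry.
- by rewrite /S addsmxMr capy Ny.
- apply/negP => /sub_addsmxP[[s t]] /= e.
  have [ur urx urE] := imarr false (t *m (arr false :&: arr true)%MS) (submx_trans (submxMl t _) (capmxSl _ _)).
  have [vr vrx vrE] := imarr true (t *m (arr false :&: arr true)%MS) (submx_trans (submxMl t _) (capmxSr _ _)).
  have : (l <= l.-1)%N; last by rewrite leqNgt ltn_predL l_gt0.
  apply: min_l; rewrite -j1; exists w', (s *m idm y), (u - ur), (v + vr).
  rewrite wE !mulmxBl !mulmxDl -urE -vrE ux vz urx vrx -!mulmxA idmK idm_powS; split=> //.
  - by rewrite -wE.
  - by rewrite addrACA addNr addr0.
  by rewrite e addrK.
have Nh : N ^+ j.+1 *m h = 0.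
  have /submxP[t ->] : (N ^+ j.+1 <= S)%MS by apply: addsmxSl.
  by rewrite -mulmxA Sh mulmx0.
have caph : (arr false :&: arr true)%MS *m h = 0.
  have /submxP[t ->] : ((arr false :&: arr true)%MS <= S)%MS by apply: addsmxSr.
  by rewrite -mulmxA Sh mulmx0.
have [|f0 [Af0 Bf0]] := @extend_functional2 k n n n (arr false) (arr false *m h) (arr true).
  move=> s t /eqP; rewrite addr_eq0 => /eqP e; rewrite mulmxA.
  have /submxP[q ->] : (s *m arr false <= arr false :&: arr true)%MS.
    by rewrite sub_capmx submxMl e -mulNmx submxMl.
  by rewrite -mulmxA caph mulmx0.
pose g := idm y *m f0 - h.
have yg : idm y *m g = g by rewrite /g mulmxBr mulmxA idmK yh.
have Ag : arr false *m g = 0 by rewrite /g mulmxBr mulmxA arry Af0 subrr.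
have Bg : arr true *m g = - (arr true *m h) by rewrite /g mulmxBr mulmxA arry Bf0 sub0r.
have wh : w' *m N ^+ i *m h = 0 by rewrite NiE -!mulmxA Nh !mulmx0.
have pg : u *m arr false *m g = 0 by rewrite -mulmxA Ag mulmx0.
have wg : w' *m N ^+ i *m g = 1%:M.
  have vh : v *m arr true *m h = - 1%:M.
    by apply/eqP; rewrite -addr_eq0 -ph -mulmxDl addrC -wE wh.
  by rewrite wE mulmxDl pg add0r -mulmxA Bg mulmxN mulmxA vh opprK.
apply: (four (x := src false) (y := y) (z := src true) (d1 := false) (d2 := true)
  (a := i.+1) (b := j.+1) (u := u) (w1 := w') (w2 := p') (v := v)
  (f := arr false *m h) (g1 := g) (g2 := h) (h := arr true *m g) (m1 := m1)) => //=.
- by rewrite exprSr -mulmxE mulmxA -pE -mulmxA arrT mulmx0.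
- by rewrite -pE.
- by rewrite -pE.
- by rewrite -/N wE pE addrC addKr.
by rewrite Bg opprK.
Qed.
End Sink.
End Families.

(** * Category algebras of finite type *)

(** In characteristic p, [(G - E) ^+ (p ^ e) = G ^+ (p ^ e) - E]. *)
Lemma unipotent_nilpotent (k : fieldType) p e n (E G : 'M[k]_n) : p \in [pchar k] ->
  E *m E = E -> E *m G = G -> G *m E = G -> E *m G ^+ (p ^ e) = E -> (G - E) ^+ (p ^ e) = 0.
Proof.
case: n E G => [|n] E G char_p EE EG GE Gq; first by apply/matrixP => [[]].
have char_M : p \in [pchar 'M[k]_n.+1] by rewrite pchar_lalg.
have p_gt0 : (0 < p ^ e)%N by rewrite expn_gt0 prime_gt0 // (pcharf_prime char_p).
have cGE : GRing.comm G E by rewrite /GRing.comm -!mulmxE EG GE.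
have -> : (G - E) ^+ (p ^ e) = G ^+ (p ^ e) - E ^+ (p ^ e).
  elim: e {Gq p_gt0} => [|e IH]; first by rewrite !expr1.
  rewrite expnSr !exprM IH; apply: (pFrobenius_autB_comm char_M).
  by apply: commrX; apply: commr_sym; apply: commrX; apply: commr_sym.
have Eq i : E ^+ i.+1 = E by elim: i => [|i IH]; rewrite ?expr1 // exprS IH -mulmxE.
have EGi i : E *m G ^+ i.+1 = G ^+ i.+1.
  by rewrite exprS; change (E *m (G *m G ^+ i) = G *m G ^+ i); rewrite mulmxA EG.
by move: Gq; rewrite -(prednK p_gt0) EGi Eq => ->; rewrite subrr.
Qed.

Section PrimeBounded.
Variables (k : fieldType) (C : fincat).

Definition prime_bounded D := forall r : rep k C, rep_indec r ->
  exists r' : rep k C, [/\ (rdim r' <= D)%N, rep_iso r r' &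
    forall x y (f : hom C x y), prime_entries (ract r' f)].

Lemma prime_entriesM n m q (M : 'M[k]_(n, m)) (N : 'M_(m, q)) :
  prime_entries M -> prime_entries N -> prime_entries (M *m N).
Proof.
move=> pM pN i j; rewrite mxE; apply: (big_ind (fun c : k => exists a, c = a%:R)) => [|_ _ [a ->] [b ->]|l _].
- by exists 0%N.
- by exists (a + b)%N; rewrite natrD.
by have [a ->] := pM i l; have [b ->] := pN l j; exists (a * b)%N; rewrite natrM.
Qed.

Lemma prime_entriesD n m (M N : 'M[k]_(n, m)) :
  prime_entries M -> prime_entries N -> prime_entries (M + N).
Proof.
move=> pM pN i j; rewrite mxE; have [a ->] := pM i j; have [b ->] := pN i j.
by exists (a + b)%N; rewrite natrD.
Qed.

Section Generated.
Variables (p : nat) (char_p : p \in [pchar k]).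
Hypothesis C_EI : EI C.
Hypothesis cyc : forall x, cyclic [set: autc C x].
Hypothesis card_p : forall x, exists e, #|[set: autc C x]| = (p ^ e)%N.
Variables (src tgt : bool -> ob C) (aa : forall d, hom C (src d) (tgt d)).
Hypothesis fixl : forall d (g : hom C (tgt d) (tgt d)), compc g (aa d) = aa d.
Hypothesis fixr : forall d (g : hom C (src d) (src d)), compc (aa d) g = aa d.
Hypothesis cover : forall (r : rep k C) x y (f : hom C x y), x != y ->
  (exists d, ract r f = ract r (aa d)) \/
  (exists d d', ract r f = ract r (aa d) *m ract r (aa d')).

Lemma cyc_ex x : exists g : autc C x, [set: autc C x] == <[g]>%g.
Proof. by have /cyclicP[g ->] := cyc x; exists g. Qed.
Definition aut_gen x : autc C x := xchoose (cyc_ex x).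
Lemma aut_genP x : [set: autc C x] = <[aut_gen x]>%g.
Proof. exact/eqP/(xchooseP (cyc_ex x)). Qed.

Variable r : rep k C.
Let idm x := ract r (idc C x).
Let T x := ract r (aut_val (aut_gen x)) - idm x.
Let arr d := ract r (aa d).

Lemma endo_pow x (f : hom C x x) : exists i,
  forall r' : rep k C, ract r' f = ract r' (idc C x) *m ract r' (aut_val (aut_gen x)) ^+ i.
Proof.
have [g <-] : exists g : autc C x, aut_val g = f by exists (MkAut (C_EI f)).
have : g \in <[aut_gen x]>%g by rewrite -aut_genP inE.
move=> /cycleP[i ->]; exists i => r'; elim: i => [|i IH].
  by rewrite expg0 expr0 mulmx1.
by rewrite expgS exprSr /= ractM IH -mulmxE !mulmxA.
Qed.

Lemma idmM x y : idm x *m idm y = if x == y then idm x else 0.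
Proof.
by case: eqVneq => [<-|neq]; [rewrite -ractM compId | rewrite ract0].
Qed.

Lemma idmT x y : idm x *m T y = if x == y then T y else 0.
Proof.
rewrite mulmxBr idmM; case: eqVneq => [<-|neq]; last by rewrite ract0 // subrr.
by rewrite -ractM compfId.
Qed.

Lemma Tidm x y : T x *m idm y = if x == y then T x else 0.
Proof.
rewrite mulmxBl idmM; case: eqVneq => [<-|neq]; last by rewrite ract0 // subrr.
by rewrite -ractM compId.
Qed.

Lemma arrT d x : arr d *m T x = 0.
Proof.
rewrite mulmxBr; case: (eqVneq (tgt d) x) => [<-|neq]; last by rewrite !ract0 // subrr.
by rewrite -!ractM !fixl subrr.
Qed.

Lemma Tarr d x : T x *m arr d = 0.
Proof.
rewrite mulmxBl; case: (eqVneq x (src d)) => [->|neq]; last by rewrite !ract0 // subrr.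
by rewrite -!ractM !fixr subrr.
Qed.

Lemma src_arr d : idm (src d) *m arr d = arr d.
Proof. by rewrite -ractM compfId. Qed.

Lemma arr_tgt d : arr d *m idm (tgt d) = arr d.
Proof. by rewrite -ractM compId. Qed.

Lemma sum_idm : \sum_x idm x = 1%:M.
Proof. exact: ract1. Qed.

(** An automorphism of x is a power of the generator [idm x + T x]. *)
Lemma generated (S : 'M[k]_(rdim r) -> Prop) :
    (forall x, S (idm x)) -> (forall x, S (T x)) -> (forall d, S (arr d)) ->
    (forall M N, S M -> S N -> S (M *m N)) -> (forall M N, S M -> S N -> S (M + N)) ->
  forall x y (f : hom C x y), S (ract r f).
Proof.
move=> Sid ST Sarr SM SD x y f; case: (eqVneq x y) f => [<- f|neq f]; last first.
  case: (cover r f neq) => [[d ->]|[d [d' ->]]]; first exact: Sarr.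
  by apply: SM; apply: Sarr.
have [i ->] := endo_pow f.
have Sg : S (ract r (aut_val (aut_gen x))).
  by have := SD _ _ (ST x) (Sid x); rewrite /T subrK.
elim: i => [|i IH]; first by rewrite expr0 mulmx1; apply: Sid.
by rewrite exprSr -mulmxE mulmxA; apply: SM.
Qed.

Lemma gens_indec_of : rep_indec r -> gens_indec idm T arr.
Proof.
move=> [r_gt0 ind]; split=> // E EE Eid ET Earr; apply: ind => //.
apply: (@generated (fun M => M *m E = E *m M)) => // M N eM eN.
  by rewrite -mulmxA eN !mulmxA eM.
by rewrite mulmxDl mulmxDr eM eN.
Qed.

Lemma prime_form_rep N : prime_form idm T arr N ->
  exists r' : rep k C, [/\ (rdim r' <= N)%N, rep_iso r r' &
    forall x y (f : hom C x y), prime_entries (ract r' f)].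
Proof.
move=> [d [B [F [le_d BF FB [pid pT parr]]]]].
have comm x y (f : hom C x y) : ract r f *m (F *m B) = F *m B *m ract r f.
  by rewrite FB mulmx1 mul1mx.
exists (summand BF comm); split=> //.
  by exists F, B; split=> // x y f; apply: summand_proj.
move=> x y f /=; apply: (@generated (fun M => prime_entries (B *m M *m F))) => // M N' pM pN.
  suff -> : B *m (M *m N') *m F = B *m M *m F *m (B *m N' *m F) by apply: prime_entriesM.
  by rewrite !mulmxA -(mulmxA _ F B) FB mulmx1.
by rewrite mulmxDr mulmxDl; apply: prime_entriesD.
Qed.

Definition nil_bound := (\sum_x #|[set: autc C x]|)%N.

Lemma T_nil x : T x ^+ nil_bound = 0.
Proof.
have [e card_x] := card_p x.
have Te : T x ^+ (p ^ e) = 0.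
  apply: unipotent_nilpotent => //.
  - by rewrite idmM eqxx.
  - by rewrite -ractM compfId.
  - by rewrite -ractM compId.
  have pow i : aut_val (aut_gen x ^+ i)%g = iter i (compc (aut_val (aut_gen x))) (idc C x).
    by elim: i => [|i IH]; rewrite ?expg0 // expgS /= IH.
  have ri i : ract r (aut_val (aut_gen x ^+ i)%g) = idm x *m ract r (aut_val (aut_gen x)) ^+ i.
    elim: i => [|i IH]; first by rewrite expg0 expr0 mulmx1.
    by rewrite expgS exprSr /= ractM IH -mulmxE !mulmxA.
  by rewrite -ri -card_x expg_cardG ?inE.
have le_n : (p ^ e <= nil_bound)%N by rewrite -card_x /nil_bound (bigD1 x) //= leq_addr.
by rewrite -(subnKC le_n) exprD Te mul0r.
Qed.
End Generated.

End PrimeBounded.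

(** Transposition exchanges the representations of a category and of its opposite. *)
Lemma prime_bounded_op (k : fieldType) (C : fincat) D :
  prime_bounded k (opcat C) D -> prime_bounded k C D.
Proof.
move=> bnd r [r_gt0 ind].
pose act x y (f : hom (opcat C) x y) := (ract r (f : hom C y x))^T.
have actM x y z (f : hom (opcat C) y z) (g : hom (opcat C) x y) :
  act _ _ (compc f g) = act _ _ g *m act _ _ f by rewrite /act /= ractM trmx_mul.
have act0 x y y' z (f : hom (opcat C) y' z) (g : hom (opcat C) x y) :
  y != y' -> act _ _ g *m act _ _ f = 0.
  by move=> neq; rewrite /act -trmx_mul ract0 ?trmx0 // eq_sym.
have act1 : \sum_x act _ _ (idc (opcat C) x) = 1%:M.
  by rewrite /act -raddf_sum /= ract1 trmx1.
have [|r' [le_D [P [Q [PQ QP fP]]] pr]] := bnd (Rep actM act0 act1).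
  split=> // E EE fE; case: (ind E^T).
  - by rewrite -trmx_mul EE.
  - by move=> x y f; apply: trmx_inj; rewrite !trmx_mul trmxK; apply: esym (fE y x f).
  - by move=> /(congr1 trmx); rewrite trmxK trmx0; left.
  by move=> /(congr1 trmx); rewrite trmxK trmx1; right.
pose act' x y (f : hom C x y) := (ract r' (f : hom (opcat C) y x))^T.
have actM' x y z (f : hom C y z) (g : hom C x y) :
  act' _ _ (compc f g) = act' _ _ g *m act' _ _ f.
  by rewrite /act' -trmx_mul -(@ractM _ _ r').
have act0' x y y' z (f : hom C y' z) (g : hom C x y) :
  y != y' -> act' _ _ g *m act' _ _ f = 0.
  by move=> neq; rewrite /act' -trmx_mul (@ract0 _ _ r') ?trmx0 // eq_sym.
have act1' : \sum_x act' _ _ (idc C x) = 1%:M.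
  by rewrite /act' -raddf_sum -trmx1 -(ract1 r').
exists (Rep actM' act0' act1'); split=> //; last first.
  by move=> x y f i j; have [a] := pr _ _ (f : hom (opcat C) y x) j i; rewrite mxE; exists a.
exists Q^T, P^T; split=> [||x y f] /=; rewrite -?trmx_mul ?PQ ?QP ?trmx1 //.
rewrite -[ract r f]trmxK -trmx_mul; congr trmx.
have := rep_iso_intertwine_inv PQ QP fP (f : hom (opcat C) y x).
by [].
Qed.

Section ListedFinite.
Variables (k : fieldType) (p : nat) (char_p : p \in [pchar k]).

Lemma trivial_aut C (r : rep k C) (cyc : forall x, cyclic [set: autc C x]) x :
  #|[set: autc C x]| = 1%N -> ract r (aut_val (aut_gen cyc x)) - ract r (idc C x) = 0.
Proof.
rewrite cardsT => /fintype1[g all_g].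
by rewrite (all_g (aut_gen cyc x)) -(all_g 1%g) subrr.
Qed.

Lemma minus_one_natural : exists m1, m1%:R = -1 :> k.
Proof.
exists p.-1; apply/eqP; rewrite -subr_eq0 opprK natr1 prednK ?(pcharf0 char_p) //.
exact: prime_gt0 (pcharf_prime char_p).
Qed.

Lemma three_objects r s t C (x y z : ob C) : cyclic_three p r s t x y z ->
  [/\ EI C, forall w, cyclic [set: autc C w],
      forall w, exists e, #|[set: autc C w]| = (p ^ e)%N,
      [/\ x != y, x != z & y != z] & forall w, [\/ w = x, w = y | w = z] ].
Proof.
move=> [[EIC _] [un all3] [cx nx] [cy ny] [cz nz]].
have split3 w : [\/ w = x, w = y | w = z].
  have := all3 w; rewrite !inE => /or3P[] /eqP e; by [constructor 1 | constructor 2 | constructor 3].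
split=> //; last first.
- by move: un; rewrite /= !inE negb_or andbT => /andP[/andP[-> ->] ->].
- by move=> w; case: (split3 w) => ->; [exists r | exists s | exists t].
by move=> w; case: (split3 w) => ->.
Qed.

Lemma first_family_bounded r s t C : first_family p r s t C ->
  exists D, prime_bounded k C D.
Proof.
move=> [x [y [z [three homs]]]].
have [EIC cyc card_p [nxy nxz nyz] all3] := three_objects three.
have hom1 a b : a != b -> (a, b) \in [:: (x, y); (y, z); (x, z)] -> #|hom C a b| = 1%N.
  by move=> neq inl; rewrite homs // inl.
have [al al_all] : {a : hom C x y | all_equal_to a}.
  by apply: fintype1; apply: hom1; rewrite // !inE eqxx.
have [be be_all] : {a : hom C y z | all_equal_to a}.
  by apply: fintype1; apply: hom1; rewrite // !inE eqxx ?orbT.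
have [ga ga_all] : {a : hom C x z | all_equal_to a}.
  by apply: fintype1; apply: hom1; rewrite // !inE eqxx ?orbT.
pose src d := if d then y else x; pose tgt d := if d then z else y.
pose aa d : hom C (src d) (tgt d) :=
  match d return hom C (src d) (tgt d) with true => be | false => al end.
have fixl d (g : hom C (tgt d) (tgt d)) : compc g (aa d) = aa d.
  by case: d g => g /=; [rewrite [compc _ _]be_all | rewrite [compc _ _]al_all].
have fixr d (g : hom C (src d) (src d)) : compc (aa d) g = aa d.
  by case: d g => g /=; [rewrite [compc _ _]be_all | rewrite [compc _ _]al_all].
have cover (rp : rep k C) a b (f : hom C a b) : a != b ->
    (exists d, ract rp f = ract rp (aa d)) \/
    (exists d d', ract rp f = ract rp (aa d) *m ract rp (aa d')).
  move=> neq; have: (a, b) \in [:: (x, y); (y, z); (x, z)].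
    by apply: contraT => /negPf nin; have := homs _ _ neq; rewrite nin => /card0_eq/(_ f).
  rewrite !inE !xpair_eqE => /or3P[] /andP[/eqP ea /eqP eb]; subst a b.
  - by left; exists false; rewrite (al_all f).
  - by left; exists true; rewrite (be_all f).
  by right; exists false, true; rewrite -ractM (ga_all f) -(ga_all (compc be al)).
exists (3 * (nil_bound C).+1)%N => rp ind.
apply: (prime_form_rep EIC (cyc := cyc) cover).
apply: (path_prime_form (idmT _ _) (Tidm _ _) (idmM _) (arrT _ fixl _) (Tarr _ fixr _)
  (src_arr _ _) (arr_tgt _ _) (gens_indec_of EIC cyc cover ind) (sum_idm _)
  (T_nil char_p cyc card_p rp) (x := x) (y := y) (z := z)) => //.
by rewrite /= !inE negb_or nxy nxz nyz.
Qed.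

Lemma second_family_setup r s t C : second_family p r s t C ->
  exists x y z (src : bool -> ob C) (aa : forall d, hom C (src d) y)
     (cyc : forall w, cyclic [set: autc C w]),
  [/\ cyclic_three p r s t x y z, src false = x /\ src true = z,
      EI C /\ (forall w, exists e, #|[set: autc C w]| = (p ^ e)%N),
      (forall d (g : hom C y y), compc g (aa d) = aa d) /\
      (forall d (g : hom C (src d) (src d)), compc (aa d) g = aa d) &
      forall (rp : rep k C) a b (f : hom C a b), a != b ->
    (exists d, ract rp f = ract rp (aa d)) \/
    (exists d d', ract rp f = ract rp (aa d) *m ract rp (aa d'))].
Proof.
move=> [x [y [z [three homs]]]].
have [EIC cyc card_p [nxy nxz nyz] all3] := three_objects three.
have hom1 a b : a != b -> (a, b) \in [:: (x, y); (z, y)] -> #|hom C a b| = 1%N.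
  by move=> neq inl; rewrite homs // inl.
have [al al_all] : {a : hom C x y | all_equal_to a}.
  by apply: fintype1; apply: hom1; rewrite // !inE eqxx.
have [be be_all] : {a : hom C z y | all_equal_to a}.
  by apply: fintype1; apply: hom1; rewrite // ?inE ?eqxx ?orbT // eq_sym.
pose src d := if d then z else x.
pose aa d : hom C (src d) y :=
  match d return hom C (src d) y with true => be | false => al end.
exists x, y, z, src, aa, cyc; split=> //.
  by split=> -[] g; first [exact: be_all | exact: al_all].
move=> rp a b f neq; have: (a, b) \in [:: (x, y); (z, y)].
  by apply: contraT => /negPf nin; have := homs _ _ neq; rewrite nin => /card0_eq/(_ f).
rewrite !inE !xpair_eqE => /orP[] /andP[/eqP ea /eqP eb]; subst a b; left.
  by exists false; rewrite (al_all f).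
by exists true; rewrite (be_all f).
Qed.

Lemma second_family_bounded r s t C : second_family p r s t C ->
  s = 0%N \/ r = 0%N /\ t = 0%N -> exists D, prime_bounded k C D.
Proof.
move=> /second_family_setup[x [y [z [src [aa [cyc
  [three [sx sz] [EIC card_p] [fixl fixr] cover]]]]]]] trivial.
have [_ _ _ [nxy nxz nyz] _] := three_objects three.
exists (4 * (nil_bound C).+1)%N => rp ind.
apply: (prime_form_rep EIC (cyc := cyc) cover).
have srcy d : src d != y by case: d; rewrite ?sx ?sz // eq_sym.
have src_neq : src false != src true by rewrite sx sz.
case: three => _ _ [_ cx] [_ cy] [_ cz].
case: trivial => [s0|[r0 t0]].
  have [d [B [F [le_d BF FB pr]]]] := sink_prime_form_trivial_center (idmT _ _) (Tidm _ _)
    (idmM _) (arrT _ fixl _) (Tarr _ fixr _)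
    (src_arr _ _) (arr_tgt _ _) (gens_indec_of EIC cyc cover ind) (sum_idm _)
    (T_nil char_p cyc card_p rp) (y := y) (fun=> erefl) srcy src_neq
    (trivial_aut rp cyc (etrans cy (congr1 _ s0))).
  by exists d, B, F; split=> //; apply: leq_trans le_d _; rewrite leq_mul2r orbT.
have [m1 m1E] := minus_one_natural.
apply: (sink_prime_form_trivial_sources (idmT _ _) (Tidm _ _)
    (idmM _) (arrT _ fixl _) (Tarr _ fixr _)
    (src_arr _ _) (arr_tgt _ _) (gens_indec_of EIC cyc cover ind) (sum_idm _)
    (T_nil char_p cyc card_p rp) (y := y) (fun=> erefl) srcy src_neq m1E).
by case; apply: trivial_aut; rewrite ?sx ?sz ?cx ?cz ?r0 ?t0.
Qed.

Lemma listed_bounded C : listed p C -> exists D, prime_bounded k C D.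
Proof.
case=> [[r [s [t f1]]]|[r [s [t [f2 s0]]]]|[r [s [t [f2 rt0]]]]].
- exact: first_family_bounded f1.
- by apply: second_family_bounded f2 _; left.
by apply: second_family_bounded f2 _; right.
Qed.

Theorem listed_finite_type C : listed p C \/ listed p (opcat C) ->
  finite_rep_type (catalg k C).
Proof.
move=> lst; have [D bnd] : exists D, prime_bounded k C D.
  case: lst => /listed_bounded // [D bnd]; exists D; exact: prime_bounded_op.
exact: finite_rep_type_of_prime char_p bnd.
Qed.
End ListedFinite.

(** * One-parameter families of functors *)

(** The polynomial 1 + prod (X - b) has a root, which is none of the b. *)
Lemma closed_field_avoid (k : closedFieldType) (s : seq k) : exists a, a \notin s.
Proof.
pose q := \prod_(b <- s) ('X - b%:P) + 1; case: s @q => [|b s] q; first by exists 0.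
have szq : size q = (size (b :: s)).+1.
  by rewrite /q size_polyDl size_prod_XsubC // size_poly1.
have /closed_rootP[a] : size q != 1 by rewrite szq.
rewrite /root hornerD hornerC => qa; exists a; apply/negP => s_a.
move: qa; rewrite horner_prod (big_rem a) //= !hornerE subrr mul0r add0r.
by rewrite oner_eq0.
Qed.

Section Distinct.
Variable k : closedFieldType.
Let fresh (s : seq k) : k := xchoose (closed_field_avoid s).
Let past := fix past n := if n is m.+1 then fresh (past m) :: past m else [::].
Definition distinct n : k := fresh (past n).

Lemma distinct_inj : injective distinct.
Proof.
have in_past i j : (i < j)%N -> distinct i \in past j.
  elim: j => //= j IH; rewrite ltnS leq_eqVlt inE => /orP[/eqP->|/IH->].
    by rewrite eqxx.
  by rewrite orbT.
have avoid j : distinct j \notin past j := xchooseP (closed_field_avoid (past j)).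
move=> i j eq_ij; case: (ltngtP i j) => // /in_past.
  by rewrite eq_ij (negPf (avoid j)).
by rewrite -eq_ij (negPf (avoid i)).
Qed.
End Distinct.

Section Functors.
Variables (k : fieldType) (C : fincat) (n : nat).

Definition is_functor (F : forall x y, hom C x y -> 'M[k]_n) :=
  (forall x y z (f : hom C y z) (g : hom C x y),
     F _ _ (compc f g) = F _ _ g *m F _ _ f) /\ forall x, F _ _ (idc C x) = 1%:M.

Definition nat_iso (F F' : forall x y, hom C x y -> 'M[k]_n) :=
  exists phi : ob C -> 'M[k]_n, (forall x, phi x \in unitmx) /\
    forall x y (f : hom C x y), F _ _ f *m phi y = phi x *m F' _ _ f.

Local Notation S := (ob C * 'I_n)%type.

(** All the spaces of a functor together: coordinates are pairs of an object and an
    index, numbered by [enum_val]. *)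
Definition tmx (G : S -> S -> k) : 'M[k]_#|{: S}| :=
  \matrix_(i, j) G (enum_val i) (enum_val j).

Lemma tmx_eq G G' : (forall s t, G s t = G' s t) -> tmx G = tmx G'.
Proof. by move=> e; apply/matrixP => i j; rewrite !mxE. Qed.

Lemma tmxM G G' : tmx G *m tmx G' = tmx (fun s t => \sum_x \sum_i G s (x, i) * G' (x, i) t).
Proof.
apply/matrixP => i j; rewrite !mxE pair_bigA /=.
rewrite (reindex (@enum_rank S)) /=; last first.
  by exists enum_val => t _; rewrite ?enum_rankK ?enum_valK.
by apply: eq_bigr => -[x l] _; rewrite !mxE enum_rankK.
Qed.

Lemma tmx_ofK (P : 'M[k]_#|{: S}|) : P = tmx (fun s t => P (enum_rank s) (enum_rank t)).
Proof. by apply/matrixP => i j; rewrite mxE !enum_valK. Qed.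

Lemma tmx_inj G G' : tmx G = tmx G' -> forall s t, G s t = G' s t.
Proof.
by move=> e s t; have /matrixP/(_ (enum_rank s) (enum_rank t)) := e; rewrite !mxE !enum_rankK.
Qed.

Lemma tmx1 : 1%:M = tmx (fun s t => (s == t)%:R).
Proof. by apply/matrixP => i j; rewrite !mxE (inj_eq enum_val_inj). Qed.

Section RepOf.
Variable F : forall x y, hom C x y -> 'M[k]_n.
Hypothesis functF : is_functor F.

Definition functor_entry x y (f : hom C x y) (s t : S) : k :=
  if (s.1 == x) && (t.1 == y) then F f s.2 t.2 else 0.

Lemma functor_repM x y z (f : hom C y z) (g : hom C x y) :
  tmx (functor_entry (compc f g)) = tmx (functor_entry g) *m tmx (functor_entry f).
Proof.
rewrite tmxM; apply: tmx_eq => s t; rewrite (bigD1 y) //= [X in _ + X]big1 ?addr0.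
  rewrite /functor_entry /= eqxx andbT; case: (s.1 == x); last first.
    by rewrite big1 // => i _; rewrite mul0r.
  case: (t.1 == z); last by rewrite big1 // => i _; rewrite mulr0.
  by case: functF => -> _; rewrite mxE.
move=> y' neq; rewrite big1 // => i _.
by rewrite /functor_entry /= (negPf neq) andbF mul0r.
Qed.

Lemma functor_rep0 x y y' z (f : hom C y' z) (g : hom C x y) :
  y != y' -> tmx (functor_entry g) *m tmx (functor_entry f) = 0.
Proof.
move=> neq; rewrite tmxM; apply/matrixP => i j; rewrite !mxE big1 // => w _.
rewrite big1 // => l _; rewrite /functor_entry /=; case: (eqVneq w y) => [->|].
  by rewrite (negPf neq) mulr0.
by rewrite andbF mul0r.
Qed.

Lemma functor_rep1 : \sum_x tmx (functor_entry (idc C x)) = 1%:M.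
Proof.
rewrite tmx1; apply/matrixP => i j; rewrite summxE mxE.
under eq_bigr do rewrite mxE; case: (enum_val i) (enum_val j) => x a [y b].
rewrite (bigD1 x) //= big1 ?addr0 => [|x' neq].
  rewrite /functor_entry /= eqxx /=; case: functF => _ ->; rewrite mxE xpair_eqE.
  by rewrite [y == x]eq_sym; case: (x == y).
by rewrite /functor_entry /= eq_sym (negPf neq).
Qed.

Definition rep_of : rep k C := Rep functor_repM functor_rep0 functor_rep1.
End RepOf.

(** An isomorphism commutes with the idempotents of the objects, so it is block
    diagonal, and its diagonal blocks form the natural isomorphism. *)
Lemma rep_of_iso F F' (functF : is_functor F) (functF' : is_functor F') :
  rep_iso (rep_of functF) (rep_of functF') -> nat_iso F F'.
Proof.
move=> [P [Q [PQ QP fP]]]; move: PQ fP => /=.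
rewrite (tmx_ofK P) (tmx_ofK Q).
set p := fun s t => P _ _; set q := fun s t => Q _ _ => PQ fP.
have eP x y (f : hom C x y) s t : (\sum_w \sum_l functor_entry F f s (w, l) * p (w, l) t) =
    \sum_w \sum_l p s (w, l) * functor_entry F' f (w, l) t.
  by have := fP x y f; rewrite /= !tmxM => /tmx_inj; apply.
have eP' x y (f : hom C x y) i o j : \sum_l F _ _ f i l * p (y, l) (o, j) =
    if o == y then \sum_l p (x, i) (x, l) * F' _ _ f l j else 0.
  have := eP x y f (x, i) (o, j); rewrite (bigD1 y) //= [X in _ + X]big1 ?addr0; last first.
    move=> w neq; rewrite big1 // => l _.
    by rewrite /functor_entry /= (negPf neq) andbF mul0r.
  under eq_bigr do rewrite /functor_entry /= !eqxx /=.
  move=> ->; case: eqVneq => [->|/negPf neq]; last first.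
    rewrite big1 // => w _; rewrite big1 // => l _.
    by rewrite /functor_entry /= neq andbF mulr0.
  rewrite (bigD1 x) //= [X in _ + X]big1 ?addr0; last first.
    move=> w neq; rewrite big1 // => l _.
    by rewrite /functor_entry /= (negPf neq) mulr0.
  by apply: eq_bigr => l _; rewrite /functor_entry /= !eqxx.
have diag x o i j : o != x -> p (x, i) (o, j) = 0.
  move=> neq; have := eP' x x (idc C x) i o j; rewrite (negPf neq) => <-.
  have [_ ->] := functF; rewrite (bigD1 i) //= mxE eqxx mul1r big1 ?addr0 // => l nl.
  by rewrite mxE eq_sym (negPf nl) mul0r.
exists (fun x => \matrix_(i, j) p (x, i) (x, j)); split=> [x | x y f]; last first.
  apply/matrixP => i j; rewrite !mxE; have := eP' x y f i y j; rewrite eqxx => e.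
  by under eq_bigr do rewrite mxE; rewrite e; apply: eq_bigr => l _; rewrite mxE.
have /mulmx1_unit[] // : (\matrix_(i, j) p (x, i) (x, j)) *m (\matrix_(i, j) q (x, i) (x, j)) = 1%:M.
apply/matrixP => i j; rewrite !mxE; move: PQ; rewrite tmxM tmx1 => /tmx_inj/(_ (x, i) (x, j)).
rewrite xpair_eqE eqxx /= => <-; rewrite (bigD1 x) //= [X in _ = _ + X]big1 ?addr0.
  by apply: eq_bigr => l _; rewrite !mxE.
by move=> w neq; rewrite big1 // => l _; rewrite diag ?mul0r.
Qed.
End Functors.

Definition families_collide (k : fieldType) (C : fincat) :=
  forall n (F : k -> forall x y, hom C x y -> 'M[k]_n),
    (forall l, is_functor (F l)) -> exists l m, l != m /\ nat_iso (F l) (F m).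

Lemma finite_type_collide (k : closedFieldType) C :
  finite_rep_type (catalg k C) -> families_collide k C.
Proof.
move=> fin n F functF.
have [i [j [neq iso]]] := finite_type_family
   (I := fun i => rep_of (functF (distinct k i))) fin (fun=> erefl).
exists (distinct k i), (distinct k j); split; last exact: rep_of_iso iso.
by rewrite (inj_eq (@distinct_inj k)); apply/eqP.
Qed.

Lemma families_collide_op (k : fieldType) C :
  families_collide k C -> families_collide k (opcat C).
Proof.
move=> collide n F functF.
pose F' l x y (f : hom C x y) := (F l y x (f : hom (opcat C) y x))^T.
have functF' l : is_functor (F' l).
  have [FM F1] := functF l; split=> [x y z f g|x].
    by rewrite /F' -trmx_mul -FM.
  by rewrite /F' -(trmx1 k n) -(F1 x).
have [l [m [neq [phi [uphi fphi]]]]] := collide n F' functF'.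
exists m, l; split; first by rewrite eq_sym.
exists (fun x => (phi x)^T); split=> [x|x y f]; first by rewrite unitmx_tr.
apply: trmx_inj; rewrite !trmx_mul !trmxK.
by rewrite -[(F m x y f)^T]/(F' m y x (f : hom C y x)) -fphi.
Qed.

(** * Functors on a sink a -> b <- z *)

Section OnHom.
Variables (C : fincat) (V : Type).

(** Morphisms are compared inside [mor C], which avoids transport along equalities
    of objects. *)
Definition on_hom a b (e : hom C a b -> V) (d : V) x y (f : hom C x y) : V :=
  if [pick g : hom C a b | Mor g == Mor f] is Some g then e g else d.

Lemma on_homE a b e d (f : hom C a b) : on_hom e d f = e f.
Proof.
rewrite /on_hom; case: pickP => [g /eqP/Mor_inj->//|/(_ f)].
by rewrite eqxx.
Qed.

Lemma on_hom_out a b e d x y (f : hom C x y) :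
  (x, y) != (a, b) -> @on_hom a b e d x y f = d.
Proof.
move=> neq; rewrite /on_hom; case: pickP => // g /eqP/(congr1 tag) /= e'.
by rewrite e' eqxx in neq.
Qed.
End OnHom.

(** Both composites are invertible endomorphisms, so f is an isomorphism. *)
Lemma no_back C (EIC : EI C) (skel : skeletal C) x y (f : hom C x y) (g : hom C y x) :
  x = y.
Proof.
have /existsP[h /andP[/eqP h1 _]] := EIC _ (compc g f).
have /existsP[h' /andP[_ /eqP h2]] := EIC _ (compc f g).
apply: (skel _ _ f); apply/existsP; exists (compc h g).
rewrite -compA h1 eqxx /=; suff -> : compc h g = compc g h' by rewrite compA h2.
transitivity (compc (compc h (compc g f)) (compc g h')); last by rewrite h1 compId.
by rewrite -[LHS]compfId -h2 -!compA.
Qed.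

Section SinkFunctor.
Variables (k : fieldType) (C : fincat) (EIC : EI C) (skel : skeletal C) (n : nat).
Variables (a b z : ob C).
Hypotheses (nab : a != b) (nzb : z != b) (naz : a != z).
Variables (ea : hom C a a -> 'M[k]_n) (eb : hom C b b -> 'M[k]_n).
Variables (eab : hom C a b -> 'M[k]_n) (ezb : hom C z b -> 'M[k]_n).
Hypothesis eaM : forall f g, ea (compc f g) = ea g *m ea f.
Hypothesis ea1 : ea (idc C a) = 1%:M.
Hypothesis ebM : forall f g, eb (compc f g) = eb g *m eb f.
Hypothesis eb1 : eb (idc C b) = 1%:M.
Hypothesis eabr : forall f g, eab (compc f g) = ea g *m eab f.
Hypothesis eabl : forall f g, eab (compc f g) = eab g *m eb f.
Hypothesis ezbr : forall f (g : hom C z z), ezb (compc f g) = ezb f.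
Hypothesis ezbl : forall f g, ezb (compc f g) = ezb g *m eb f.
Hypothesis eab0 : forall c (f : hom C c b) (g : hom C a c),
  c != a -> c != b -> eab (compc f g) = 0.
Hypothesis ezb0 : forall c (f : hom C c b) (g : hom C z c),
  c != z -> c != b -> ezb (compc f g) = 0.

Definition sink_functor x y (f : hom C x y) : 'M[k]_n :=
  on_hom ea (on_hom eb (on_hom eab (on_hom ezb (x == y)%:R%:M f) f) f) f.

Lemma sink_aa f : @sink_functor a a f = ea f.
Proof. by rewrite /sink_functor on_homE. Qed.

Lemma sink_bb f : @sink_functor b b f = eb f.
Proof.
by rewrite /sink_functor on_hom_out ?on_homE // xpair_eqE eq_sym (negPf nab).
Qed.

Lemma sink_ab f : @sink_functor a b f = eab f.
Proof.
rewrite /sink_functor on_hom_out ?xpair_eqE 1?[b == a]eq_sym ?(negPf nab) ?andbF //.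
by rewrite on_hom_out ?on_homE // xpair_eqE (negPf nab).
Qed.

Lemma sink_zb f : @sink_functor z b f = ezb f.
Proof.
rewrite /sink_functor on_hom_out ?xpair_eqE 1?[b == a]eq_sym ?(negPf nab) ?andbF //.
rewrite on_hom_out ?xpair_eqE ?(negPf nzb) //.
by rewrite on_hom_out ?on_homE // xpair_eqE [z == a]eq_sym (negPf naz).
Qed.

Lemma sink_oo x (f : hom C x x) : x != a -> x != b -> sink_functor f = 1%:M.
Proof.
move=> nxa nxb; rewrite /sink_functor.
rewrite !on_hom_out ?xpair_eqE ?(negPf nxa) ?(negPf nxb) ?andbF //.
by rewrite eqxx.
Qed.

Lemma sink_0 x y (f : hom C x y) :
  x != y -> (x, y) != (a, b) -> (x, y) != (z, b) -> sink_functor f = 0.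
Proof.
move=> nxy nab' nzb'; rewrite /sink_functor.
have out c : (x, y) != (c, c).
  by apply/eqP => -[ex ey]; move: nxy; rewrite ex ey eqxx.
by rewrite !on_hom_out ?(negPf nxy) ?raddf0.
Qed.

Lemma sink_functorP : is_functor sink_functor.
Proof.
have nza : z != a by rewrite eq_sym.
split=> [x y w f g|x]; last first.
  case: (eqVneq x a) => [->|nxa]; first by rewrite sink_aa.
  by case: (eqVneq x b) => [->|nxb]; [rewrite sink_bb | rewrite sink_oo].
case: (eqVneq x y) g => [->|nxy] g.
  case: (eqVneq y w) f => [<-|nyw] f.
    case: (eqVneq y a) f g => [->|nya] f g; first by rewrite !sink_aa.
    case: (eqVneq y b) f g nya => [->|nyb] f g nya; first by rewrite !sink_bb.
    by rewrite !sink_oo // mulmx1.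
  case: (eqVneq (y, w) (a, b)) => [[ey ew]|neq1].
    by subst y w; rewrite !sink_ab sink_aa eabr.
  case: (eqVneq (y, w) (z, b)) => [[ey ew]|neq2].
    by subst y w; rewrite !sink_zb (sink_oo g nza nzb) mul1mx ezbr.
  by rewrite !(sink_0 _ nyw neq1 neq2) mulmx0.
case: (eqVneq y w) f => [<-|nyw] f.
  case: (eqVneq (x, y) (a, b)) => [[ex ey]|neq1].
    by subst x y; rewrite !sink_ab sink_bb eabl.
  case: (eqVneq (x, y) (z, b)) => [[ex ey]|neq2].
    by subst x y; rewrite !sink_zb sink_bb ezbl.
  by rewrite !(sink_0 _ nxy neq1 neq2) mul0mx.
have nxw : x != w.
  apply/eqP => ex; subst w; have := no_back EIC skel g f.
  by move/eqP; rewrite (negPf nxy).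
have -> : sink_functor g *m sink_functor f = 0.
  case: (eqVneq y b) => [yb|nyb].
    rewrite [sink_functor f]sink_0 ?mulmx0 // yb xpair_eqE ?[b == _]eq_sym;
      by rewrite ?(negPf nab) ?(negPf nzb).
  by rewrite [sink_functor g]sink_0 ?mul0mx // xpair_eqE (negPf nyb) andbF.
case: (eqVneq (x, w) (a, b)) => [[ex ew]|neq1].
  by subst x w; rewrite sink_ab eab0 // eq_sym.
case: (eqVneq (x, w) (z, b)) => [[ex ew]|neq2]; last by rewrite sink_0.
by subst x w; rewrite sink_zb ezb0 // eq_sym.
Qed.
End SinkFunctor.

Section SinkCollide.
Variables (k : fieldType) (C : fincat) (EIC : EI C) (skel : skeletal C).
Hypothesis collide : families_collide k C.

Lemma sink_collide n (a b z : ob C) (ea : k -> hom C a a -> 'M[k]_n) (eb : hom C b b -> 'M[k]_n)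
    (eab : k -> hom C a b -> 'M[k]_n) (ezb : k -> hom C z b -> 'M[k]_n) :
    a != b -> z != b -> a != z ->
    (forall l f g, ea l (compc f g) = ea l g *m ea l f) -> (forall l, ea l (idc C a) = 1%:M) ->
    (forall f g, eb (compc f g) = eb g *m eb f) -> eb (idc C b) = 1%:M ->
    (forall l f g, eab l (compc f g) = ea l g *m eab l f) ->
    (forall l f g, eab l (compc f g) = eab l g *m eb f) ->
    (forall l f (g : hom C z z), ezb l (compc f g) = ezb l f) ->
    (forall l f g, ezb l (compc f g) = ezb l g *m eb f) ->
    (forall l c (f : hom C c b) (g : hom C a c), c != a -> c != b -> eab l (compc f g) = 0) ->
    (forall l c (f : hom C c b) (g : hom C z c), c != z -> c != b -> ezb l (compc f g) = 0) ->
  exists l m, l != m /\ exists (pa pb pz : 'M[k]_n), [/\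
    [/\ pa \in unitmx, pb \in unitmx & pz \in unitmx],
    forall f, ea l f *m pa = pa *m ea m f, forall f, eb f *m pb = pb *m eb f,
    forall f, eab l f *m pb = pa *m eab m f & forall f, ezb l f *m pb = pz *m ezb m f].
Proof.
move=> nab nzb naz eaM ea1 ebM eb1 eabr eabl ezbr ezbl eab0 ezb0.
have [l [m [neq [phi [uphi fphi]]]]] := collide (fun l => sink_functorP EIC skel nab nzb naz
  (eaM l) (ea1 l) ebM eb1 (eabr l) (eabl l) (ezbr l) (ezbl l) (eab0 l) (ezb0 l)).
exists l, m; split=> //; exists (phi a), (phi b), (phi z); split=> // f.
- by have := fphi _ _ f; rewrite !sink_aa.
- by have := fphi _ _ f; rewrite !sink_bb.
- by have := fphi _ _ f; rewrite !sink_ab.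
by have := fphi _ _ f; rewrite !sink_zb.
Qed.

Lemma pair_collide n (a b z : ob C) (ea : k -> hom C a a -> 'M[k]_n) (eb : hom C b b -> 'M[k]_n)
    (eab : k -> hom C a b -> 'M[k]_n) :
    a != b -> z != b -> a != z ->
    (forall l f g, ea l (compc f g) = ea l g *m ea l f) -> (forall l, ea l (idc C a) = 1%:M) ->
    (forall f g, eb (compc f g) = eb g *m eb f) -> eb (idc C b) = 1%:M ->
    (forall l f g, eab l (compc f g) = ea l g *m eab l f) ->
    (forall l f g, eab l (compc f g) = eab l g *m eb f) ->
    (forall l c (f : hom C c b) (g : hom C a c), c != a -> c != b -> eab l (compc f g) = 0) ->
  exists l m, l != m /\ exists (pa pb : 'M[k]_n), [/\
    pa \in unitmx /\ pb \in unitmx,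
    forall f, ea l f *m pa = pa *m ea m f, forall f, eb f *m pb = pb *m eb f &
    forall f, eab l f *m pb = pa *m eab m f].
Proof.
move=> nab nzb naz eaM ea1 ebM eb1 eabr eabl eab0.
have [l [m [neq [pa [pb [pz [[upa upb _] fa fb fab _]]]]]]] :=
  sink_collide (ezb := fun _ _ => 0) nab nzb naz eaM ea1 ebM eb1 eabr eabl
    (fun _ _ _ => erefl) (fun _ f g => esym (mul0mx _ (eb f))) eab0 (fun _ _ _ _ _ _ => erefl).
by exists l, m; split=> //; exists pa, pb.
Qed.
End SinkCollide.

(** * Automorphism groups are cyclic *)

Section PGroupLog.
Local Open Scope group_scope.

(** A maximal subgroup of a p-group is normal of index p; chi is the logarithm to the
    base x in the quotient. *)
Lemma maximal_log (gT : finGroupType) (p : nat) (G M : {group gT}) x :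
    prime p -> p.-group G -> maximal M G -> x \in G -> x \notin M ->
  exists chi : gT -> nat, [/\ {in G &, forall g h, chi (g * h)%g = chi g + chi h %[mod p]},
    {in M, forall m, chi m = 0 %[mod p]} & chi x = 1 %[mod p]]%N.
Proof.
move=> pr_p pG maxM Gx Mx.
have nsMG := p_maximal_normal pG maxM; have [sMG nMG] := andP nsMG.
have cardGM : #|G / M| = p by rewrite card_quotient // (p_maximal_index pG maxM).
pose cx := coset M x.
have ncx : cx != 1.
  apply: contra Mx => /eqP/coset_idr; apply.
  exact: (subsetP nMG).
have GMcx : cx \in G / M by apply: mem_quotient.
have ord_cx : #[cx] = p.
  have : (#[cx] %| p)%N by rewrite -cardGM order_dvdG.
  by move/primeP: (pr_p) => [_ H] /H /orP[]/eqP => [/eqP|//]; rewrite order_eq1 (negPf ncx).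
have GM_cyc : G / M = <[cx]>.
  by apply/eqP; rewrite eq_sym eqEcard cycle_subG GMcx cardGM -ord_cx /=.
pose chi g := if [pick i : 'I_p | coset M g == cx ^+ i] is Some i then i : nat else 0%N.
have chiP g : g \in G -> coset M g = cx ^+ chi g.
  move=> Gg; rewrite /chi; case: pickP => [i /eqP//|none].
  have : coset M g \in <[cx]> by rewrite -GM_cyc mem_quotient.
  move=> /cyclePmin[i]; rewrite ord_cx => lt_i e.
  by have := none (Ordinal lt_i); rewrite /= e eqxx.
have modP i j : cx ^+ i = cx ^+ j -> (i = j %[mod p])%N.
  by move/eqP; rewrite eq_expg_mod_order ord_cx => /eqP.
exists chi; split=> [g h Gg Gh|m Mm|]; apply: modP.
- rewrite -chiP ?groupM // morphM ?(subsetP nMG) //.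
  by rewrite expgD -!chiP.
- by rewrite -chiP ?(subsetP sMG) // coset_id.
by rewrite -chiP.
Qed.

(** A noncyclic p-group has two maximal subgroups, neither containing the other. *)
Lemma noncyclic_logs (gT : finGroupType) (p : nat) (G : {group gT}) :
    prime p -> p.-group G -> ~~ cyclic G ->
  exists x y, [/\ x \in G, y \in G & exists chi1 chi2 : gT -> nat,
   [/\ {in G &, forall g h, chi1 (g * h)%g = chi1 g + chi1 h %[mod p]},
       {in G &, forall g h, chi2 (g * h)%g = chi2 g + chi2 h %[mod p]},
       chi1 x = 1 %[mod p] /\ chi1 y = 0 %[mod p] &
       chi2 x = 0 %[mod p] /\ chi2 y = 1 %[mod p]]]%N.
Proof.
move=> pr_p pG ncG.
have [eG|[M1 maxM1 _]] := maximal_exists (sub1G G).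
  by case/negP: ncG; rewrite -eG cyclic1.
have [sM1G [x Gx M1x]] := properP (maxgroupp maxM1).
have sxG : <[x]> \subset G by rewrite cycle_subG.
have [exG|[M2 maxM2 sxM2]] := maximal_exists sxG.
  by case/negP: ncG; rewrite -exG cycle_cyclic.
have M2x : x \in M2 by rewrite -cycle_subG.
have [sM2G _] := properP (maxgroupp maxM2).
have /subsetPn[y M1y M2y] : ~~ (M1 \subset M2).
  apply: contra M1x => sM12; suff -> : M1 :=: M2 by [].
  apply/eqP; rewrite eqEcard sM12 /= -(leq_pmul2r (indexg_gt0 G M1)) Lagrange //.
  by rewrite (p_maximal_index pG maxM1) -(p_maximal_index pG maxM2) Lagrange.
have Gy : y \in G by apply: (subsetP sM1G).
have [chi1 [add1 ker1 val1]] := maximal_log pr_p pG maxM1 Gx M1x.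
have [chi2 [add2 ker2 val2]] := maximal_log pr_p pG maxM2 Gy M2y.
exists x, y; split=> //; exists chi1, chi2; split=> //; split=> //.
  exact: ker1.
exact: ker2.
Qed.
End PGroupLog.

Lemma natr_mod_eq (k : fieldType) p i j : p \in [pchar k] -> i = j %[mod p] ->
  i%:R = j%:R :> k.
Proof.
by move=> char_p e; rewrite -(GRing.natr_mod_pchar char_p i) e (GRing.natr_mod_pchar char_p).
Qed.

Section CyclicGroups.
Variables (k : fieldType) (p : nat) (C : fincat).
Hypotheses (char_p : p \in [pchar k]) (EIC : EI C) (skel : skeletal C).
Hypothesis collide : families_collide k C.
Hypothesis third : forall a b : ob C, exists z, z != a /\ z != b.

(** A noncyclic p-group maps onto an elementary abelian group of order p^2; its modules
    of dimension two on which the two generators act by 1 + E and 1 + l E, with E the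
    elementary nilpotent matrix, are pairwise non-isomorphic. *)
Lemma collide_cyclic a : (p.-group [set: autc C a])%g -> cyclic [set: autc C a].
Proof.
move=> pG; apply: contraT => ncG; have pr_p := pcharf_prime char_p.
have [x [y [_ _ [chi1 [chi2 [add1 add2 [x1 y1] [x2 y2]]]]]]] := noncyclic_logs pr_p pG ncG.
have [b [nba _]] := third a a; have [z [nza nzb]] := third a b.
pose E := delta_mx 0 1 : 'M[k]_2.
have EE : E *m E = 0 by rewrite mul_delta_mx_cond.
pose c l (f : hom C a a) : k := (chi1 (MkAut (EIC f)))%:R + l * (chi2 (MkAut (EIC f)))%:R.
have cM l f g : c l (compc f g) = c l f + c l g.
  have e : MkAut (EIC (compc f g)) = (MkAut (EIC f) * MkAut (EIC g))%g by apply: val_inj.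
  rewrite /c e (natr_mod_eq char_p (add1 _ _ _ _)) ?inE //.
  rewrite (natr_mod_eq char_p (add2 _ _ _ _)) ?inE // !natrD mulrDr.
  by rewrite addrACA.
have c1 l : c l (idc C a) = 0.
  have := cM l (idc C a) (idc C a); rewrite compId -{1}[c l _]addr0.
  by move/addrI.
pose ea l f := 1%:M + c l f *: E.
have eaM l f g : ea l (compc f g) = ea l g *m ea l f.
  rewrite /ea cM mulmxDl !mulmxDr !mul1mx mulmx1 -scalemxAl -scalemxAr EE !scaler0 addr0.
  by rewrite scalerDl -addrA.
have ea1 l : ea l (idc C a) = 1%:M by rewrite /ea c1 scale0r addr0.
have nab : a != b by rewrite eq_sym.
have naz : a != z by rewrite eq_sym.
have [l [m [neq [pa [pb [[upa _] fa _ _]]]]]] := @pair_collide k C EIC skel collide 2 a b z ea (fun _ => 1%:M) (fun _ _ => 0)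
  nab nzb naz eaM ea1 (fun _ _ => esym (mulmx1 _)) erefl (fun l f g => esym (mulmx0 _ (ea l g)))
  (fun _ _ _ => esym (mul0mx _ _)) (fun _ _ _ _ _ _ => erefl).
have cE (g : autc C a) l' : c l' (aut_val g) = (chi1 g)%:R + l' * (chi2 g)%:R.
  by rewrite /c (_ : MkAut _ = g) //; apply: val_inj.
have cx l' : c l' (aut_val x) = 1.
  by rewrite cE (natr_mod_eq char_p x1) (natr_mod_eq char_p x2) mulr0 addr0.
have cy l' : c l' (aut_val y) = l'.
  by rewrite cE (natr_mod_eq char_p y1) (natr_mod_eq char_p y2) mulr1 add0r.
have eE g : c l (aut_val g) *: (E *m pa) = c m (aut_val g) *: (pa *m E).
  have := fa (aut_val g); rewrite /ea mulmxDl mulmxDr mul1mx mulmx1 => /addrI.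
  by rewrite -scalemxAl -scalemxAr.
have Ex := eE x; rewrite !cx !scale1r in Ex.
have := eE y; rewrite !cy -Ex => /eqP; rewrite -subr_eq0 -scalerBl scaler_eq0 subr_eq0.
rewrite (negPf neq) /= => /eqP Epa; have : E = 0.
  by rewrite -[E](mulmxK upa) Epa mul0mx.
by move/matrixP/(_ 0 1)/eqP; rewrite !mxE !eqxx oner_eq0.
Qed.
End CyclicGroups.

(** * Unipotent actions on two Jordan blocks *)

Section Sparse.
Variables (k : comNzRingType) (n : nat).
Implicit Types (s : seq (nat * nat * k)) (phi : 'M[k]_n.+1).

(** Positions are natural numbers, so that tests on concrete positions compute. *)
Definition ent phi i j : k := phi (inord i) (inord j).

Definition sparse s : 'M[k]_n.+1 :=
  \matrix_(i, j) \sum_(t <- s) (if (i == t.1.1 :> nat) && (j == t.1.2 :> nat) then t.2 else 0).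

Definition in_range s := all (fun t => (t.1.1 <= n) && (t.1.2 <= n))%N s.

Lemma ent_sparse s i j : (i <= n)%N -> (j <= n)%N ->
  ent (sparse s) i j = \sum_(t <- s) (if (i == t.1.1) && (j == t.1.2) then t.2 else 0).
Proof. by move=> le_i le_j; rewrite /ent mxE !inordK. Qed.

Lemma ent_sparsel s phi i j : (i <= n)%N -> in_range s ->
  ent (sparse s *m phi) i j = \sum_(t <- s) (if i == t.1.1 then t.2 * ent phi t.1.2 j else 0).
Proof.
move=> le_i /allP s_ok; rewrite /ent mxE.
under eq_bigr do rewrite mxE mulr_suml.
rewrite exchange_big /=; apply: eq_big_seq => t /s_ok/andP[le1 le2].
rewrite (bigD1 (inord t.1.2)) //= !inordK // eqxx andbT big1 ?addr0.
  by case: ifP => // _; rewrite mul0r.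
move=> l neq; case: eqP => [_|]; rewrite ?mul0r //=; case: eqP => [e|]; rewrite ?mul0r //.
by rewrite -e inord_val eqxx in neq.
Qed.

Lemma ent_sparser s phi i j : (j <= n)%N -> in_range s ->
  ent (phi *m sparse s) i j = \sum_(t <- s) (if j == t.1.2 then ent phi i t.1.1 * t.2 else 0).
Proof.
move=> le_j /allP s_ok; rewrite /ent mxE.
under eq_bigr do rewrite mxE mulr_sumr.
rewrite exchange_big /=; apply: eq_big_seq => t /s_ok/andP[le1 le2].
rewrite (bigD1 (inord t.1.1)) //= !inordK // eqxx /= big1 ?addr0.
  by case: ifP => // _; rewrite mulr0.
move=> l neq; case: eqP => [e|] /=; rewrite ?mulr0 //.
by rewrite -e inord_val eqxx in neq.
Qed.

Lemma ent_inj phi psi : (forall i j, (i <= n)%N -> (j <= n)%N -> ent phi i j = ent psi i j) ->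
  phi = psi.
Proof.
move=> e; apply/matrixP => i j; have := e i j; rewrite /ent !inord_val; apply.
  exact: (ltn_ord i).
exact: (ltn_ord j).
Qed.
End Sparse.

(** In characteristic p, [(1 + N) ^+ p = 1 + N ^+ p]. *)
Lemma unipotent_expr_mod (k : fieldType) p n (N : 'M[k]_n.+1) i j :
  p \in [pchar k] -> N ^+ p = 0 -> i = j %[mod p] -> (1 + N) ^+ i = (1 + N) ^+ j.
Proof.
move=> char_p Np e; have char_M : p \in [pchar 'M[k]_n.+1] by rewrite pchar_lalg.
have Up : (1 + N) ^+ p = 1.
  have := pFrobenius_autD_comm char_M (commr_sym (commr1 N)).
  by rewrite !GRing.pFrobenius_autE expr1n Np addr0.
have red l : (1 + N) ^+ l = (1 + N) ^+ (l %% p).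
  by rewrite {1}(divn_eq l p) exprD mulnC exprM Up expr1n mul1r.
by rewrite red e -red.
Qed.

Ltac entries c i j := have := c i j; rewrite ?(ent_sparsel, ent_sparser, big_cons, big_nil,
  mul1r, mulr1, mul0r, mulr0, add0r, addr0) //=.

Section JordanPair.
Variable k : fieldType.

(** Jordan blocks of sizes 4 and 2, with chains a, Na, N^2 a, N^3 a (positions 0 to 3) and
    b, Nb (positions 4 and 5). *)
Definition J42 : 'M[k]_6 :=
  sparse 5 [:: (0, 1, 1%R); (1, 2, 1%R); (2, 3, 1%R); (4, 5, 1%R)]%N.

Lemma J42_nil : J42 ^+ 4 = 0.
Proof.
rewrite !exprS expr0; apply: ent_inj => i j le_i le_j.
change (@ent k 5 (J42 *m (J42 *m (J42 *m (J42 *m 1%:M)))) i j = @ent k 5 0 i j); rewrite /J42.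
have -> : @ent k 5 (0 : 'M[k]_6) i j = 0 by rewrite /ent mxE.
move: le_i; do 6 (case: i => [|i]; first by move=> _;
  do 4 rewrite ?(ent_sparsel, big_cons, big_nil, mul1r, add0r, addr0) //=).
by [].
Qed.

(** The first two basis vectors go to Na + b and N^2 a + l Nb.  In the plane spanned by
    N^2 a and Nb, the lines of N^2 a, Nb, N(Na + b) and N^2 a + l Nb have a cross ratio
    determined by l. *)
Definition one_sided_map (l : k) : 'M[k]_6 := sparse 5 [:: (0, 1, 1%R); (0, 4, 1%R); (1, 2, 1%R); (1, 5, l)]%N.

(** The endomorphism a -> b + (l - 1) Na, b -> Nb + l N^2 a of the module of [J42].  With
    suitable gradings it is a commutative ladder with dimensions 0 1 2 2 1 over
    1 2 2 1 0. *)
Definition two_sided_map (l : k) : 'M[k]_6 := sparse 5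
  [:: (0, 4, 1%R); (0, 1, (l - 1)%R); (1, 5, 1%R); (1, 2, (l - 1)%R); (2, 3, (l - 1)%R);
      (4, 5, 1%R); (4, 2, l); (5, 3, l)]%N.

Lemma unit_row n (phi : 'M[k]_n.+1) i : phi \in unitmx ->
  (forall j, (j <= n)%N -> ent phi i j = 0) -> False.
Proof.
move=> uphi e0; have r0 : row (inord i) phi = 0.
  apply/rowP => j; rewrite !mxE; have := e0 j; rewrite /ent inord_val; apply.
  exact: (ltn_ord j).
have : row (inord i) (1%:M : 'M[k]_n.+1) = 0.
  by rewrite -(mulmxV uphi) row_mul r0 mul0mx.
by move/rowP/(_ (inord i))/eqP; rewrite !mxE eqxx oner_eq0.
Qed.

(** The entries of an endomorphism that the two rigidity lemmas compare; the last clause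
    makes the entry (0, 0) nonzero for an automorphism. *)
Lemma J42_rows (phi : 'M[k]_6) : J42 *m phi = phi *m J42 ->
  let e i j := @ent k 5 phi i j in
  [/\ [/\ e 4%N 1%N = 0, e 5%N 2%N = 0, e 1%N 4%N = 0 & e 2%N 5%N = 0],
      [/\ e 1%N 1%N = e 0%N 0%N, e 2%N 2%N = e 0%N 0%N & e 5%N 5%N = e 4%N 4%N]
    & e 0%N 0%N = 0 -> forall j, (j <= 5)%N -> e 3%N j = 0].
Proof.
move=> comm e; have c i j : @ent k 5 (J42 *m phi) i j = @ent k 5 (phi *m J42) i j by rewrite comm.
rewrite /J42 in c.
have e52 : e 5%N 2%N = 0 by entries c 5%N 3%N.
have e41 : e 4%N 1%N = 0 by entries c 4%N 2%N; rewrite -/(e _ _) e52.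
have e14 : e 1%N 4%N = 0 by entries c 0%N 4%N.
have e25 : e 2%N 5%N = 0 by entries c 1%N 5%N; rewrite -/(e _ _) => ->.
have e11 : e 1%N 1%N = e 0%N 0%N by entries c 0%N 1%N.
have e22 : e 2%N 2%N = e 0%N 0%N by entries c 1%N 2%N; rewrite -/(e 1%N 1%N) e11.
have e55 : e 5%N 5%N = e 4%N 4%N by entries c 4%N 5%N.
split=> // e00; have e24 : e 2%N 4%N = 0 by entries c 1%N 4%N.
case=> [|[|[|[|[|[|j]]]]]] //= _.
- by entries c 3%N 1%N.
- by entries c 3%N 2%N.
- by entries c 3%N 3%N.
- by entries c 2%N 3%N; rewrite -/(e 2%N 2%N) e22 e00.
- by entries c 3%N 5%N.
by entries c 2%N 5%N; rewrite -/(e 2%N 4%N) e24.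
Qed.

Lemma one_sided_rigid l m (phi psi : 'M[k]_6) : phi \in unitmx ->
  J42 *m phi = phi *m J42 -> one_sided_map l *m phi = psi *m one_sided_map m -> l = m.
Proof.
move=> uphi /J42_rows/=[[e41 e52 e14 e25] [e11 e22 e55] e3] eA.
have c i j : @ent k 5 (one_sided_map l *m phi) i j = @ent k 5 (psi *m one_sided_map m) i j by rewrite eA.
rewrite /one_sided_map in c.
have f00 : @ent k 5 psi 0%N 0%N = @ent k 5 phi 0%N 0%N by entries c 0%N 1%N; rewrite e11 e41 addr0.
have e44 : @ent k 5 phi 4%N 4%N = @ent k 5 phi 0%N 0%N by entries c 0%N 4%N; rewrite e14 add0r f00.
have f11 : @ent k 5 psi 1%N 1%N = @ent k 5 phi 0%N 0%N.
  by entries c 1%N 2%N; rewrite e22 e52 mulr0 addr0.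
have : (l - m) * @ent k 5 phi 0%N 0%N = 0.
  entries c 1%N 5%N; rewrite e25 e55 e44 f11 add0r mulrBl => ->.
  by rewrite [_ * m]mulrC subrr.
move/eqP; rewrite mulf_eq0 subr_eq0 => /orP[/eqP//|/eqP/e3].
by move/(unit_row uphi).
Qed.

Lemma two_sided_comm l : J42 *m two_sided_map l = two_sided_map l *m J42.
Proof.
apply: (@ent_inj k 5) => i j le_i le_j; rewrite /J42 /two_sided_map.
rewrite [LHS]ent_sparsel // [RHS]ent_sparser // !big_cons !big_nil !ent_sparse //=.
rewrite !big_cons !big_nil /=.
case: i le_i => [|[|[|[|[|[|i]]]]]] //= _; case: j le_j => [|[|[|[|[|[|j]]]]]] //= _;
  by rewrite ?(mul1r, mulr1, mul0r, mulr0, add0r, addr0).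
Qed.

Lemma two_sided_rigid l m (phi psi : 'M[k]_6) : phi \in unitmx ->
  J42 *m phi = phi *m J42 -> J42 *m psi = psi *m J42 ->
  two_sided_map l *m phi = psi *m two_sided_map m -> l = m.
Proof.
move=> uphi /J42_rows/=[[e41 e52 e14 e25] [e11 e22 e55] e3].
move=> /J42_rows/=[[f41 f52 f14 f25] _ _] eA.
have c i j : @ent k 5 (two_sided_map l *m phi) i j = @ent k 5 (psi *m two_sided_map m) i j by rewrite eA.
rewrite /two_sided_map in c.
have f00 : @ent k 5 psi 0%N 0%N = @ent k 5 phi 4%N 4%N.
  by entries c 0%N 4%N; rewrite e14 mulr0 addr0.
have E1 : (l - 1) * @ent k 5 phi 0%N 0%N = @ent k 5 phi 4%N 4%N * (m - 1).
  by entries c 0%N 1%N; rewrite e11 e41 add0r f00.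
have f44 : @ent k 5 psi 4%N 4%N = @ent k 5 phi 4%N 4%N.
  by entries c 4%N 5%N; rewrite e55 e25 mulr0 addr0 f41 add0r.
have E2 : l * @ent k 5 phi 0%N 0%N = @ent k 5 phi 4%N 4%N * m.
  by entries c 4%N 2%N; rewrite e22 e52 add0r f41 f44 mul0r add0r.
have E3 : @ent k 5 phi 0%N 0%N = @ent k 5 phi 4%N 4%N.
  by move: E1; rewrite mulrBl mulrBr E2 mul1r mulr1 => /addrI/oppr_inj.
have : (l - m) * @ent k 5 phi 0%N 0%N = 0 by rewrite mulrBl E2 -E3 mulrC subrr.
move/eqP; rewrite mulf_eq0 subr_eq0 => /orP[/eqP//|/eqP/e3].
by move/(unit_row uphi).
Qed.
End JordanPair.

Section UnipotentPairs.
Variables (k : fieldType) (p : nat) (C : fincat).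
Hypotheses (char_p : p \in [pchar k]) (p_ge5 : (5 <= p)%N) (EIC : EI C) (skel : skeletal C).
Hypothesis collide : families_collide k C.
Variables (a b z : ob C).
Hypotheses (nab : a != b) (nzb : z != b) (naz : a != z).
Hypothesis convex : forall c, hom C c b -> hom C a c -> c != a -> c != b -> False.

Variables (iH : hom C b b -> nat) (pi : hom C a b -> nat).
Hypothesis iHM : forall f g, iH (compc f g) = iH g + iH f %[mod p].
Hypothesis piH : forall h f, pi (compc h f) = pi f + iH h %[mod p].
Hypothesis iH_1 : exists h, iH h = 1 %[mod p].
Hypothesis pi_0 : exists f, pi f = 0 %[mod p].

Let U : 'M[k]_6 := 1 + J42 k.
Let J42_p : J42 k ^+ p = 0.
Proof.
rewrite -(subnKC (leq_trans (isT : (4 <= 5)%N) p_ge5)) exprD J42_nil.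
exact: mul0r.
Qed.
Let U_mod i j : i = j %[mod p] -> U ^+ i = U ^+ j.
Proof. exact: unipotent_expr_mod. Qed.
Let UD i j : U ^+ (i + j) = U ^+ i *m U ^+ j.
Proof. by rewrite exprD. Qed.

Lemma log_id x (j : hom C x x -> nat) :
  (forall f g, j (compc f g) = j g + j f %[mod p]) -> j (idc C x) = 0 %[mod p].
Proof.
move=> jM; have := jM (idc C x) (idc C x); rewrite compId => /eqP.
by rewrite -[X in X == _ %[mod p]]addn0 eqn_modDl eq_sym => /eqP.
Qed.

Let U_comm (M : 'M[k]_6) : U *m M = M *m U -> J42 k *m M = M *m J42 k.
Proof. by rewrite /U [_ *m M]mulmxDl [M *m _]mulmxDr mul1mx mulmx1 => /addrI. Qed.

(** Only the group at b acts: h by [U ^+ iH h], f by [one_sided_map l *m U ^+ pi f]. *)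
Lemma one_sided_false :
  (forall f g, pi (compc f g) = pi f %[mod p]) -> False.
Proof.
move=> piG; have [h h1] := iH_1; have [f0 f00] := pi_0.
have [l [m [neq [pa [pb [[_ upb] _ fb fab]]]]]] := @pair_collide k C EIC skel collide 6 a b z
  (fun _ _ => 1%:M) (fun h => U ^+ iH h) (fun l f => one_sided_map l *m U ^+ pi f) nab nzb naz
  (fun _ _ _ => esym (mulmx1 _)) (fun=> erefl)
  (fun f g => etrans (U_mod (iHM f g)) (UD _ _)) (U_mod (log_id iHM))
  (fun l f g => etrans (congr1 (mulmx (one_sided_map l)) (U_mod (piG f g))) (esym (mul1mx _)))
  (fun l f g => etrans (congr1 (mulmx (one_sided_map l)) (etrans (U_mod (piH f g)) (UD _ _)))
     (mulmxA _ _ _)) (fun _ _ f g nca ncb => False_ind _ (convex f g nca ncb)).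
case/negP: neq; apply/eqP; apply: (one_sided_rigid upb (psi := pa)).
  by have := fb h; rewrite (U_mod h1) expr1 => /U_comm.
by have := fab f0; rewrite (U_mod f00) expr0 !mulmx1.
Qed.

(** Both groups act by powers of U, which commute with [two_sided_map l]. *)
Lemma two_sided_false (iG : hom C a a -> nat) :
    (forall f g, iG (compc f g) = iG g + iG f %[mod p]) ->
    (forall f g, pi (compc f g) = iG g + pi f %[mod p]) ->
    (exists g, iG g = 1 %[mod p]) -> False.
Proof.
move=> iGM piG [g g1]; have [h h1] := iH_1; have [f0 f00] := pi_0.
have AU l i : two_sided_map l *m U ^+ i = U ^+ i *m two_sided_map l.
  elim: i => [|i IH]; first by rewrite expr0 mulmx1 mul1mx.
  rewrite exprSr -mulmxE mulmxA IH -!mulmxA; congr (_ *m _).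
  by rewrite /U [LHS]mulmxDr [RHS]mulmxDl mulmx1 mul1mx two_sided_comm.
have eabr l f g' : two_sided_map l *m U ^+ pi (compc f g') = U ^+ iG g' *m (two_sided_map l *m U ^+ pi f).
  by rewrite (U_mod (piG f g')) UD mulmxA AU -mulmxA.
have [l [m [neq [pa [pb [[_ upb] fa fb fab]]]]]] := @pair_collide k C EIC skel collide 6 a b z
  (fun _ g => U ^+ iG g) (fun h => U ^+ iH h) (fun l f => two_sided_map l *m U ^+ pi f) nab nzb naz
  (fun _ f g => etrans (U_mod (iGM f g)) (UD _ _)) (fun=> U_mod (log_id iGM))
  (fun f g => etrans (U_mod (iHM f g)) (UD _ _)) (U_mod (log_id iHM)) eabr
  (fun l f g => etrans (congr1 (mulmx (two_sided_map l)) (etrans (U_mod (piH f g)) (UD _ _)))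
     (mulmxA _ _ _)) (fun _ _ f g nca ncb => False_ind _ (convex f g nca ncb)).
case/negP: neq; apply/eqP; apply: (two_sided_rigid upb (psi := pa)).
- by have := fb h; rewrite (U_mod h1) expr1 => /U_comm.
- by have := fa g; rewrite (U_mod g1) expr1 => /U_comm.
by have := fab f0; rewrite (U_mod f00) expr0 !mulmx1.
Qed.
End UnipotentPairs.

(** * Hom sets have at most one element *)

Lemma log_sum A B i j i' j' q r :
  (A * (i' * q + i) + B * (j + j' * r) + (A * i' + B * j') =
   A * (i' * q.+1) + B * (j' * r.+1) + (A * i + B * j))%N.
Proof. by lia. Qed.

Section LogData.
Variables (p : nat) (C : fincat) (EIC : EI C).
Hypothesis cyc : forall x, cyclic [set: autc C x].

Definition gen_pow x i : hom C x x := aut_val (aut_gen cyc x ^+ i)%g.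

Lemma gen_pow0 x : gen_pow x 0 = idc C x.
Proof. by rewrite /gen_pow expg0. Qed.

Lemma gen_powD x i j : gen_pow x (i + j) = compc (gen_pow x i) (gen_pow x j).
Proof. by rewrite /gen_pow expgD. Qed.

Lemma gen_powP x (f : hom C x x) : exists i, f = gen_pow x i.
Proof.
have : MkAut (EIC f) \in <[aut_gen cyc x]>%g by rewrite -aut_genP inE.
by move=> /cycleP[i e]; exists i; rewrite /gen_pow -e.
Qed.

Lemma gen_pow_card x i : gen_pow x (i * #|[set: autc C x]|) = idc C x.
Proof. by rewrite /gen_pow mulnC expgM expg_cardG ?inE // expg1n. Qed.

Lemma gen_powM x i u v q : (i * u = 1 + v * q)%N -> q = #|[set: autc C x]| ->
  gen_pow x (i * u) = gen_pow x 1.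
Proof. by move=> -> ->; rewrite gen_powD gen_pow_card compfId. Qed.

Variables (a b : ob C) (x0 : hom C a b).
Definition orb i j : hom C a b := compc (compc (gen_pow b i) x0) (gen_pow a j).

Lemma orbD i j i' j' : orb (i + i') (j' + j) = compc (compc (gen_pow b i) (orb i' j')) (gen_pow a j).
Proof. by rewrite /orb !gen_powD !compA. Qed.

Lemma orb_card i j : orb (i * #|[set: autc C b]|) (j * #|[set: autc C a]|) = x0.
Proof. by rewrite /orb !gen_pow_card compId compfId. Qed.

Variables A B : nat.
Hypothesis stab : forall i j, orb i j = x0 -> (p %| A * i + B * j)%N.

(** Multiplying by the powers (i' (q - 1), j' (r - 1)) of the generators, with q and r
    their orders, turns (i', j') into a stabilising pair; so the difference of (i, j) and
    (i', j') stabilises x0 up to such a pair. *)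
Lemma orb_log i j i' j' : orb i j = orb i' j' ->
  (A * i + B * j)%N = (A * i' + B * j')%N %[mod p].
Proof.
move=> e; set qb := #|[set: autc C b]|; set qa := #|[set: autc C a]|.
have qb0 : (0 < qb)%N by rewrite cardG_gt0.
have qa0 : (0 < qa)%N by rewrite cardG_gt0.
have s2 := stab (orb_card i' j').
have s1 : (p %| A * (i' * qb.-1 + i) + B * (j + j' * qa.-1))%N.
  apply: stab; rewrite orbD e -orbD -[RHS](orb_card i' j') -/qb -/qa.
  by rewrite [(_ + i')%N]addnC -!mulnS !prednK.
have := log_sum A B i j i' j' qb.-1 qa.-1; rewrite !prednK //.
move=> /(congr1 (modn^~ p)); rewrite -modnDml (eqP s1) -[RHS]modnDml (eqP s2) !add0n.
by [].
Qed.

Hypothesis trans : forall f, exists i j, f = orb i j.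

(** The weights (A, B) vanish modulo p on the stabiliser of x0, so A i + B j is well
    defined modulo p on the orbit of x0, and likewise on both groups. *)
Lemma log_data : exists (iH : hom C b b -> nat) (iG : hom C a a -> nat) (pi : hom C a b -> nat),
  [/\ (forall f g, iH (compc f g) = iH g + iH f %[mod p]) /\
      (forall f g, iG (compc f g) = iG g + iG f %[mod p]),
      forall h f, pi (compc h f) = pi f + iH h %[mod p],
      forall f g, pi (compc f g) = iG g + pi f %[mod p],
      pi x0 = 0 %[mod p] &
      forall i, iH (gen_pow b i) = A * i %[mod p] /\ iG (gen_pow a i) = B * i %[mod p]]%N.
Proof.
have exH x (f : hom C x x) : exists i, f == gen_pow x i by have [i ->] := gen_powP f; exists i.
have expi (f : hom C a b) : exists ij : nat * nat, f == orb ij.1 ij.2.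
  by have [i [j ->]] := trans f; exists (i, j).
pose l x f := xchoose (exH x f); have lP x f : f = gen_pow x (l x f) := eqP (xchooseP (exH x f)).
pose m f := xchoose (expi f); have mP f : f = orb (m f).1 (m f).2 := eqP (xchooseP (expi f)).
have logH i i' : gen_pow b i = gen_pow b i' -> (A * i = A * i' %[mod p])%N.
  by move=> e; have := @orb_log i 0 i' 0; rewrite /orb e !muln0 !addn0; apply.
have logG i i' : gen_pow a i = gen_pow a i' -> (B * i = B * i' %[mod p])%N.
  by move=> e; have := @orb_log 0 i 0 i'; rewrite /orb e !muln0 !add0n; apply.
exists (fun h => A * l b h)%N, (fun g => B * l a g)%N, (fun f => A * (m f).1 + B * (m f).2)%N.
split=> [ | h f | f g | | i].
- split=> f g; rewrite -mulnDr; [apply: logH | apply: logG];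
    by rewrite -lP addnC gen_powD -!lP.
- have -> : (A * (m f).1 + B * (m f).2 + A * l b h = A * (l b h + (m f).1) + B * (m f).2)%N.
    by rewrite mulnDr addnC addnA.
  by apply: orb_log; rewrite -mP -[(m f).2]addn0 orbD -mP -lP gen_pow0 compfId.
- have -> : (B * l a g + (A * (m f).1 + B * (m f).2) = A * (m f).1 + B * ((m f).2 + l a g))%N.
    by rewrite mulnDr addnC addnA.
  by apply: orb_log; rewrite -mP -[(m f).1]add0n orbD -mP -lP gen_pow0 compId.
- by apply/eqP; rewrite mod0n; apply: stab; rewrite -mP.
by split; [apply: logH | apply: logG]; rewrite -lP.
Qed.
End LogData.

Section ConvexHoms.
Variables (k : fieldType) (p : nat) (C : fincat).
Hypotheses (char_p : p \in [pchar k]) (p_ge5 : (5 <= p)%N) (EIC : EI C) (skel : skeletal C).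
Hypothesis collide : families_collide k C.
Hypothesis third : forall a b : ob C, exists z, z != a /\ z != b.
Hypothesis pgr : forall x : ob C, (p.-group [set: autc C x])%g.

Definition convex (a b : ob C) := forall c, hom C c b -> hom C a c -> c != a -> c != b -> False.

Lemma endo_inv x (g : hom C x x) : exists g', compc g g' = idc C x /\ compc g' g = idc C x.
Proof. by have /existsP[g' /andP[/eqP e1 /eqP e2]] := EIC g; exists g'. Qed.

(** Two orbits in a hom set give representations of the Kronecker quiver. *)
Lemma hom_transitive a b (f1 f2 : hom C a b) : a != b -> convex a b ->
  exists h g, f2 = compc (compc h f1) g.
Proof.
move=> nab conv; apply: NNPP => no.
have [z [nza nzb]] := third a b; have naz : a != z by rewrite eq_sym.
pose inorb (f : hom C a b) := [exists h : hom C b b, [exists g : hom C a a, f == compc (compc h f1) g]].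
have inorbP f : reflect (exists h g, f = compc (compc h f1) g) (inorb f).
  apply: (iffP existsP) => [[h /existsP[g /eqP->]]|[h [g ->]]]; first by exists h, g.
  by exists h; apply/existsP; exists g.
have orbr f g : inorb (compc f g) = inorb f.
  apply/inorbP/inorbP => [[h [g1 e]]|[h [g1 ->]]]; last by exists h, (compc g1 g); rewrite !compA.
  have [g' [gg' _]] := endo_inv g; exists h, (compc g1 g').
  by rewrite compA -e -compA gg' compfId.
have orbl h f : inorb (compc h f) = inorb f.
  apply/inorbP/inorbP => [[h1 [g e]]|[h1 [g ->]]]; last by exists (compc h h1), g; rewrite !compA.
  have [h' [_ hh']] := endo_inv h; exists (compc h' h1), g.
  by rewrite -!compA (compA h1) -e compA hh' compId.
pose eab l f : 'M[k]_1 := if inorb f then 1%:M else l%:M.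
have [l [m [neq [pa [pb [[upa _] _ _ fab]]]]]] := @pair_collide k C EIC skel collide 1 a b z
  (fun _ _ => 1%:M) (fun _ => 1%:M) eab nab nzb naz
  (fun _ _ _ => esym (mulmx1 _)) (fun=> erefl) (fun _ _ => esym (mulmx1 _)) erefl
  (fun l f g => etrans (congr1 (fun c : bool => if c then 1%:M else l%:M) (orbr f g)) (esym (mul1mx _)))
  (fun l f g => etrans (congr1 (fun c : bool => if c then 1%:M else l%:M) (orbl f g)) (esym (mulmx1 _)))
  (fun _ _ f g nca ncb => False_ind _ (conv _ f g nca ncb)).
have e1 : pb = pa.
  have := fab f1; rewrite /eab; have -> : inorb f1.
    by apply/inorbP; exists (idc C b), (idc C a); rewrite compId compfId.
  by rewrite mul1mx mulmx1.
have n2 : inorb f2 = false by apply: negbTE; apply/negP => /inorbP[h [g e]]; apply: no; exists h, g.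
have := fab f2; rewrite /eab n2.
rewrite e1 mul_scalar_mx mul_mx_scalar => /eqP; rewrite -subr_eq0 -scalerBl scaler_eq0 subr_eq0.
rewrite (negPf neq) /= => /eqP pa0.
by move: upa; rewrite pa0 unitmxE det0 unitr0.
Qed.

Lemma coprime_inv q i : (0 < i)%N -> coprime i q -> exists u v, (i * u = 1 + v * q)%N.
Proof.
move=> i0 /(coprimeP _ i0)[[u v] /= e]; exists u, v; rewrite mulnC.
have lt : (v * q < u * i)%N by rewrite -subn_gt0 e.
by rewrite -e subnK // ltnW.
Qed.
End ConvexHoms.

Lemma isoc_op C x y (f : hom C y x) : @isoc (opcat C) x y f = @isoc C y x f.
Proof.
by apply/existsP/existsP => -[g /andP[e1 e2]]; exists g; apply/andP; split.
Qed.

Lemma EI_op C : EI C -> EI (opcat C).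
Proof. by move=> EIC x f; rewrite isoc_op; apply: EIC. Qed.

Lemma skeletal_op C : skeletal C -> skeletal (opcat C).
Proof. by move=> skel x y f; rewrite isoc_op => /skel. Qed.

Section ConvexHoms2.
Variables (k : fieldType) (p : nat) (C : fincat).
Hypotheses (char_p : p \in [pchar k]) (p_ge5 : (5 <= p)%N) (EIC : EI C) (skel : skeletal C).
Hypothesis collide : families_collide k C.
Hypothesis third : forall a b : ob C, exists z, z != a /\ z != b.
Hypothesis pgr : forall x : ob C, (p.-group [set: autc C x])%g.

Let cyc x : cyclic [set: autc C x] := collide_cyclic char_p EIC skel collide third (pgr x).

Lemma gen_pow_coprime x i : ~~ (p %| i)%N -> exists u, gen_pow cyc x (i * u) = gen_pow cyc x 1.
Proof.
move=> npi; have pr_p := pcharf_prime char_p.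
have i0 : (0 < i)%N by case: i npi => //; rewrite dvdn0.
have cop : coprime i #|[set: autc C x]|.
  have [e ->] := p_natP (pgr x).
  by rewrite coprime_sym coprimeXl // prime_coprime.
have [u [v e]] := coprime_inv i0 cop; exists u.
exact: gen_powM e erefl.
Qed.

(** Suppose there are two elements; by transitivity they are in one orbit under the cyclic
    groups of b and a.  If the generator at b acts on x0 as the m-th power of the one at
    a, the weights (m, 1) vanish modulo p on the stabiliser of x0, otherwise (1, 0)
    do.  Modulo p, either one group acts (m divisible by p, or the second case) or
    both do, and a family with a parameter contradicts the hypothesis. *)
Theorem convex_hom_eq a b : a != b -> convex a b -> forall f1 f2 : hom C a b, f1 = f2.
Proof.
move=> nab conv x0 x1; apply: NNPP => neq; have pr_p := pcharf_prime char_p.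
have [z [nza nzb]] := third a b; have naz : a != z by rewrite eq_sym.
have trans f : exists i j, f = orb cyc x0 i j.
  have [h [g ->]] := hom_transitive EIC skel collide third x0 f nab conv.
  have [i ->] := gen_powP EIC cyc h; have [j ->] := gen_powP EIC cyc g.
  by exists i, j.
have conv' : forall c, hom C c b -> hom C a c -> c != a -> c != b -> False by [].
have pi0 (pi : hom C a b -> nat) : pi x0 = 0 %[mod p] -> exists f, pi f = 0 %[mod p] by exists x0.
case: (classic (exists m, compc (gen_pow cyc b 1) x0 = compc x0 (gen_pow cyc a m))) => [[m em]|no_m].
  have emi i : compc (gen_pow cyc b i) x0 = compc x0 (gen_pow cyc a (m * i)).
    elim: i => [|i IH]; first by rewrite muln0 !gen_pow0 compId compfId.
    by rewrite -addn1 gen_powD -compA em compA IH -compA -gen_powD mulnDr muln1.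
  have orbE i j : orb cyc x0 i j = compc x0 (gen_pow cyc a (m * i + j)).
    by rewrite /orb emi -compA -gen_powD.
  have stab i j : orb cyc x0 i j = x0 -> (p %| m * i + 1 * j)%N.
    rewrite mul1n orbE; set t := (m * i + j)%N => et; apply: contraT => npt.
    have tu u : compc x0 (gen_pow cyc a (t * u)) = x0.
      elim: u => [|u IH]; first by rewrite muln0 gen_pow0 compfId.
      by rewrite mulnS addnC gen_powD compA IH et.
    have [u eu] := gen_pow_coprime a npt.
    have fix1 n : compc x0 (gen_pow cyc a n) = x0.
      elim: n => [|n IH]; first by rewrite gen_pow0 compfId.
      by rewrite -addn1 gen_powD compA IH -eu tu.
    by case: neq; have [i' [j' ->]] := trans x1; rewrite orbE fix1.
  have [iH [iG [pi [[iHM iGM] piH piG pix0 vals]]]] := log_data EIC stab trans.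
  have iG1 : exists g, iG g = 1 %[mod p].
    by exists (gen_pow cyc a 1); have [_ ->] := vals 1%N; rewrite muln1.
  have [pm|npm] := boolP (p %| m)%N.
    (* Only the group of a acts, so the family lives on the opposite category. *)
    apply: (@one_sided_false k p (opcat C) char_p p_ge5 (EI_op EIC) (skeletal_op skel)
      (families_collide_op collide) b a z _ nza _ _ iG pi) => //.
    - by rewrite eq_sym.
    - by rewrite eq_sym.
    - by move=> c f g ncb nca; apply: (conv c g f).
    - by move=> f g; rewrite iGM addnC.
    - by move=> g f; rewrite [LHS]piG addnC.
    - exact: pi0 pix0.
    move=> f h; rewrite [LHS](piH h f); have [i ->] := gen_powP EIC cyc h.
    by rewrite -modnDmr; have [-> _] := vals i; rewrite (eqP (dvdn_mulr i pm)) addn0.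
  apply: (@two_sided_false k p C char_p p_ge5 EIC skel collide a b z nab nzb naz conv'
    iH pi iHM piH _ (pi0 _ pix0) iG iGM piG iG1).
  have m0 : (0 < m)%N by case: (m) npm => //; rewrite dvdn0.
  have cop : coprime m p by rewrite coprime_sym prime_coprime.
  have [u [v e]] := coprime_inv m0 cop; exists (gen_pow cyc b u).
  by have [-> _] := vals u; rewrite e addnC modnMDl.
have stab i j : orb cyc x0 i j = x0 -> (p %| 1 * i + 0 * j)%N.
  rewrite mul1n addn0 => e; apply: contraT => npi.
  set q := #|[set: autc C a]|; have q0 : (0 < q)%N by rewrite cardG_gt0.
  pose j' := (j * q.-1)%N.
  have ei : compc (gen_pow cyc b i) x0 = compc x0 (gen_pow cyc a j').
    rewrite -{2}e /orb -compA -gen_powD /j'.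
    have -> : (j + j * q.-1 = j * q)%N by rewrite -mulnS prednK.
    by rewrite gen_pow_card compfId.
  have eiu u : compc (gen_pow cyc b (i * u)) x0 = compc x0 (gen_pow cyc a (j' * u)).
    elim: u => [|u IH]; first by rewrite !muln0 !gen_pow0 compId compfId.
    by rewrite !mulnS gen_powD -compA IH compA ei -compA -gen_powD.
  have [u eu] := gen_pow_coprime b npi.
  by case: no_m; exists (j' * u)%N; rewrite -eu eiu.
have [iH [iG [pi [[iHM iGM] piH piG pix0 vals]]]] := log_data EIC stab trans.
apply: (@one_sided_false k p C char_p p_ge5 EIC skel collide a b z nab nzb naz conv'
    iH pi iHM piH _ (pi0 _ pix0)).
  by exists (gen_pow cyc b 1); have [-> _] := vals 1%N; rewrite muln1.
move=> f g; rewrite piG; have [i ->] := gen_powP EIC cyc g.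
by rewrite -modnDml; have [_ ->] := vals i; rewrite mod0n.
Qed.
End ConvexHoms2.

Section KroneckerChain.
Variables (k : fieldType) (C : fincat) (EIC : EI C) (skel : skeletal C).
Hypothesis collide : families_collide k C.
Variables (a b c : ob C).
Hypotheses (nab : a != b) (nac : a != c) (ncb : c != b).
Hypothesis all3 : forall w, [\/ w = a, w = b | w = c].
Variables (al : hom C a c) (be : hom C c b).
Hypothesis al_all : forall f : hom C a c, f = al.
Hypothesis be_all : forall f : hom C c b, f = be.
Let ga := compc be al.

Let no_ba : hom C b a -> False.
Proof. by move=> f; have /eqP := no_back EIC skel ga f; rewrite (negPf nab). Qed.
Let no_ca : hom C c a -> False.
Proof. by move=> f; have /eqP := no_back EIC skel al f; rewrite (negPf nac). Qed.
Let no_bc : hom C b c -> False.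
Proof. by move=> f; have /eqP := no_back EIC skel be f; rewrite (negPf ncb). Qed.

Let gar f (g : hom C a a) : (compc f g == ga) = (f == ga).
Proof.
have gag (g' : hom C a a) : compc ga g' = ga by rewrite -compA [compc al g']al_all.
apply/eqP/eqP => [e|->//]; have [g' [gg' _]] := endo_inv EIC g.
by rewrite -[f]compfId -gg' compA e gag.
Qed.

Let gal (h : hom C b b) f : (compc h f == ga) = (f == ga).
Proof.
have gah (h' : hom C b b) : compc h' ga = ga by rewrite compA [compc h' be]be_all.
apply/eqP/eqP => [e|->//]; have [h' [_ hh']] := endo_inv EIC h.
by rewrite -[f]compId -hh' -compA e gah.
Qed.

Definition chain_functor (l : k) x y (f : hom C x y) : 'M[k]_1 :=
  on_hom (fun f : hom C a b => if f == ga then 1%:M else l%:M) 1%:M f.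

Lemma chain_functorP l : is_functor (@chain_functor l).
Proof.
have out x y (f : hom C x y) : (x, y) != (a, b) -> chain_functor l f = 1%:M.
  by move=> neq; rewrite /chain_functor on_hom_out.
have ab f : @chain_functor l a b f = if f == ga then 1%:M else l%:M.
  by rewrite /chain_functor on_homE.
have naa x : (x, x) != (a, b) by apply/eqP => -[-> e]; move: nab; rewrite e eqxx.
have nca : (a, c) != (a, b) by rewrite xpair_eqE (negPf ncb) andbF.
have ncb' : (c, b) != (a, b) by rewrite xpair_eqE [c == a]eq_sym (negPf nac).
split=> [x y w f g|x]; last by rewrite out.
case: (all3 x) (all3 y) (all3 w) => ex [] ey [] ew; subst x y w;
  try (by case: (no_ba f)); try (by case: (no_ba g)); try (by case: (no_ca f));
  try (by case: (no_ca g)); try (by case: (no_bc f)); try (by case: (no_bc g));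
  rewrite ?ab ?out ?mulmx1 ?mul1mx ?gar ?gal //.
by rewrite (be_all f) (al_all g) eqxx.
Qed.

(** An element f next to the composite gives a Kronecker quiver: the composite acts by 1
    and f by the parameter. *)
Lemma chain_hom_eq (f : hom C a b) : f = ga.
Proof.
apply/eqP; apply: contraT => nf.
have [l [m [neq [phi [uphi fphi]]]]] := collide chain_functorP.
have e1 : phi b = phi a.
  by have := fphi _ _ ga; rewrite /chain_functor !on_homE !eqxx mul1mx mulmx1.
have := fphi _ _ f; rewrite /chain_functor !on_homE (negPf nf) e1.
rewrite mul_scalar_mx mul_mx_scalar => /eqP; rewrite -subr_eq0 -scalerBl scaler_eq0 subr_eq0.
rewrite (negPf neq) /= => /eqP pa0.
by have := uphi a; rewrite pa0 unitmxE det0 unitr0.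
Qed.
End KroneckerChain.

(** * Two flags and a plane *)

Section StarFamily.
Variable k : fieldType.

(** Jordan blocks of sizes 1, 2, 3, 4, each listed from top to socle: the tops u1, ..., u4
    are at positions 0, 1, 3, 6 and the socles s1, ..., s4 at 0, 2, 5, 9. *)
Definition J1234 : 'M[k]_10 :=
  sparse 9 [:: (1, 2, 1%R); (3, 4, 1%R); (4, 5, 1%R); (6, 7, 1%R); (7, 8, 1%R); (8, 9, 1%R)]%N.

Definition star_tops : 'M[k]_10 :=
  sparse 9 [:: (0, 0, 1%R); (1, 2, 1%R); (3, 5, 1%R); (6, 9, 1%R)]%N.

(** The first two basis vectors go to s1 + s3 + s4 and s2 + s3 + l s4. *)
Definition star_plane (l : k) : 'M[k]_10 :=
  sparse 9 [:: (0, 0, 1%R); (0, 5, 1%R); (0, 9, 1%R); (1, 2, 1%R); (1, 5, 1%R); (1, 9, l)]%N.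

Lemma sparse_mul0 n (s t : seq (nat * nat * k)) : in_range n s -> in_range n t ->
  all (fun x => all (fun y => x.1.2 != y.1.1) t) s -> sparse n s *m sparse n t = 0.
Proof.
move=> s_ok t_ok /allP disj; apply: ent_inj => i j le_i le_j.
rewrite ent_sparsel // {2}/ent mxE big1_seq // => x /andP[_ s_x].
case: ifP => // _; have /andP[_ le_x] := allP s_ok _ s_x.
rewrite ent_sparse // big1_seq ?mulr0 // => y /andP[_ t_y].
by have /negPf-> := allP (disj _ s_x) _ t_y.
Qed.

Lemma J1234_nil : J1234 ^+ 4 = 0.
Proof.
rewrite !exprS expr0; apply: ent_inj => i j le_i le_j.
change (@ent k 9 (J1234 *m (J1234 *m (J1234 *m (J1234 *m 1%:M)))) i j = @ent k 9 0 i j); rewrite /J1234.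
have -> : @ent k 9 (0 : 'M[k]_10) i j = 0 by rewrite /ent mxE.
move: le_i; do 10 (case: i => [|i]; first by move=> _;
  do 4 rewrite ?(ent_sparsel, big_cons, big_nil, mul1r, add0r, addr0) //=).
by [].
Qed.

Lemma J1234_tops : J1234 *m star_tops = 0. Proof. exact: sparse_mul0. Qed.
Lemma tops_J1234 : star_tops *m J1234 = 0. Proof. exact: sparse_mul0. Qed.
Lemma plane_J1234 l : star_plane l *m J1234 = 0. Proof. exact: sparse_mul0. Qed.

(** On the span of the socles phi preserves the flag cut out by the images of powers of
    N; since phi and psi agree through [star_tops], it also preserves the flag of the
    images of the kernels of powers.  These flags are opposite, so phi is diagonal on
    the socles, and the plane of [star_plane] then determines l. *)
Lemma star_rigid l m (phi psi zeta : 'M[k]_10) : phi \in unitmx ->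
  J1234 *m phi = phi *m J1234 -> J1234 *m psi = psi *m J1234 ->
  star_tops *m phi = psi *m star_tops -> star_plane l *m phi = zeta *m star_plane m -> l = m.
Proof.
move=> uphi cphi cpsi eal ebe.
have c i j : @ent k 9 (J1234 *m phi) i j = @ent k 9 (phi *m J1234) i j by rewrite cphi.
have d i j : @ent k 9 (J1234 *m psi) i j = @ent k 9 (psi *m J1234) i j by rewrite cpsi.
have A i j : @ent k 9 (star_tops *m phi) i j = @ent k 9 (psi *m star_tops) i j by rewrite eal.
have B i j : @ent k 9 (star_plane l *m phi) i j = @ent k 9 (zeta *m star_plane m) i j by rewrite ebe.
rewrite /J1234 in c d; rewrite /star_tops in A; rewrite /star_plane in B.
have e20 : @ent k 9 phi 2%N 0%N = 0 by entries c 1%N 0%N.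
have e50 : @ent k 9 phi 5%N 0%N = 0 by entries c 4%N 0%N.
have e90 : @ent k 9 phi 9%N 0%N = 0 by entries c 8%N 0%N.
have e52 : @ent k 9 phi 5%N 2%N = 0 by entries c 4%N 2%N => ->; entries c 3%N 1%N.
have e92 : @ent k 9 phi 9%N 2%N = 0 by entries c 8%N 2%N => ->; entries c 7%N 1%N.
have e95 : @ent k 9 phi 9%N 5%N = 0.
  by entries c 8%N 5%N => ->; entries c 7%N 4%N => ->; entries c 6%N 3%N.
have f01 : @ent k 9 psi 0%N 1%N = 0 by entries d 0%N 2%N.
have f03 : @ent k 9 psi 0%N 3%N = 0 by entries d 0%N 4%N.
have f06 : @ent k 9 psi 0%N 6%N = 0 by entries d 0%N 7%N.
have f13 : @ent k 9 psi 1%N 3%N = 0 by entries d 1%N 4%N => <-; entries d 2%N 5%N.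
have f16 : @ent k 9 psi 1%N 6%N = 0 by entries d 1%N 7%N => <-; entries d 2%N 8%N.
have f36 : @ent k 9 psi 3%N 6%N = 0.
  by entries d 3%N 7%N => <-; entries d 4%N 8%N => <-; entries d 5%N 9%N.
have e02 : @ent k 9 phi 0%N 2%N = 0 by entries A 0%N 2%N => ->.
have e05 : @ent k 9 phi 0%N 5%N = 0 by entries A 0%N 5%N => ->.
have e09 : @ent k 9 phi 0%N 9%N = 0 by entries A 0%N 9%N => ->.
have e25 : @ent k 9 phi 2%N 5%N = 0 by entries A 1%N 5%N => ->.
have e29 : @ent k 9 phi 2%N 9%N = 0 by entries A 1%N 9%N => ->.
have e59 : @ent k 9 phi 5%N 9%N = 0 by entries A 3%N 9%N => ->.
have z01 : @ent k 9 zeta 0%N 1%N = 0 by entries B 0%N 2%N; rewrite e02 e52 e92 !addr0.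
have z10 : @ent k 9 zeta 1%N 0%N = 0 by entries B 1%N 0%N; rewrite e20 e50 e90 mulr0 !addr0.
have E1 : @ent k 9 phi 5%N 5%N = @ent k 9 zeta 0%N 0%N.
  by entries B 0%N 5%N; rewrite e05 e95 z01 add0r !addr0.
have E2 : @ent k 9 phi 9%N 9%N = @ent k 9 zeta 0%N 0%N.
  by entries B 0%N 9%N; rewrite e09 e59 z01 mul0r !add0r addr0.
have E3 : @ent k 9 phi 5%N 5%N = @ent k 9 zeta 1%N 1%N.
  by entries B 1%N 5%N; rewrite e25 e95 z10 mulr0 !add0r addr0.
have : (l - m) * @ent k 9 phi 9%N 9%N = 0.
  entries B 1%N 9%N; rewrite e29 e59 z10 !add0r mulrBl => ->.
  by rewrite -E3 E1 E2 mulrC subrr.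
move/eqP; rewrite mulf_eq0 subr_eq0 => /orP[/eqP//|/eqP e99].
exfalso; apply: (unit_row (i := 9) uphi) => j le_j.
by case: j le_j => [|[|[|[|[|[|[|[|[|[|j]]]]]]]]]] //= _;
  [entries A 6%N 1%N | entries A 6%N 3%N | entries A 6%N 4%N | entries A 6%N 6%N
  | entries A 6%N 7%N | entries A 6%N 8%N].
Qed.
End StarFamily.

(** * Shapes of the categories of finite type *)

Section FiniteTypeShape.
Variables (k : fieldType) (p : nat).
Hypotheses (char_p : p \in [pchar k]) (p_ge5 : (5 <= p)%N).
Variable C : fincat.
Hypotheses (EIC : EI C) (skel : skeletal C).
Hypothesis collide : families_collide k C.
Hypothesis pgr : forall x : ob C, (p.-group [set: autc C x])%g.
Hypothesis card3 : #|ob C| = 3.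

Lemma other_object (a b : ob C) : exists z, z != a /\ z != b.
Proof.
have /subsetPn[z _] : ~~ ([set: ob C] \subset [set a; b]).
  apply/negP => /subset_leq_card; rewrite cardsT card3 cards2.
  by case: (a != b).
by rewrite !inE negb_or => /andP[za zb]; exists z.
Qed.

Lemma all_objects (a b c : ob C) : uniq [:: a; b; c] -> forall w, [\/ w = a, w = b | w = c].
Proof.
move=> un w; have : w \in [:: a; b; c].
  have [_ ->] := uniq_min_size un (fun x _ => mem_enum (ob C) x)
    (eq_leq (etrans (esym (cardE (ob C))) card3)).
  by rewrite mem_enum.
by rewrite !inE => /or3P[] /eqP e; [constructor 1 | constructor 2 | constructor 3].
Qed.

Let cyc x : cyclic [set: autc C x] := collide_cyclic char_p EIC skel collide other_object (pgr x).

Lemma back_false x y (f : hom C x y) (g : hom C y x) : x != y -> False.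
Proof. by rewrite (no_back EIC skel f g) eqxx. Qed.

(** With an object c between a and b, the pairs (a, c) and (c, b) are convex and the
    previous section applies to the composite. *)
Lemma hom_eq a b (f1 f2 : hom C a b) : a != b -> f1 = f2.
Proof.
move=> nab; have [c [nca ncb]] := other_object a b; have nac : a != c by rewrite eq_sym.
have all3 : forall w, [\/ w = a, w = b | w = c].
  by apply: all_objects; rewrite /= !inE negb_or nab nac eq_sym ncb.
have ceq := convex_hom_eq char_p p_ge5 EIC skel collide other_object pgr.
case: (classic (inhabited (hom C a c))) => [[al]|no_al]; last first.
  apply: ceq => // w f g nwa nwb; case: (all3 w) => ew; subst w.
  - by rewrite eqxx in nwa.
  - by rewrite eqxx in nwb.
  by apply: no_al; exists.
case: (classic (inhabited (hom C c b))) => [[be]|no_be]; last first.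
  apply: ceq => // w f g nwa nwb; case: (all3 w) => ew; subst w.
  - by rewrite eqxx in nwa.
  - by rewrite eqxx in nwb.
  by apply: no_be; exists.
have al_all (f : hom C a c) : f = al.
  apply: ceq => // w f' g nwa nwc; case: (all3 w) => ew; subst w.
  - by rewrite eqxx in nwa.
  - exact: back_false be f' ncb.
  by rewrite eqxx in nwc.
have be_all (f : hom C c b) : f = be.
  apply: ceq => // w f' g nwc nwb; case: (all3 w) => ew; subst w.
  - exact: back_false al g nac.
  - by rewrite eqxx in nwb.
  by rewrite eqxx in nwc.
have ga_all := chain_hom_eq EIC skel collide nab nac ncb all3 al_all be_all.
by rewrite (ga_all f1) (ga_all f2).
Qed.

Lemma hom_card a b : a != b -> #|hom C a b| = (0 < #|hom C a b|)%N :> nat.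
Proof.
move=> nab; case: posnP => [->//|/card_gt0P[f _]].
by apply/eqP; rewrite eqn_leq; apply/andP; split; [apply/card_le1P => g _ h; rewrite !inE (hom_eq g h) ?eqxx | apply/card_gt0P; exists f].
Qed.

(** As p divides the order of the group, exponents of the generator are well defined
    modulo p. *)
Lemma exists_log x : (p %| #|[set: autc C x]|)%N ->
  exists j : hom C x x -> nat, (forall f g, j (compc f g) = j g + j f %[mod p])%N /\
    exists f, j f = 1 %[mod p].
Proof.
move=> p_dvd; have ex f : exists i, f == gen_pow cyc x i.
  by have [i ->] := gen_powP EIC cyc f; exists i.
pose j f := xchoose (ex f); have jP f : f = gen_pow cyc x (j f) := eqP (xchooseP (ex f)).
have modj i i' : gen_pow cyc x i = gen_pow cyc x i' -> i = i' %[mod p].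
  move=> /val_inj/eqP; rewrite eq_expg_mod_order => /eqP e.
  have p_ord : (p %| #[aut_gen cyc x]%g)%N by rewrite orderE -aut_genP.
  by rewrite -(modn_dvdm i p_ord) e modn_dvdm.
exists j; split=> [f g|]; last by exists (gen_pow cyc x 1); apply: modj; rewrite -jP.
by apply: modj; rewrite -jP addnC gen_powD -!jP.
Qed.

(** The sources x and z carry [J1234], acted on by the group of x, and a plane; the sink y
    carries [J1234]. *)
Lemma sink_groups (x y z : ob C) : uniq [:: x; y; z] -> hom C x y -> hom C z y ->
    (hom C x z -> False) -> (hom C z x -> False) ->
  (p %| #|[set: autc C x]|)%N -> (p %| #|[set: autc C y]|)%N -> False.
Proof.
move=> un al be nxz nzx px py; have all3 := all_objects un.
move: un; rewrite /= !inE negb_or andbT => /andP[/andP[nxy nxz'] nyz].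
have nzy : z != y by rewrite eq_sym.
have [iG [iGM [g g1]]] := exists_log px; have [iH [iHM [h h1]]] := exists_log py.
pose U : 'M[k]_10 := 1 + J1234 k.
have Jp : J1234 k ^+ p = 0.
  rewrite -(subnKC (leq_trans (isT : (4 <= 5)%N) p_ge5)) exprD J1234_nil.
  exact: mul0r.
have U_mod i j : i = j %[mod p] -> U ^+ i = U ^+ j by apply: unipotent_expr_mod.
have UD i j : U ^+ (i + j) = U ^+ i *m U ^+ j by rewrite exprD.
have Ual i : star_tops k = U ^+ i *m star_tops k.
  elim: i => [|i IH]; first by rewrite expr0 mul1mx.
  by rewrite exprSr -mulmxE -mulmxA [U *m _]mulmxDl J1234_tops addr0 mul1mx.
have alU i : star_tops k = star_tops k *m U ^+ i.
  elim: i => [|i IH]; first by rewrite expr0 mulmx1.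
  by rewrite exprS -mulmxE mulmxA [_ *m U]mulmxDr tops_J1234 addr0 mulmx1.
have beU l i : star_plane l = star_plane l *m U ^+ i.
  elim: i => [|i IH]; first by rewrite expr0 mulmx1.
  by rewrite exprS -mulmxE mulmxA [_ *m U]mulmxDr plane_J1234 addr0 mulmx1.
have conv c (f : hom C c y) (f' : hom C x c) : c != x -> c != y -> star_tops k = 0.
  by case: (all3 c) => ec; subst c; rewrite ?eqxx //; case: (nxz f').
have conv' l c (f : hom C c y) (f' : hom C z c) : c != z -> c != y -> star_plane l = 0 :> 'M[k]_10.
  by case: (all3 c) => ec; subst c; rewrite ?eqxx //; case: (nzx f').
have [l [m [neq [pa [pb [pz [[_ upb _] fa fb fab fzb]]]]]]] :=
  @sink_collide k C EIC skel collide 10 x y z (fun _ g => U ^+ iG g) (fun h => U ^+ iH h)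
   (fun _ _ => star_tops k) (fun l _ => star_plane l) nxy nzy nxz'
   (fun _ f g => etrans (U_mod _ _ (iGM f g)) (UD _ _)) (fun=> U_mod _ _ (log_id iGM))
   (fun f g => etrans (U_mod _ _ (iHM f g)) (UD _ _)) (U_mod _ _ (log_id iHM))
   (fun _ _ _ => Ual _) (fun _ _ _ => alU _) (fun _ _ _ => erefl) (fun _ _ _ => beU _ _)
   (fun _ => conv) conv'.
have U_comm (M : 'M[k]_10) : U *m M = M *m U -> J1234 k *m M = M *m J1234 k.
  by rewrite /U [_ *m M]mulmxDl [M *m _]mulmxDr mul1mx mulmx1 => /addrI.
case/negP: neq; apply/eqP; apply: (star_rigid upb (psi := pa) (zeta := pz)).
- by have := fb h; rewrite (U_mod _ _ h1) expr1 => /U_comm.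
- by have := fa g; rewrite (U_mod _ _ g1) expr1 => /U_comm.
- exact: fab al.
exact: fzb be.
Qed.

Lemma three_cyclic (x y z : ob C) : uniq [:: x; y; z] -> exists r s t, cyclic_three p r s t x y z.
Proof.
move=> un; have [r cx] := p_natP (pgr x); have [s cy] := p_natP (pgr y).
have [t cz] := p_natP (pgr z); exists r, s, t; split=> //; split=> // w.
by rewrite !inE; case: (all_objects un w) => ->; rewrite eqxx ?orbT.
Qed.

Lemma hom_mem (l : seq (ob C * ob C)) :
    (forall a b, (a, b) \in l -> inhabited (hom C a b)) ->
    (forall a b, a != b -> (a, b) \notin l -> hom C a b -> False) ->
  forall a b, a != b -> #|hom C a b| = ((a, b) \in l) :> nat.
Proof.
move=> inl notl a b nab; rewrite hom_card //; congr (nat_of_bool _).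
apply/idP/idP => [/card_gt0P[f _]|/inl[f]]; last by apply/card_gt0P; exists f.
by apply: contraT => nin; case: (notl _ _ nab nin f).
Qed.

Lemma chain_listed (x y z : ob C) : uniq [:: x; y; z] -> hom C x y -> hom C y z -> listed p C.
Proof.
move=> un al be; have [r [s [t three]]] := three_cyclic un; have all3 := all_objects un.
constructor 1; exists r, s, t, x, y, z; split=> //.
move: un; rewrite /= !inE negb_or andbT => /andP[/andP[nxy nxz] nyz].
apply: hom_mem => [a b|a b nab].
  rewrite !inE !xpair_eqE => /or3P[] /andP[/eqP-> /eqP->]; exists => //.
  exact: compc be al.
case: (all3 a) nab => ->; case: (all3 b) => ->; rewrite ?eqxx // !inE ?eqxx ?orbT //= => _ _ f.
- exact: back_false al f nxy.
- exact: back_false (compc be al) f nxz.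
exact: back_false be f nyz.
Qed.

Lemma sink_listed (x y z : ob C) : uniq [:: x; y; z] -> hom C x y -> hom C z y ->
  (hom C x z -> False) -> (hom C z x -> False) -> listed p C.
Proof.
move=> un al be noxz nozx; have [r [s [t three]]] := three_cyclic un.
have all3 := all_objects un; have sec : second_family p r s t C.
  exists x, y, z; split=> //; apply: hom_mem => [a b|a b nab].
    by rewrite !inE !xpair_eqE => /orP[] /andP[/eqP-> /eqP->]; exists.
  move: un; rewrite /= !inE negb_or andbT => /andP[/andP[nxy nxz] nyz].
  case: (all3 a) nab => ->; case: (all3 b) => ->; rewrite ?eqxx // ?inE ?eqxx ?orbT //= => _ _ f.
    exact: back_false al f nxy.
  by apply: back_false be f _; rewrite eq_sym.
case: three => _ _ [_ cx] [_ cy] [_ cz].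
have dvd_p e : (0 < e)%N -> (p %| p ^ e)%N by move=> e0; apply: dvdn_exp.
have [s0|s_gt0] := posnP s; first by constructor 2; exists r, s, t.
constructor 3; exists r, s, t; split=> //.
have un' : uniq [:: z; y; x] by rewrite -(rev_uniq [:: z; y; x]).
split; apply/eqP; rewrite -leqn0 leqNgt; apply/negP => e_gt0.
  by apply: (sink_groups un al be noxz nozx); rewrite ?cx ?cy dvd_p.
by apply: (sink_groups un' be al nozx noxz); rewrite ?cz ?cy dvd_p.
Qed.
End FiniteTypeShape.

Lemma card_autc C (EIC : EI C) x : #|[set: autc C x]| = #|hom C x x|.
Proof.
rewrite cardsT; apply: (bij_eq_card (f := @aut_val C x)).
exists (fun f => MkAut (EIC x f)) => [f|//]; exact: val_inj.
Qed.

Lemma pgroup_op C p : EI C -> (forall x : ob C, (p.-group [set: autc C x])%g) ->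
  forall x : ob (opcat C), (p.-group [set: autc (opcat C) x])%g.
Proof.
move=> EIC pgr x; rewrite /pgroup card_autc; last exact: EI_op.
by have := pgr x; rewrite /pgroup card_autc.
Qed.

Lemma connected_neighbour C (x y : ob C) : cat_connected C -> x != y ->
  exists w, w != x /\ (inhabited (hom C x w) \/ inhabited (hom C w x)).
Proof.
move=> [_ conn] nxy; apply: NNPP => no.
have /connectP[q path_q last_q] := conn x y.
have : last x q = x.
  elim: q x path_q no {last_q nxy} => //= w q IH x /andP[xw path_q] no.
  have ew : w = x.
    apply/eqP; apply: contraT => nwx; case: no; exists w; split=> //.
    by case/orP: xw => /card_gt0P[f _]; [left | right]; exists.
  by subst w; apply: IH.
by rewrite -last_q => /eqP; rewrite eq_sym (negPf nxy).
Qed.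

(** Every object has a neighbour; three objects cannot be joined in disjoint pairs. *)
Lemma exists_middle C : #|ob C| = 3 -> cat_connected C ->
  exists x y z : ob C, [/\ uniq [:: x; y; z],
    inhabited (hom C x y) \/ inhabited (hom C y x) &
    inhabited (hom C z y) \/ inhabited (hom C y z)].
Proof.
move=> card3 conn; have [x _] := conn.1.
have third := other_object card3; have [y0 [ny0x _]] := third x x.
have nxy0 : x != y0 by rewrite eq_sym.
have [y [nyx exy]] := connected_neighbour conn nxy0.
have [z [nzx nzy]] := third x y.
have [w [nwz ezw]] := connected_neighbour conn nzx.
have all3 : forall w, [\/ w = x, w = y | w = z].
  by apply: (all_objects card3); rewrite /= !inE negb_or eq_sym nyx eq_sym nzx eq_sym nzy.
case: (all3 w) nwz ezw => -> nwz ezw; last by rewrite eqxx in nwz.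
  exists y, x, z; split.
  - by rewrite /= !inE negb_or nyx eq_sym nzy eq_sym nzx.
  - by case: exy; [right | left].
  exact: ezw.
exists x, y, z; split=> //.
by rewrite /= !inE negb_or eq_sym nyx eq_sym nzx eq_sym nzy.
Qed.

Local Close Scope ring_scope.

Theorem proposition5p1 (k : closedFieldType) (p : nat)
    (char_k : p \in [pchar k]%R) (p_ge5 : 5 <= p)
    (C : fincat) (C_EI : EI C) (C_skel : skeletal C) (C_conn : cat_connected C)
    (C_three : #|ob C| = 3)
    (C_pgroups : forall x : ob C, (p.-group [set: autc C x])%g) :
  finite_rep_type (catalg k C) <->
  listed p C \/ listed p (opcat C).
Proof.
split; last exact: listed_finite_type.
move=> /finite_type_collide collide.
have chain := chain_listed char_k p_ge5 C_EI C_skel collide C_pgroups C_three.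
have sink := sink_listed char_k p_ge5 C_EI C_skel collide C_pgroups C_three.
have sink_op := @sink_listed k p char_k p_ge5 (opcat C) (EI_op C_EI) (skeletal_op C_skel)
  (families_collide_op collide) (pgroup_op C_EI C_pgroups) C_three.
have [x [y [z [un exy ezy]]]] := exists_middle C_three C_conn.
have perms : [/\ uniq [:: z; y; x], uniq [:: x; z; y], uniq [:: z; x; y],
    uniq [:: y; x; z] & uniq [:: y; z; x]].
  by move: un; rewrite /= !inE !negb_or !andbT ![_ == x]eq_sym ![z == y]eq_sym
    => /andP[/andP[-> ->] ->].
have [un1 un2 un3 un4 un5] := perms.
(* The middle object y is a sink, passed through, or a source; in the first and last
   cases an arrow between x and z gives a chain through another object. *)
case: exy ezy => [[xy]|[yx]] [[zy]|[yz]].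
- case: (classic (inhabited (hom C x z))) => [[xz]|noxz].
    by left; exact: chain un2 xz zy.
  case: (classic (inhabited (hom C z x))) => [[zx]|nozx].
    by left; exact: chain un3 zx xy.
  by left; apply: (sink _ _ _ un xy zy) => f; [apply: noxz | apply: nozx]; exists.
- by left; exact: chain un xy yz.
- by left; exact: chain un1 zy yx.
case: (classic (inhabited (hom C x z))) => [[xz]|noxz].
  by left; exact: chain un4 yx xz.
case: (classic (inhabited (hom C z x))) => [[zx]|nozx].
  by left; exact: chain un5 yz zx.
by right; apply: (sink_op x y z un yx yz) => f; [apply: nozx | apply: noxz]; exists.
Qed.
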